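(* Let $T\subset\mathbb{R}^2$ be the open triangle with vertices $(0,0)$, $(1,0)$, $(0,1)$, and let $\delta\in\mathbf{H}^{-3/2,-1/2}(\partial T)\subset H^2(T)'$ denote the Dirac distribution supported at $(0,0)$, that is, $\langle\delta,z\rangle_{\partial T}=z(0,0)$ for $z\in H^2(T)$. Then $$\mathrm{tr}_T^{2,\Delta}(v_\varepsilon)\to-\delta\quad(\varepsilon\to0)\quad\text{in } H^2(T)'.$$
   Context: $(\cdot,\cdot)_T$, $\|\cdot\|_T$ are the $L_2(T)$ inner product and norm (scalar or tensor functions). $H(\Delta,T)$ is the closure of $\mathcal{D}(\overline T)$ (functions smooth up to the boundary) in the norm $(\|z\|_T^2+\|\Delta z\|_T^2)^{1/2}$; $H^2(T)$ carries the norm $\|z\|_{2,T}=(\|z\|_T^2+\|D^2z\|_T^2)^{1/2}$, $D^2z$ the Hessian, and $H^2(T)'$ the corresponding dual norm. Trace operator $\mathrm{tr}_T^{2,\Delta}:H(\Delta,T)\to H^2(T)'$: $\langle\mathrm{tr}_T^{2,\Delta}(v),z\rangle_{\partial T}=(\Delta z,v)_T-(z,\Delta v)_T$ for $z\in H^2(T)$. $\mathbf{H}^{-3/2,-1/2}(\partial T)\subset H^2(T)'$ is the set of functionals $z\mapsto(\mathrm{div}\,\mathbf{Div}\,\Theta,z)_T-(\Theta,D^2z)_T$, where $\Theta\in H(\mathrm{div}\,\mathbf{Div},T)$, the closure of smooth symmetric tensors on $T$ in the norm $(\|\Theta\|_T^2+\|\mathrm{div}\,\mathbf{Div}\,\Theta\|_T^2)^{1/2}$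 ($\mathbf{Div}$ is the row-wise divergence). For $\varepsilon\in(0,1)$ let $\phi_\varepsilon(t)=C\,\frac1\varepsilon e^{-\varepsilon^2/(\varepsilon^2-t^2)}$ for $t\in[0,\varepsilon)$ and $\phi_\varepsilon(t)=0$ for $t\ge\varepsilon$, where $C>0$ is chosen such that $\int_0^1\phi_\varepsilon(t)\,dt=1/2$ ($C$ is independent of $\varepsilon$). Define $v_\varepsilon\in C^\infty(T)$ by $v_\varepsilon(x,y)=-(x+y)\,\phi_\varepsilon(|(x,y)|)$, where $|\cdot|$ is the Euclidean norm. *)

(* Defs.v *)
From HB Require Import structures.
From mathcomp Require Import all_boot all_order all_algebra.
From mathcomp Require Import all_classical all_reals all_analysis.

Set Implicit Arguments.
Unset Strict Implicit.
Unset Printing Implicit Defensive.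

Import Order.TTheory GRing.Theory Num.Theory.
Import numFieldNormedType.Exports.
Local Open Scope classical_set_scope.
Local Open Scope ring_scope.

(* Elements of L_2(T) are represented by functions R * R -> R of which only the
   values on T matter.  Weak derivatives are picked by choice among the
   L_2(T) functions satisfying the defining identity; they are unique up to a
   null set, and only integrals of them are used. *)

Notation lebesgue2 := (lebesgue_measure \x lebesgue_measure)%E.

Section Plane.
Variable R : realType.
Implicit Types (f g v z phi : R * R -> R) (p : R * R).
Implicit Types (Theta Psi : 'I_2 -> 'I_2 -> R * R -> R).
Implicit Types l : (R * R -> R) -> R.

Definition triangle : set (R * R) :=
  [set p | [/\ 0 < p.1, 0 < p.2 & p.1 + p.2 < 1]].

Definition basis (i : 'I_2) : R * R := if i == 0 then (1, 0) else (0, 1).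

Definition pd (i : 'I_2) f : R * R -> R := fun p => 'D_(basis i) f p.

(* [pds [:: i; j] f] is d_i (d_j f). *)
Definition pds (w : seq 'I_2) f : R * R -> R := foldr pd f w.

Definition smooth f : Prop :=
  forall w : seq 'I_2, continuous (pds w f) /\
    (forall (i : 'I_2) p, derivable (pds w f) p (basis i)).

Definition laplace f : R * R -> R := fun p => \sum_(i < 2) pds [:: i; i] f p.

(* C_c^infty(T), extended by zero to the plane. *)
Definition test f : Prop :=
  smooth f /\ exists K : set (R * R),
    [/\ compact K, K `<=` triangle & forall p, ~ K p -> f p = 0].

Definition L2 f : Prop := (f \_ triangle) \in Lfun lebesgue2 2%:E.

Definition ip f g : R := (\int[lebesgue2]_(p in triangle) (f p * g p))%R.

Definition ipt Theta Psi : R := \sum_(i < 2) \sum_(j < 2) ip (Theta i j) (Psi i j).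

Definition is_wD (w : seq 'I_2) z g : Prop :=
  L2 g /\ forall phi, test phi -> ip z (pds w phi) = (-1) ^+ size w * ip g phi.

Definition wD (w : seq 'I_2) z : R * R -> R := xget (fun=> 0) (is_wD w z).

Definition hessian z : 'I_2 -> 'I_2 -> R * R -> R := fun i j => wD [:: i; j] z.

Definition is_wlaplace v g : Prop :=
  L2 g /\ forall phi, test phi -> ip v (laplace phi) = ip g phi.

Definition wlaplace v : R * R -> R := xget (fun=> 0) (is_wlaplace v).

(* The functions of D(closure T) are the restrictions to T of smooth functions
   on the plane. *)

Definition norm_Lap v : R := Num.sqrt (ip v v + ip (wlaplace v) (wlaplace v)).

Definition HLap v : Prop :=
  [/\ L2 v, exists g, is_wlaplace v g &
   forall e : R, 0 < e -> exists f, smooth f /\ norm_Lap (v \- f) < e].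

Definition H2 z : Prop :=
  L2 z /\ forall w : seq 'I_2, (size w <= 2)%N -> exists g, is_wD w z g.

Definition norm_H2 z : R := Num.sqrt (ip z z + ipt (hessian z) (hessian z)).

(* H^2(T)': bounded linear functionals on H^2(T).  A functional is given as a
   function on all of R * R -> R; its values outside H^2(T) are irrelevant. *)
Definition H2dual l : Prop :=
  (forall (a : R) z z', H2 z -> H2 z' -> l (a \*: z \+ z') = a * l z + l z') /\
  (exists M : R, forall z, H2 z -> `|l z| <= M * norm_H2 z).

Definition norm_H2dual l : \bar R :=
  ereal_sup [set x | exists z, [/\ H2 z, norm_H2 z <= 1 & x = `|l z|%:E]].

Definition tr_Lap v z : R := ip (wlaplace z) v - ip z (wlaplace v).

Definition is_divDiv Theta g : Prop :=
  L2 g /\ forall phi, test phi ->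
    ipt Theta (fun i j => pds [:: i; j] phi) = ip g phi.

Definition divDiv Theta : R * R -> R := xget (fun=> 0) (is_divDiv Theta).

Definition norm_divDiv Theta : R :=
  Num.sqrt (ipt Theta Theta + ip (divDiv Theta) (divDiv Theta)).

Definition HdivDiv Theta : Prop :=
  [/\ forall i j, L2 (Theta i j), exists g, is_divDiv Theta g &
   forall e : R, 0 < e -> exists Psi,
     [/\ forall i j, smooth (Psi i j), forall i j p, Psi i j p = Psi j i p &
      norm_divDiv (fun i j => Theta i j \- Psi i j) < e]].

(* The space H^{-3/2,-1/2}(boundary of T), a subset of H^2(T)'. *)
Definition Hdual_divDiv l : Prop :=
  H2dual l /\ exists2 Theta, HdivDiv Theta &
    forall z, H2 z -> l z = ip (divDiv Theta) z - ipt Theta (hessian z).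

(* Point values of z in H^2(T) on the closure of T are those of its
   representative that is continuous there (Sobolev embedding). *)
Definition crep z : R * R -> R :=
  xget z [set g | {within closure triangle, continuous g} /\
                  {ae lebesgue2, forall p, triangle p -> g p = z p}].

Definition delta0 z : R := crep z (0, 0).

(* Only used for t >= 0. *)
Definition phi_eps (C eps t : R) : R :=
  if t < eps then C * eps^-1 * expR (- (eps ^+ 2 / (eps ^+ 2 - t ^+ 2))) else 0.

Definition v_eps (C eps : R) : R * R -> R :=
  fun p => - (p.1 + p.2) * phi_eps C eps (Num.sqrt (p.1 ^+ 2 + p.2 ^+ 2)).

End Plane.

(* Main.v *)
Require Import Defs.
From mathcomp Require Import all_boot all_order all_algebra.
From mathcomp Require Import all_classical all_reals all_analysis.
From mathcomp Require Import measurable_realfun.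
From mathcomp Require Import ring lra.

Set Implicit Arguments.
Unset Strict Implicit.
Unset Printing Implicit Defensive.

Import Order.TTheory GRing.Theory Num.Theory.
Import numFieldNormedType.Exports.
Local Open Scope classical_set_scope.
Local Open Scope ring_scope.
Local Notation "f ^` ()" := (derive1 f) : ring_scope.
Local Notation basis := Defs.basis.

(** Let Theta be a smooth symmetric tensor that vanishes near the hypotenuse and
    satisfies Theta_nn = 0 and d_n Theta_nn + 2 d_t Theta_nt = 0 on both legs
    (n normal, t tangential).  Integrating by parts, with a cut-off away from the
    legs, only leaves a corner term:
      (div Div Theta, z) - (Theta, D^2 z) = - 2 Theta_xy(0,0) z(0,0).
    Let b be a cut-off function, equal to 1 near 0, let P(t) be the integral of
    phi_eps over (t, 1), so that P(0) = 1/2, and Pi(t) the integral of P over (0, t).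
    The tensor Theta = v_eps I + K with
      K_xx = Pi(x) b(x) b'(y) + b(x) y phi_eps(y),
      K_yy = Pi(y) b(y) b'(x) + b(y) x phi_eps(x),
      K_xy = - (b(x) P(y) + P(x) b(y)) / 2
    satisfies these conditions, with Theta_xy(0,0) = - 1/2.  Hence its functional
    is the Dirac distribution.  As the functional of v_eps I is the negative
    trace of v_eps, the trace of v_eps plus the Dirac distribution is the
    functional of K.  Its norm is at most that of K and div Div K in L_2(T).
    The terms of order 1/eps cancel in
      div Div K = Pi(eps) (b''(x) b'(y) + b'(x) b''(y))
                  + b''(x) y phi_eps(y) + b''(y) x phi_eps(x),
    so that K and div Div K are bounded and tend to 0 pointwise.

    Point values make sense because near (0,0) a function z of H^2(T), times a
    cut-off, is the double integral of its mixed derivative, which is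
    continuous; an affine map of order 3 brings the other corners to (0,0). *)

(** The trace cannot be estimated through [v_eps] directly: its L_2 norm is of order eps, but that
    of its Laplacian is of order 1/eps. Other tensors represent the same kind of functional, and the
    task is to find one with small norms. The entries of K are dictated by the legs. On x = 0 one
    has v_eps = - y phi_eps(y) and d_x v_eps = - phi_eps(y). The first is cancelled by b(x) y
    phi_eps(y) in K_xx. For the second, 2 d_y K_xy has to produce phi_eps(y), which asks for -
    P(y)/2 in K_xy; the other leg asks for - P(x)/2. Both are - 1/4 at the corner, so the mass 1/2
    of phi_eps is what fixes the factor of the Dirac distribution. As P(x) is 1/2 on x = 0, cutting
    it off by b(y) adds - b'(y)/2 to the flux. The term Pi(x) b(x) b'(y) repairs this: it vanishes
    on x = 0 and has the normal derivative P(0) b'(y) = b'(y)/2 there. Since Pi'' = - phi_eps, it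
    also removes phi_eps(x) b'(y) from 2 d_x d_y K_xy. *)

(** * Calculus of smooth functions on the line and on the plane *)

Section SmoothFunctions.
Variable R : realType.
Implicit Types (f g : R * R -> R) (e : R -> R) (p : R * R).

Lemma derive_line f p v : 'D_v f p = (fun h : R => f (h *: v + p))^`() 0.
Proof.
rewrite /derive derive1E /derive; do 2 f_equal.
by apply/funext => h; rewrite /= addr0 scale0r add0r /GRing.scale /= mulr1.
Qed.

Lemma is_derive_line f p v b :
  is_derive p v f b <-> is_derive (0 : R) 1 (fun h : R => f (h *: v + p)) b.
Proof.
split=> -[d E]; split.
- by move/derivable1P : d.
- by rewrite -derive1E -derive_line.
- by apply/derivable1P.
- by rewrite derive_line derive1E.
Qed.

Lemma is_derive_comp_line e f p v a b :
  is_derive p v f b -> is_derive (f p) 1 e a ->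
  is_derive p v (e \o f) (a * b).
Proof.
move=> /is_derive_line df de; apply/is_derive_line.
apply: (@is_derive1_comp _ e (fun h : R => f (h *: v + p)) 0) => //.
by rewrite scale0r add0r.
Qed.

(** Regularity of finite order: the derivative of a product or a composition contains
    undifferentiated factors, so closure properties are proved by induction on the order. *)
Fixpoint Dk n e : Prop :=
  if n is n'.+1 then (forall x, derivable e x 1) /\ Dk n' e^`() else True.

Definition smooth1 e := forall n, Dk n e.

Fixpoint Ck n f : Prop := continuous f /\
  if n is n'.+1 then
    forall i, (forall p, derivable f p (basis R i)) /\ Ck n' (pd i f)
  else True.

Lemma Dk1 n e : Dk n.+1 e -> Dk n e.
Proof. by elim: n e => //= n IH e [d H]; split=> //; exact: IH. Qed.

Lemma Ck_cont n f : Ck n f -> continuous f.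
Proof. by case: n => [|n] []. Qed.

Lemma Ck1 n f : Ck n.+1 f -> Ck n f.
Proof.
elim: n f => [|n IH] f /= [c H]; first by [].
by split=> // i; have [d C] := H i; split=> //; exact: IH.
Qed.

Lemma smooth1_derivable e : smooth1 e -> forall x, derivable e x 1.
Proof. by move=> /(_ 1%N) []. Qed.

Lemma smooth1_cont e : smooth1 e -> continuous e.
Proof.
move=> se x; apply: differentiable_continuous.
by apply/derivable1_diffP; exact: smooth1_derivable.
Qed.

Lemma smooth1_derive1 e : smooth1 e -> smooth1 e^`().
Proof. by move=> se n; have [] := se n.+1. Qed.

Lemma smooth1_intro e : (forall x, derivable e x 1) -> smooth1 e^`() -> smooth1 e.
Proof. by move=> d s [|n] //=; split. Qed.

(** In [pds] the head of the word is the outermost derivative, whereas [Ck] peels off the innermost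
    one; hence the induction from the end of the word. *)
Lemma smoothE f : smooth f <-> forall n, Ck n f.
Proof.
split=> [sf n|H w].
  have {sf} : forall w, continuous (pds w f) /\
     (forall i p, derivable (pds w f) p (basis R i)) by [].
  elim: n f => [|n IH] f sf /=; first by split=> //; have [] := sf [::].
  split; first by have [] := sf [::].
  move=> i; split; first by move=> p; have [_] := sf [::]; exact.
  by apply: IH => w; have := sf (rcons w i); rewrite /pds foldr_rcons.
elim/last_ind: w f H => [|w i IH] f H.
  split; first exact: (Ck_cont (H 0%N)).
  by move=> i p; have [_] := H 1%N; move=> /(_ i) [].
rewrite /pds foldr_rcons; apply: IH => n.
by have [_] := H n.+1; move=> /(_ i) [].
Qed.

Lemma smooth_cont f : smooth f -> continuous f.
Proof. by move=> /(_ [::]) []. Qed.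

Lemma smooth_derivable f i p : smooth f -> derivable f p (basis R i).
Proof. by move=> /(_ [::]) [_]; exact. Qed.

Lemma smooth_pds w f : smooth f -> smooth (pds w f).
Proof. by move=> sf w'; rewrite /pds -foldr_cat; exact: sf. Qed.

Lemma smooth_pd i f : smooth f -> smooth (pd i f).
Proof. exact: (@smooth_pds [:: i]). Qed.

Lemma derivable_cont1 e : (forall x, derivable e x 1) -> continuous e.
Proof.
by move=> d x; apply: differentiable_continuous; apply/derivable1_diffP.
Qed.

Lemma DkD n e1 e2 : Dk n e1 -> Dk n e2 -> Dk n (e1 + e2).
Proof.
elim: n e1 e2 => //= n IH e1 e2 [d1 D1] [d2 D2]; split.
  by move=> x; exact: derivableD.
have -> : (e1 + e2)^`() = e1^`() + e2^`().
  by apply/funext => x; have := deriveD (d1 x) (d2 x); rewrite -!derive1E.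
exact: IH.
Qed.

Lemma DkM n e1 e2 : Dk n e1 -> Dk n e2 -> Dk n (e1 * e2).
Proof.
elim: n e1 e2 => // n IH e1 e2 H1 H2.
have [[d1 D1] [d2 D2]] := (H1, H2); split.
  by move=> x; exact: derivableM.
have -> : (e1 * e2)^`() = e1 * e2^`() + e2 * e1^`().
  by apply/funext => x; have := deriveM (d1 x) (d2 x); rewrite -!derive1E.
by apply: DkD; apply: IH => //; exact: Dk1.
Qed.

Lemma Dk_cst n (c : R) : Dk n (cst c).
Proof.
elim: n c => //= n IH c; split; first by move=> x; exact: derivable_cst.
have -> : (cst c)^`() = cst 0 :> (R -> R).
  by apply/funext => x; rewrite derive1_cst.
exact: IH.
Qed.

Lemma Dk_id n : Dk n (id : R -> R).
Proof.
case: n => //= n; split; first by move=> x; exact: derivable_id.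
have -> : id^`() = cst 1 :> (R -> R) by apply/funext => x; rewrite derive1_id.
exact: Dk_cst.
Qed.

Lemma Dk_comp n e1 e2 : Dk n e1 -> Dk n e2 -> Dk n (e1 \o e2).
Proof.
elim: n e1 e2 => // n IH e1 e2 H1 H2.
have [[d1 D1] [d2 D2]] := (H1, H2).
have dc (x : R) : is_derive x 1 (e1 \o e2) (e1^`() (e2 x) * e2^`() x).
  have h1 : is_derive (e2 x) 1 e1 (e1^`() (e2 x)).
    by rewrite derive1E; exact: derivableP.
  have h2 : is_derive x 1 e2 (e2^`() x) by rewrite derive1E; exact: derivableP.
  exact: is_derive1_comp.
split; first by move=> x; have [] := dc x.
have -> : (e1 \o e2)^`() = (e1^`() \o e2) * e2^`().
  by apply/funext => x; rewrite derive1E (@derive_val _ _ _ _ _ _ _ (dc x)).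
by apply: DkM => //; apply: IH => //; exact: Dk1.
Qed.

Lemma smooth1D e1 e2 : smooth1 e1 -> smooth1 e2 -> smooth1 (fun x => e1 x + e2 x).
Proof. by move=> s1 s2 n; exact: DkD. Qed.

Lemma smooth1M e1 e2 : smooth1 e1 -> smooth1 e2 -> smooth1 (fun x => e1 x * e2 x).
Proof. by move=> s1 s2 n; exact: DkM. Qed.

Lemma smooth1_cst (c : R) : smooth1 (fun=> c).
Proof. by move=> n; exact: Dk_cst. Qed.

Lemma smooth1_id : smooth1 (fun x : R => x).
Proof. by move=> n; exact: Dk_id. Qed.

Lemma smooth1_comp e1 e2 : smooth1 e1 -> smooth1 e2 -> smooth1 (fun x => e1 (e2 x)).
Proof. by move=> s1 s2 n; exact: Dk_comp. Qed.

Lemma smooth1N e : smooth1 e -> smooth1 (fun x => - e x).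
Proof.
move=> s; have -> : (fun x => - e x) = (fun x => (-1) * e x).
  by apply/funext => x; rewrite mulN1r.
by apply: smooth1M => //; exact: smooth1_cst.
Qed.

Lemma smooth1B e1 e2 : smooth1 e1 -> smooth1 e2 -> smooth1 (fun x => e1 x - e2 x).
Proof. by move=> s1 s2; apply: smooth1D => //; exact: smooth1N. Qed.

Lemma smooth1X e n : smooth1 e -> smooth1 (fun x => e x ^+ n).
Proof.
move=> s; elim: n => [|n IH].
  by under eq_fun do rewrite expr0; exact: smooth1_cst.
by under eq_fun do rewrite exprS; exact: smooth1M.
Qed.

Lemma derive1Dx e1 e2 x : derivable e1 x 1 -> derivable e2 x 1 ->
  (fun x => e1 x + e2 x)^`() x = e1^`() x + e2^`() x.
Proof. by move=> d1 d2; have := deriveD d1 d2; rewrite -!derive1E. Qed.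

Lemma derive1Mx e1 e2 x : derivable e1 x 1 -> derivable e2 x 1 ->
  (fun x => e1 x * e2 x)^`() x = e1 x * e2^`() x + e2 x * e1^`() x.
Proof. by move=> d1 d2; have := deriveM d1 d2; rewrite -!derive1E. Qed.

Lemma derive1_compx e1 e2 x : derivable e1 (e2 x) 1 -> derivable e2 x 1 ->
  (fun x => e1 (e2 x))^`() x = e1^`() (e2 x) * e2^`() x.
Proof. by move=> d1 d2; have := derive1_comp d2 d1. Qed.

Lemma CkD n f g : Ck n f -> Ck n g -> Ck n (f + g).
Proof.
have cD f' g' : continuous f' -> continuous g' -> continuous (f' + g').
  by move=> cf cg p; apply: continuousD; [exact: cf|exact: cg].
elim: n f g => [f g [cf _] [cg _]|n IH f g [cf Hf] [cg Hg]].
  by split=> //; exact: cD.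
split; first exact: cD.
move=> i; have [df Cf] := Hf i; have [dg Cg] := Hg i.
split; first by move=> p; exact: derivableD.
have -> : pd i (f + g) = pd i f + pd i g.
  by apply/funext => p; rewrite /pd deriveD.
exact: IH.
Qed.

Lemma CkM n f g : Ck n f -> Ck n g -> Ck n (f * g).
Proof.
have cM f' g' : continuous f' -> continuous g' -> continuous (f' * g').
  by move=> cf cg p; apply: continuousM; [exact: cf|exact: cg].
elim: n f g => [f g [cf _] [cg _]|n IH f g Hf0 Hg0].
  by split=> //; exact: cM.
have [[cf Hf] [cg Hg]] := (Hf0, Hg0).
split; first exact: cM.
move=> i; have [df Cf] := Hf i; have [dg Cg] := Hg i.
split; first by move=> p; exact: derivableM.
have -> : pd i (f * g) = f * pd i g + g * pd i f.
  by apply/funext => p; rewrite /pd deriveM.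
by apply: CkD; apply: IH => //; exact: Ck1.
Qed.

Lemma Ck_cst n (c : R) : Ck n (fun=> c).
Proof.
elim: n c => [|n IH] c; first by split=> //; exact: cst_continuous.
split; first exact: cst_continuous.
move=> i; split; first by move=> p; exact: derivable_cst.
have -> : pd i (fun=> c) = fun=> 0 by apply/funext => p; rewrite /pd derive_cst.
exact: IH.
Qed.

Lemma Ck_comp n e f : smooth1 e -> Ck n f -> Ck n (e \o f).
Proof.
have cc e' f' : smooth1 e' -> continuous f' -> continuous (e' \o f').
  by move=> se cf p; apply: continuous_comp; [exact: cf|exact: smooth1_cont].
elim: n e f => [e f se [cf _]|n IH e f se Hf0].
  by split=> //; exact: cc.
have [cf Hf] := Hf0.
split; first exact: cc.
move=> i; have [df Cf] := Hf i.
have dc (p : R * R) : is_derive p (basis R i) (e \o f) (e^`() (f p) * pd i f p).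
  apply: is_derive_comp_line; first exact: derivableP.
  by rewrite derive1E; apply: derivableP; exact: smooth1_derivable.
split; first by move=> p; have [] := dc p.
have -> : pd i (e \o f) = (e^`() \o f) * pd i f.
  by apply/funext => p; rewrite {1}/pd (@derive_val _ _ _ _ _ _ _ (dc p)).
apply: CkM => //; apply: IH; last exact: Ck1.
exact: smooth1_derive1.
Qed.

Lemma smoothD f g : smooth f -> smooth g -> smooth (fun p => f p + g p).
Proof. by move=> /smoothE sf /smoothE sg; apply/smoothE => n; exact: CkD. Qed.

Lemma smoothM f g : smooth f -> smooth g -> smooth (fun p => f p * g p).
Proof. by move=> /smoothE sf /smoothE sg; apply/smoothE => n; exact: CkM. Qed.

Lemma smooth_cst (c : R) : smooth (fun=> c).
Proof. by apply/smoothE => n; exact: Ck_cst. Qed.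

Lemma smooth_comp e f : smooth1 e -> smooth f -> smooth (fun p => e (f p)).
Proof. by move=> se /smoothE sf; apply/smoothE => n; exact: Ck_comp. Qed.

Lemma smoothN f : smooth f -> smooth (fun p => - f p).
Proof.
by apply: (@smooth_comp (fun x => - x)); apply: smooth1N; exact: smooth1_id.
Qed.

Lemma smoothB f g : smooth f -> smooth g -> smooth (fun p => f p - g p).
Proof. by move=> sf sg; exact: smoothD sf (smoothN sg). Qed.

(** With the index as a variable, both legs [co i p = 0] are treated at once. *)
Definition co (i : 'I_2) : R * R -> R := fun p => if i == 0 then p.1 else p.2.

Lemma ord2E (i : 'I_2) : i = 0 \/ i = 1.
Proof. by case: i => [[|[|//]] ?]; [left|right]; exact: val_inj. Qed.

Lemma is_derive_co i j p : is_derive p (basis R j) (co i) (i == j)%:R.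
Proof.
apply/is_derive_line.
have -> : (fun h : R => co i (h *: basis R j + p)) =
          (fun h : R => (i == j)%:R * h + co i p).
  apply/funext => h; rewrite /co /basis.
  by case: (ord2E i) => ->; case: (ord2E j) => ->;
    rewrite /= /GRing.scale /= ?(mulr0,mulr1,mul0r,mul1r,add0r).
have s1 : smooth1 (fun h : R => (i == j)%:R * h).
  by apply: smooth1M; [exact: smooth1_cst|exact: smooth1_id].
have s2 := smooth1_cst (co i p).
apply: DeriveDef; first exact: (smooth1_derivable (smooth1D s1 s2)).
rewrite -derive1E derive1Dx; [|exact: smooth1_derivable..].
rewrite derive1_cst addr0 derive1Mx;
  [|exact: smooth1_derivable (smooth1_cst _) _|exact: smooth1_derivable smooth1_id _].
by rewrite derive1_id derive1_cst mulr1 mulr0 addr0.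
Qed.

Lemma co_cont i : continuous (@co i).
Proof.
case: (ord2E i) => -> p; first by have : (@fst R R) @ p --> p.1 by exact: cvg_fst.
by have : (@snd R R) @ p --> p.2 by exact: cvg_snd.
Qed.

Lemma smooth_co i : smooth (@co i).
Proof.
apply/smoothE => -[|n]; first by split; [exact: co_cont|].
split; first exact: co_cont.
move=> j; split=> [p|]; first by have [] := is_derive_co i j p.
have -> : pd j (co i) = fun=> (i == j)%:R.
  by apply/funext => p; rewrite /pd (@derive_val _ _ _ _ _ _ _ (is_derive_co i j p)).
exact: Ck_cst.
Qed.

Lemma pdD i f g : smooth f -> smooth g ->
  pd i (fun p => f p + g p) = fun p => pd i f p + pd i g p.
Proof.
by move=> sf sg; apply/funext => p; rewrite /pd -deriveD//; exact: smooth_derivable.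
Qed.

Lemma pdM i f g : smooth f -> smooth g ->
  pd i (fun p => f p * g p) = fun p => f p * pd i g p + g p * pd i f p.
Proof.
by move=> sf sg; apply/funext => p; rewrite /pd -[RHS]deriveM//; exact: smooth_derivable.
Qed.

Lemma pd_cst i (c : R) : pd i (fun=> c) = fun=> 0.
Proof. by apply/funext => p; rewrite /pd derive_cst. Qed.

Lemma pd_comp i e f : smooth1 e -> smooth f ->
  pd i (fun p => e (f p)) = fun p => e^`() (f p) * pd i f p.
Proof.
move=> se sf; apply/funext => p; rewrite /pd.
have H : is_derive p (basis R i) (e \o f) (e^`() (f p) * 'D_(basis R i) f p).
  apply: is_derive_comp_line; first by apply: derivableP; exact: smooth_derivable.
  by rewrite derive1E; apply: derivableP; exact: smooth1_derivable.
by rewrite -(@derive_val _ _ _ _ _ _ _ H).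
Qed.

Lemma pdZ i c f : smooth f -> pd i (fun p => c * f p) = fun p => c * pd i f p.
Proof.
move=> sf; rewrite (pdM _ (smooth_cst c) sf) pd_cst.
by apply/funext => p; rewrite mulr0 addr0.
Qed.

Lemma pdN i f : smooth f -> pd i (fun p => - f p) = fun p => - pd i f p.
Proof.
move=> sf; have -> : (fun p => - f p) = fun p => (-1) * f p.
  by apply/funext => p; rewrite mulN1r.
by rewrite pdZ//; apply/funext => p; rewrite mulN1r.
Qed.

Lemma pd_co i j : pd j (@co i) = fun=> (i == j)%:R.
Proof.
by apply/funext => p; rewrite /pd (@derive_val _ _ _ _ _ _ _ (is_derive_co i j p)).
Qed.

Lemma smooth_fst e : smooth1 e -> smooth (fun p => e p.1).
Proof. by move=> se; exact: (smooth_comp se (smooth_co 0)). Qed.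

Lemma smooth_snd e : smooth1 e -> smooth (fun p => e p.2).
Proof. by move=> se; exact: (smooth_comp se (smooth_co 1)). Qed.

Lemma smooth_add e : smooth1 e -> smooth (fun p => e (p.1 + p.2)).
Proof.
by move=> se; exact: (smooth_comp se (smoothD (smooth_co 0) (smooth_co 1))).
Qed.

Lemma pd_fst i e : smooth1 e ->
  pd i (fun p => e p.1) = fun p => (0 == i)%:R * e^`() p.1.
Proof.
move=> se; rewrite (pd_comp i se (smooth_co 0)) pd_co.
by apply/funext => p; rewrite mulrC.
Qed.

Lemma pd_snd i e : smooth1 e ->
  pd i (fun p => e p.2) = fun p => (1 == i)%:R * e^`() p.2.
Proof.
move=> se; rewrite (pd_comp i se (smooth_co 1)) pd_co.
by apply/funext => p; rewrite mulrC.
Qed.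

Lemma pd_add i e : smooth1 e ->
  pd i (fun p => e (p.1 + p.2)) = fun p => e^`() (p.1 + p.2).
Proof.
move=> se; rewrite (pd_comp i se (smoothD (smooth_co 0) (smooth_co 1))).
rewrite pdD; [|exact: smooth_co..]; rewrite !pd_co.
apply/funext => p; case: (ord2E i) => -> /=; rewrite ?addr0 ?add0r mulr1 //.
Qed.

Lemma smooth_tensor e1 e2 : smooth1 e1 -> smooth1 e2 ->
  smooth (fun p => e1 p.1 * e2 p.2).
Proof. by move=> s1 s2; apply: smoothM; [exact: smooth_fst|exact: smooth_snd]. Qed.

Lemma pd_tensor i e1 e2 : smooth1 e1 -> smooth1 e2 ->
  pd i (fun p => e1 p.1 * e2 p.2) =
  fun p => if i == 0 then e1^`() p.1 * e2 p.2 else e1 p.1 * e2^`() p.2.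
Proof.
move=> s1 s2; rewrite pdM; [|exact: smooth_fst|exact: smooth_snd].
rewrite pd_fst// pd_snd//; apply/funext => p.
by case: (ord2E i) => -> /=; rewrite ?(mul0r,mul1r,mulr0,addr0,add0r)// mulrC.
Qed.

Lemma near_pd i f g p : (\near p, f p = g p) -> pd i f p = pd i g p.
Proof. by move=> H; exact: near_eq_derive. Qed.

End SmoothFunctions.

Arguments smooth1_derivable {R e} _ x.
Arguments smooth1_id {R}.
Arguments smooth1_cst {R} c.
Arguments smooth_cst {R} c.
Arguments smooth_co {R} i.

(** * Flat functions, primitives and smooth steps in one variable *)

Section SmoothSteps.
Variable R : realType.
Implicit Types (e : R -> R) (x y a b : R).
Local Notation mu := (@lebesgue_measure R).

Lemma smooth1_lin (c d : R) : smooth1 (fun x => c * x + d).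
Proof.
exact: smooth1D (smooth1M (smooth1_cst c) smooth1_id) (smooth1_cst d).
Qed.

Lemma derive1_lin (c d x : R) : (fun x => c * x + d)^`() x = c.
Proof.
have dc (k : R) y := smooth1_derivable (smooth1_cst k) y.
have di y := smooth1_derivable smooth1_id y.
have dm y := smooth1_derivable (smooth1M (smooth1_cst c) smooth1_id) y.
rewrite (derive1Dx (dm x) (dc d x)) (derive1Mx (dc c x) (di x)).
by rewrite !derive1_cst derive1_id !mulr1 mulr0 !addr0.
Qed.

Lemma mvt_bound e a b M : smooth1 e -> a <= b ->
  (forall x, a <= x <= b -> `|e^`() x| <= M) -> `|e b - e a| <= M * (b - a).
Proof.
move=> se ab H.
have [] := @MVT_segment R e e^`() a b ab.
- by move=> x _; rewrite derive1E; apply: derivableP; exact: smooth1_derivable.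
- by apply: continuous_subspaceT => x; exact: smooth1_cont.
move=> c; rewrite in_itv /= => cab ->; rewrite normrM (ger0_norm (_ : 0 <= b - a)) ?subr_ge0//.
by rewrite ler_wpM2r ?subr_ge0// H.
Qed.

Lemma mvt_ge0 e a b : smooth1 e -> a <= b ->
  (forall x, a <= x <= b -> 0 <= e^`() x) -> e a <= e b.
Proof.
move=> se ab H; rewrite -subr_ge0.
have [] := @MVT_segment R e e^`() a b ab.
- by move=> x _; rewrite derive1E; apply: derivableP; exact: smooth1_derivable.
- by apply: continuous_subspaceT => x; exact: smooth1_cont.
by move=> c; rewrite in_itv /= => cab ->; rewrite mulr_ge0 ?subr_ge0// H.
Qed.

Lemma ftc_C1 e a b : (forall x, derivable e x 1) -> continuous e^`() -> a < b ->
  (\int[mu]_(x in `[a, b]) (e^`() x)%:E = (e b - e a)%:E)%E.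
Proof.
move=> de ce ab; have c := derivable_cont1 de.
rewrite EFinB; apply: (@continuous_FTC2 R e^`() e a b ab).
- by apply: continuous_subspaceT => x; exact: ce.
- split=> [x _||]; first exact: de.
  + by apply: cvg_at_right_filter; exact: c.
  + by apply: cvg_at_left_filter; exact: c.
- by [].
Qed.

(** The difference quotient of increment h is at most M |h| in absolute value. *)
Lemma is_derive_flat e x M : e x = 0 ->
  (forall y, `|e y| <= M * (y - x) ^+ 2) -> is_derive x 1 e 0.
Proof.
move=> ex0 H.
have M0 : 0 <= M.
  have := le_trans (normr_ge0 _) (H (x + 1)).
  by rewrite [x + 1]addrC addrK expr1n mulr1.
have c : h^-1 *: ((e \o shift x) (h *: 1) - e x) @[h --> 0^'] --> (0 : R).
  apply/cvgr0Pnorm_le => eps eps0.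
  (* [M + 1] instead of [M] covers the case [M = 0]. *)
  have d0 : 0 < eps / (M + 1) by rewrite divr_gt0// ltr_wpDl.
  exists (eps / (M + 1)) => //= h; rewrite /ball_ /= sub0r normrN => hd h0.
  rewrite ex0 subr0 /GRing.scale /= mulr1 normrM normfV.
  rewrite ler_pdivrMl ?normr_gt0//.
  apply: le_trans (H _) _; rewrite addrK -(normr_id h) -real_normK ?num_real//.
  rewrite normr_id expr2 mulrA mulrC ler_wpM2l//.
  have := ltW hd; rewrite ler_pdivlMr ?ltr_wpDl// mulrC; apply: le_trans.
  by rewrite ler_wpM2r// lerDl.
by split; [apply/cvg_ex; exists 0|exact: cvg_lim].
Qed.

Lemma smooth1_expR : smooth1 (@expR R).
Proof.
move=> n; elim: n => //= n IH; split; first by move=> x; exact: derivable_expR.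
by have -> : (@expR R)^`() = expR by apply/funext => x; rewrite derive1E derive_val.
Qed.

(** For n = 0 this is the standard flat function exp(-1/x). The powers of 1/x make the span of the
    family stable under differentiation. *)
Definition flat n x : R := if 0 < x then x^-1 ^+ n * expR (- x^-1) else 0.

Lemma flat_eq0 n x : x <= 0 -> flat n x = 0.
Proof. by move=> x0; rewrite /flat ltNge x0. Qed.

(** With w = 1/x, the exponential series gives exp(w) >= w^(n+2) / (n+2)!. The quadratic decay
    yields the derivative 0 at the origin by [is_derive_flat]. *)
Lemma flat_bound n x : `|flat n x| <= (n.+2)`!%:R * x ^+ 2.
Proof.
rewrite /flat; case: ifPn => [x0|_]; last by rewrite normr0 mulr_ge0 ?sqr_ge0.
have xV0 : 0 < x^-1 by rewrite invr_gt0.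
rewrite ger0_norm; last by rewrite mulr_ge0 ?expR_ge0// exprn_ge0// ltW.
have /(_ (n.+1)) := @expR_ge1Dxn R (x^-1) ^~ (ltW xV0).
rewrite expRN => H.
rewrite ler_pdivrMr ?expR_gt0// -ler_pdivrMl; last by rewrite mulr_gt0 ?exprn_gt0// ltr0n fact_gt0.
apply: le_trans H; rewrite invfM -!exprVn mulrAC -mulrA -exprD addn2 mulrC.
by rewrite lerDr.
Qed.

Lemma is_derive_flatS n x :
  is_derive x 1 (flat n) (- n%:R * flat n.+1 x + flat n.+2 x).
Proof.
have [x0|x0|->] := ltgtP x 0.
- apply: (@near_eq_is_derive _ _ _ (cst 0)).
    near=> y; rewrite /flat ifF//; apply/negbTE; rewrite -leNgt ltW//.
    by near: y; exact: lt_nbhsl.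
  rewrite !(flat_eq0 _ (ltW x0)) mulr0 addr0; exact: is_derive_cst.
- pose e (w : R) := w ^+ n * expR (- w).
  have sn : smooth1 (fun w : R => w ^+ n) by apply: smooth1X; exact: smooth1_id.
  have se1 : smooth1 (fun w : R => expR (- w)).
    by apply: smooth1_comp; [exact: smooth1_expR|apply: smooth1N; exact: smooth1_id].
  have se : smooth1 e by exact: smooth1M.
  apply: (@near_eq_is_derive _ _ _ (fun y => e (y^-1))).
    near=> y; rewrite /flat ifT//.
    by near: y; exact: lt_nbhsr.
  have h1 : is_derive (x^-1) 1 e (e^`() x^-1).
    by rewrite derive1E; apply: derivableP; exact: smooth1_derivable.
  have h2 : is_derive x 1 (fun y : R => y^-1) (- x ^- 2).
    by have := @is_deriveV R id x 1 1 (lt0r_neq0 x0) (is_derive_id _ _);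
      rewrite /GRing.scale /= mulr1.
  have h3 := is_derive1_comp h1 h2.
  suff -> : - n%:R * flat n.+1 x + flat n.+2 x = e^`() x^-1 * - x ^- 2 by [].
  rewrite /flat x0 /e derive1Mx; [|exact: smooth1_derivable..].
  have -> : (fun w : R => expR (- w))^`() x^-1 = - expR (- x^-1).
    rewrite derive1_compx; [|exact: (smooth1_derivable smooth1_expR)
      |exact: (smooth1_derivable (smooth1N smooth1_id))].
    have -> : (fun w : R => - w)^`() x^-1 = -1.
      by rewrite derive1E (@derive_val _ _ _ _ _ _ _ (is_deriveN (is_derive_id _ _))).
    by rewrite derive1E derive_val mulrN1.
  have -> : (fun w : R => w ^+ n)^`() x^-1 = n%:R * (x^-1) ^+ n.-1.
    by rewrite exp_derive1.
  rewrite -[x ^- 2]exprVn; move: (x^-1) (expR _) => w E.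
  by case: n {e sn se h1 h3} => [|n] /=; rewrite !exprS ?expr0; ring.
rewrite (_ : - n%:R * flat n.+1 0 + flat n.+2 0 = 0); last first.
  by rewrite /flat ltxx mulr0 addr0.
apply: (@is_derive_flat _ _ (n.+2)`!%:R); first by rewrite /flat ltxx.
by move=> y; rewrite subr0; exact: flat_bound.
Unshelve. all: by end_near. Qed.

Lemma smooth1_flat n : smooth1 (flat n).
Proof.
move=> k; elim: k n => //= k IH n; split.
  by move=> x; have [] := is_derive_flatS n x.
have -> : (flat n)^`() = (cst (- n%:R) * flat n.+1) + flat n.+2.
  apply/funext => x.
  by rewrite derive1E (@derive_val _ _ _ _ _ _ _ (is_derive_flatS n x)).
by apply: DkD => //; apply: DkM => //; exact: Dk_cst.
Qed.

Lemma flat_ge0 n x : 0 <= flat n x.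
Proof.
rewrite /flat; case: ifP => // x0.
by rewrite mulr_ge0 ?expR_ge0// exprn_ge0// invr_ge0 ltW.
Qed.

Lemma flat_gt0 n x : 0 < x -> 0 < flat n x.
Proof. by move=> x0; rewrite /flat x0 mulr_gt0 ?expR_gt0// exprn_gt0// invr_gt0. Qed.

(** Starting at -oo avoids oriented integrals. It is applied to functions that vanish on a left
    half-line, where it is a genuine primitive. *)
Definition prim e x : R := (\int[mu]_(t in `]-oo, x]) e t)%R.

Lemma prim_eq0 e a x : (forall y, y <= a -> e y = 0) -> x <= a -> prim e x = 0.
Proof.
move=> H xa; rewrite /prim -[RHS](@Rintegral_set0 _ _ R mu e) Rintegral_mkcond.
rewrite [RHS]Rintegral_mkcond; apply: eq_Rintegral => y _.
rewrite patch_set0 patchE; case: ifPn => // /set_mem /=; rewrite in_itv /= => yx.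
by rewrite H// (le_trans yx).
Qed.

Lemma prim_cst e b x : (forall y, b <= y -> e y = 0) -> b <= x -> prim e x = prim e b.
Proof.
move=> H bx; rewrite /prim Rintegral_mkcond [RHS]Rintegral_mkcond.
apply: eq_Rintegral => y _; rewrite !patchE !mem_setE !in_itv /=.
case: (leP y b) => [yb|/ltW /H ->]; last by case: ifP.
by rewrite (le_trans yb bx).
Qed.

Lemma prim_integrable e a x : continuous e -> (forall y, y <= a -> e y = 0) ->
  mu.-integrable `]-oo, x] (EFin \o e).
Proof.
move=> ce H; have : mu.-integrable `[a, x] (EFin \o e).
  apply: continuous_compact_integrable; first exact: segment_compact.
  by apply: continuous_subspaceT => y; exact: ce.
move=> /integrable_mkcond => /(_ (measurable_itv _)) I.
apply/integrable_mkcond => //; apply: eq_integrable I => // y _.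
rewrite !patchE !mem_setE !in_itv /=.
by case: (leP a y) => //= /ltW ya; case: ifP => // _; rewrite H.
Qed.

Lemma is_derive_prim e a x : continuous e -> (forall y, y <= a -> e y = 0) ->
  derivable (prim e) x 1 /\ (prim e)^`() x = e x.
Proof.
move=> ce H; apply: (@continuous_FTC1 R e -oo%O x (x + 1)) => //.
- by rewrite ltrDl.
- exact: prim_integrable H.
- by rewrite ltNyr.
- exact: ce.
Qed.

Lemma derive1_prim e a : continuous e -> (forall y, y <= a -> e y = 0) ->
  (prim e)^`() = e.
Proof. by move=> ce H; apply/funext => x; have [] := is_derive_prim x ce H. Qed.

Lemma smooth1_prim e a : smooth1 e -> (forall y, y <= a -> e y = 0) ->
  smooth1 (prim e).
Proof.
move=> se H; have ce := smooth1_cont se; apply: smooth1_intro.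
  by move=> x; have [] := is_derive_prim x ce H.
by rewrite (derive1_prim ce H).
Qed.

Let bump x := flat 0 (x - 1) * flat 0 (2 - x).

Let bump_smooth : smooth1 bump.
Proof.
have s1 := smooth1B smooth1_id (smooth1_cst (1 : R)).
have s2 := smooth1B (smooth1_cst (2 : R)) smooth1_id.
exact: smooth1M (smooth1_comp (smooth1_flat 0) s1) (smooth1_comp (smooth1_flat 0) s2).
Qed.

Let bump1 x : x <= 1 -> bump x = 0.
Proof. by move=> x1; rewrite /bump flat_eq0 ?mul0r// subr_le0. Qed.

Let bump2 x : 2 <= x -> bump x = 0.
Proof. by move=> x1; rewrite /bump (@flat_eq0 _ (2 - x)) ?mulr0// subr_le0. Qed.

Let bumpP := derive1_prim (smooth1_cont bump_smooth) bump1.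

Let prim_gt0 : 0 < prim bump 2.
Proof.
(* The mean value theorem provides an interior point of (1, 2), where the bump is positive. *)
have [|||c] := @MVT R (prim bump) bump 1 2; first by rewrite ltr1n.
- move=> x _; rewrite -{2}bumpP derive1E; apply: derivableP.
  exact: smooth1_derivable (smooth1_prim bump_smooth bump1) x.
- apply: continuous_subspaceT => x; apply: smooth1_cont.
  exact: smooth1_prim bump1.
rewrite in_itv /= => /andP[c1 c2]; rewrite (prim_eq0 bump1 (lexx 1)) subr0 => ->.
by rewrite !mulr_gt0 ?flat_gt0 ?subr_gt0// ltr1n.
Qed.

(* A smooth monotone transition from 0 (on the left of a) to 1 (on the right of b). *)
Definition ramp a b x := prim bump (1 + (x - a) / (b - a)) / prim bump 2.

Lemma smooth1_ramp a b : smooth1 (ramp a b).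
Proof.
apply: smooth1M; last exact: smooth1_cst.
apply: smooth1_comp; first exact: smooth1_prim bump1.
apply: smooth1D; first exact: smooth1_cst.
apply: smooth1M; last exact: smooth1_cst.
by apply: smooth1B; [exact: smooth1_id|exact: smooth1_cst].
Qed.

Lemma ramp0 a b x : a < b -> x <= a -> ramp a b x = 0.
Proof.
move=> ab xa; rewrite /ramp (prim_eq0 bump1) ?mul0r// gerDl.
by rewrite pmulr_lle0 ?invr_gt0 ?subr_gt0// subr_le0.
Qed.

Lemma ramp1 a b x : a < b -> b <= x -> ramp a b x = 1.
Proof.
move=> ab xa; rewrite /ramp (prim_cst bump2) ?divff ?lt0r_neq0//.
by rewrite -natr1 addrC lerD2l ler_pdivlMr ?subr_gt0// mul1r lerB.
Qed.

Lemma ramp01 a b x : 0 <= ramp a b x <= 1.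
Proof.
have sp := smooth1_prim bump_smooth bump1.
have b0 y : 0 <= (prim bump)^`() y by rewrite bumpP mulr_ge0// flat_ge0.
have p0 y : 0 <= prim bump y.
  have [y1|y1] := leP y 1; first by rewrite (prim_eq0 bump1).
  by rewrite -(prim_eq0 bump1 (lexx 1)); apply: mvt_ge0 => //; exact: ltW.
rewrite divr_ge0//= ler_pdivrMr// mul1r; set y := (1 + _).
have [y1|y1] := leP 2 y; first by rewrite (prim_cst bump2).
by apply: mvt_ge0 => //; exact: ltW.
Qed.

Let derive1_rampE a b x : (ramp a b)^`() x = (prim bump 2)^-1 *
  (bump (1 + (x - a) / (b - a)) / (b - a)).
Proof.
have sa : smooth1 (fun x => 1 + (x - a) / (b - a)).
  apply: smooth1D; first exact: smooth1_cst.
  apply: smooth1M; last exact: smooth1_cst.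
  by apply: smooth1B; [exact: smooth1_id|exact: smooth1_cst].
have sp := smooth1_prim bump_smooth bump1.
have -> : ramp a b = (fun x => prim bump (1 + (x - a) / (b - a)) * (prim bump 2)^-1) by [].
rewrite (derive1Mx (smooth1_derivable (smooth1_comp sp sa) x)
  (smooth1_derivable (smooth1_cst _) x)).
rewrite derive1_cst mulr0 add0r; congr (_ * _).
rewrite (derive1_compx (smooth1_derivable sp _) (smooth1_derivable sa x)) bumpP.
congr (_ * _).
have -> : (fun x => 1 + (x - a) / (b - a)) = (fun x => (b - a)^-1 * x + (1 - a / (b - a))).
  by apply/funext => y; rewrite mulrBl; ring.
by rewrite derive1_lin.
Qed.

Lemma derive1_ramp_ge0 a b x : a < b -> 0 <= (ramp a b)^`() x.
Proof.
move=> ab; rewrite derive1_rampE mulr_ge0 ?invr_ge0 ?(ltW prim_gt0)//.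
by rewrite mulr_ge0 ?invr_ge0 ?subr_ge0 ?(ltW ab)// mulr_ge0 ?flat_ge0.
Qed.

Lemma derive1_ramp0 a b x : a < b -> x <= a \/ b <= x -> (ramp a b)^`() x = 0.
Proof.
move=> ab H; rewrite derive1_rampE; case: H => H.
  rewrite bump1 ?mul0r ?mulr0// gerDl pmulr_lle0 ?invr_gt0 ?subr_gt0//.
  by rewrite subr_le0.
rewrite bump2 ?mul0r ?mulr0// -natr1 addrC lerD2l ler_pdivlMr ?subr_gt0//.
by rewrite mul1r lerB.
Qed.

(** All ramps are rescalings of one profile, so a single constant serves for all of them; only the
    inverse width remains. *)
Lemma derive1_ramp_bound : exists2 M, 0 <= M & forall a b x, a < b ->
  `|(ramp a b)^`() x| <= M / (b - a).
Proof.
exists (prim bump 2)^-1; first by rewrite invr_ge0 ltW.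
move=> a b x ab.
have f1 y : 0 <= flat 0 y <= 1.
  rewrite flat_ge0 /flat; case: ifP => // y0; last exact: ler01.
  by rewrite expr0 mul1r -expR0 ler_expR oppr_le0 invr_ge0 ltW.
rewrite derive1_rampE normrM ger0_norm ?invr_ge0 ?(ltW prim_gt0)//.
rewrite ler_wpM2l ?invr_ge0 ?(ltW prim_gt0)//.
rewrite normrM [X in _ * X]ger0_norm ?invr_ge0 ?subr_ge0 ?(ltW ab)//.
rewrite -[leRHS]mul1r ler_wpM2r ?invr_ge0 ?subr_ge0 ?(ltW ab)//.
rewrite /bump ger0_norm; last by rewrite mulr_ge0 ?flat_ge0.
have /andP[? ?] := f1 (1 + (x - a) / (b - a) - 1).
by have /andP[? ?] := f1 (2 - (1 + (x - a) / (b - a))); rewrite mulr_ile1.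
Qed.

End SmoothSteps.

(** * Measurability, integrals and L_2 on the triangle *)

Section Integration.
Variable R : realType.
Local Notation P := (measurableTypeR R * measurableTypeR R)%type.
Local Notation mu := (@lebesgue_measure R).
Local Notation mu2 := (mu \x mu)%E.
Local Notation T := (@triangle R).
Implicit Types (f g F G : R * R -> R) (p : R * R).

(** The sigma-algebra of the plane is the product one, so an open set has to be written as a
    countable union of products: the rational boxes that it contains. *)
Lemma open_plane_measurable (U : set (R * R)) : open U -> measurable (U : set P).
Proof.
move=> oU.
pose box (i : (rat * rat) * (rat * rat)) : set P :=
  `](ratr i.1.1 : R), ratr i.1.2[%classic `*` `](ratr i.2.1 : R), ratr i.2.2[%classic.
have -> : U = \bigcup_i (if pselect (box i `<=` U) then box i else set0).
  apply/seteqP; split=> p; last by move=> [i _]; case: pselect => // s /s.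
  move=> Up; have /nbhs_ballP[e /= e0 eU] := open_nbhs_nbhs (conj oU Up).
  have h (x : R) : exists a b : rat, x - e < ratr a < x /\ x < ratr b < x + e.
    have xe1 : x - e < x by rewrite gtrDl oppr_lt0.
    have xe2 : x < x + e by rewrite ltrDl.
    have [a /[!in_itv]/= ha] := rat_in_itvoo xe1.
    have [b /[!in_itv]/= hb] := rat_in_itvoo xe2.
    by exists a, b.
  have [a1 [b1 [/andP[h1 h2] /andP[h3 h4]]]] := h p.1.
  have [a2 [b2 [/andP[h5 h6] /andP[h7 h8]]]] := h p.2.
  exists ((a1, b1), (a2, b2)) => //; case: pselect => [s|ns].
    by split; rewrite /= in_itv /= ?h2 ?h3 ?h6 ?h7.
  apply: ns => q [/=]; rewrite !in_itv /= => /andP[q1 q2] /andP[q3 q4].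
  apply: eU; split; rewrite /ball /= ltr_norml; apply/andP; split; lra.
apply: countable_bigcupT_measurable; first exact: countableP.
move=> i; case: pselect => [s|ns]; last exact: measurable0.
by apply: measurableX; exact: measurable_itv.
Qed.

Lemma continuous_plane_measurable f : continuous f ->
  measurable_fun (setT : set P) (f : P -> R).
Proof.
move=> cf mD; apply: (measurability _ (RGenOpens.measurableE R)) => //.
move=> _ [_ [a [b ->] <-]]; rewrite setTI; apply: open_plane_measurable.
by move/continuousP : cf; apply; exact: interval_open.
Qed.

Lemma triangleE : T = [set p | 0 < p.1] `&` [set p | 0 < p.2] `&` [set p | p.1 + p.2 < 1].
Proof. by apply/seteqP; split => p /= => [[]|[[]]]. Qed.

Lemma open_triangle : open T.
Proof.
have cadd : continuous (fun p : R * R => p.1 + p.2).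
  exact: smooth_cont (smoothD (smooth_co 0) (smooth_co 1)).
rewrite triangleE; apply: openI; [apply: openI|].
- by apply: (@open_comp _ _ fst [set x : R | 0 < x]) => [p _|]; [exact: cvg_fst|exact: open_gt].
- by apply: (@open_comp _ _ snd [set x : R | 0 < x]) => [p _|]; [exact: cvg_snd|exact: open_gt].
- apply: (@open_comp _ _ (fun p : R * R => p.1 + p.2) [set x : R | x < 1]) => [p _|].
    exact: cadd.
  exact: open_lt.
Qed.

Lemma measurable_triangle : measurable (T : set P).
Proof. exact: open_plane_measurable open_triangle. Qed.

Lemma triangle_box p : T p -> [/\ 0 < p.1, p.1 < 1, 0 < p.2 & p.2 < 1].
Proof. by move=> [a b c]; split => //; lra. Qed.

Lemma triangle_finite : (mu2 T < +oo)%E.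
Proof.
apply: (@le_lt_trans _ _ (mu2 (`]0, 1[%classic `*` `]0, 1[%classic))).
  apply: le_measure; rewrite ?inE.
  - exact: measurable_triangle.
  - by apply: measurableX; exact: measurable_itv.
  - by move=> p /triangle_box[a b c d]; split; rewrite /= in_itv /= ?a ?b ?c ?d.
rewrite product_measure1E; [|exact: measurable_itv..].
by rewrite /= lebesgue_measure_itv /= lte01 -EFinD -EFinM ltry.
Qed.

Definition measT F := measurable_fun (T : set P) (F : P -> R).
Definition L1 F := mu2.-integrable T (EFin \o F).
Definition intT F : R := (\int[mu2]_(p in T) F p)%R.

Lemma ipE f g : ip f g = intT (fun p => f p * g p).
Proof. by []. Qed.

Lemma eq_intT F G : (forall p, T p -> F p = G p) -> intT F = intT G.
Proof. by move=> H; apply: eq_Rintegral => p /set_mem; exact: H. Qed.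

Lemma eq_measT F G : (forall p, T p -> F p = G p) -> measT F -> measT G.
Proof. by move=> H; apply: eq_measurable_fun => p /set_mem; exact: H. Qed.

Lemma measT_cont F : continuous F -> measT F.
Proof. by move=> /continuous_plane_measurable; exact: measurable_funTS. Qed.

Lemma measT_smooth F : smooth F -> measT F.
Proof. by move=> /smooth_cont; exact: measT_cont. Qed.

Lemma measTD F G : measT F -> measT G -> measT (fun p => F p + G p).
Proof. exact: measurable_funD. Qed.

Lemma measTM F G : measT F -> measT G -> measT (fun p => F p * G p).
Proof. exact: measurable_funM. Qed.

Lemma measT_cst (c : R) : measT (fun=> c).
Proof. exact: measurable_cst. Qed.

Lemma L1_measT F : L1 F -> measT F.
Proof. by move=> /measurable_int /measurable_EFinP. Qed.

Lemma L1_le F G : measT F -> L1 G -> (forall p, T p -> `|F p| <= G p) -> L1 F.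
Proof.
move=> mF iG H; apply: (le_integrable measurable_triangle _ _ iG).
  exact/measurable_EFinP.
by move=> p Tp /=; rewrite lee_fin (le_trans (H p Tp))// ler_norm.
Qed.

Lemma eq_L1 F G : (forall p, T p -> F p = G p) -> L1 F -> L1 G.
Proof.
move=> H; apply: eq_integrable; first exact: measurable_triangle.
by move=> p /set_mem Tp /=; rewrite H.
Qed.

Lemma L1D F G : L1 F -> L1 G -> L1 (fun p => F p + G p).
Proof. by move=> iF iG; have := integrableD measurable_triangle iF iG. Qed.

Lemma L1B F G : L1 F -> L1 G -> L1 (fun p => F p - G p).
Proof. by move=> iF iG; have := integrableB measurable_triangle iF iG. Qed.

Lemma L1Z c F : L1 F -> L1 (fun p => c * F p).
Proof. by move=> iF; have := integrableZl measurable_triangle c iF. Qed.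

Lemma L1_cst (c : R) : L1 (fun=> c).
Proof.
apply: measurable_bounded_integrable => //; first exact: measurable_triangle.
  exact: triangle_finite.
by exists `|c|; split; [rewrite num_real|move=> x cx y _ /=; exact: ltW].
Qed.

Lemma L1_bounded F M : measT F -> (forall p, T p -> `|F p| <= M) -> L1 F.
Proof. by move=> mF H; apply: (L1_le mF (L1_cst M)). Qed.

Lemma L1_norm F : L1 F -> L1 (fun p => `|F p|).
Proof. by move=> iF; have := integrable_norm iF. Qed.

Lemma L1_Mb F G M : L1 F -> measT G -> (forall p, T p -> `|G p| <= M) ->
  L1 (fun p => F p * G p).
Proof.
move=> iF mG H; apply: (@L1_le _ (fun p => M * `|F p|)).
- by apply: measTM => //; exact: L1_measT.
- by apply: L1Z; exact: L1_norm.
- by move=> p Tp; rewrite normrM mulrC ler_wpM2r// H.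
Qed.

Lemma intTD F G : L1 F -> L1 G -> intT (fun p => F p + G p) = intT F + intT G.
Proof. by move=> *; exact: (RintegralD measurable_triangle). Qed.

Lemma intTB F G : L1 F -> L1 G -> intT (fun p => F p - G p) = intT F - intT G.
Proof. by move=> *; exact: (RintegralB measurable_triangle). Qed.

Lemma intTZ c F : L1 F -> intT (fun p => c * F p) = c * intT F.
Proof. by move=> *; exact: (RintegralZl _ measurable_triangle). Qed.

Lemma intT_cst (c : R) : intT (fun=> c) = c * fine (mu2 T).
Proof. by rewrite /intT Rintegral_cst//; exact: measurable_triangle. Qed.

Lemma intT0 : intT (fun=> 0) = 0.
Proof. by rewrite intT_cst mul0r. Qed.

Lemma intT_le F G : L1 F -> L1 G -> (forall p, T p -> F p <= G p) -> intT F <= intT G.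
Proof. by move=> *; exact: (le_Rintegral measurable_triangle). Qed.

Lemma intT_ge0 F : (forall p, T p -> 0 <= F p) -> 0 <= intT F.
Proof. by move=> H; apply: Rintegral_ge0. Qed.

Lemma intT_norm F : L1 F -> `|intT F| <= intT (fun p => `|F p|).
Proof. by move=> iF; exact: (le_normr_Rintegral measurable_triangle). Qed.

Lemma intT_cvg (F : nat -> R * R -> R) G D : (forall n, measT (F n)) ->
  (forall p, T p -> F n p @[n --> \oo] --> G p) ->
  L1 D -> (forall n p, T p -> `|F n p| <= D p) ->
  L1 G /\ intT (F n) @[n --> \oo] --> intT G.
Proof.
move=> mF cF iD H.
have mG : measT G by exact: (measurable_fun_cvg mF cF).
have mFE n : measurable_fun (T : set P) (EFin \o (F n : P -> R)).
  by apply/measurable_EFinP; exact: mF.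
have mGE : measurable_fun (T : set P) (EFin \o (G : P -> R)).
  by apply/measurable_EFinP.
have [||iG _ cv] := dominated_convergence measurable_triangle mFE mGE _ iD _.
- apply: aeW => p Tp; apply/fine_cvgP; split; first by near=> n.
  exact: cF.
- by apply: aeW => p n Tp; rewrite /= lee_fin H.
split=> //; have iF n : L1 (F n) by exact: (L1_le (mF n) iD (H n)).
apply/fine_cvg; rewrite /Rintegral fineK; first exact: cv.
exact: (integrable_fin_num measurable_triangle).
Unshelve. all: by end_near. Qed.

Definition aeT (Q : R * R -> Prop) := {ae mu2, forall p, T p -> Q p}.

Lemma aeTW (Q : R * R -> Prop) : (forall p, T p -> Q p) -> aeT Q.
Proof. by move=> H; apply: aeW. Qed.

Lemma aeTS (Q Q' : R * R -> Prop) : aeT Q -> (forall p, T p -> Q p -> Q' p) -> aeT Q'.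
Proof.
move=> H QQ'.
have FF := ae_filter_ringOfSetsType (mu2 : {measure set P -> \bar R}).
by apply: (@filterS _ _ FF) H => p Hp Tp; exact: QQ' Tp (Hp Tp).
Qed.

Lemma aeTI (Q Q' : R * R -> Prop) : aeT Q -> aeT Q' -> aeT (fun p => Q p /\ Q' p).
Proof.
move=> H H'.
have FF := ae_filter_ringOfSetsType (mu2 : {measure set P -> \bar R}).
by apply: (@filterS2 _ _ FF) H H' => p h h' Tp; split; [exact: h|exact: h'].
Qed.

Lemma aeT_ae_eq F G : aeT (fun p => F p = G p) -> ae_eq mu2 T (EFin \o F) (EFin \o G).
Proof.
move=> H; have FF := ae_filter_ringOfSetsType (mu2 : {measure set P -> \bar R}).
by apply: (@filterS _ _ FF) H => p Hp Tp /=; rewrite Hp.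
Qed.

Lemma ae_intT F G : measT F -> measT G ->
  aeT (fun p => F p = G p) -> intT F = intT G.
Proof.
move=> mF mG H; congr fine; apply: ae_eq_integral; first exact: measurable_triangle.
- exact/measurable_EFinP.
- exact/measurable_EFinP.
- exact: aeT_ae_eq.
Qed.

Lemma L2P f : L2 f <-> measT f /\ L1 (fun p => f p ^+ 2).
Proof.
have E : (fun p => (f \_ T) p ^+ 2) = (fun p => f p ^+ 2) \_ T.
  by apply/funext => p; rewrite !patchE; case: ifP => // _; rewrite expr0n.
split=> [Lf|[mf if2]].
  have mf : measT f.
    apply/(measurable_restrictT f measurable_triangle).
    by have /set_mem := sub_Lfun_mfun Lf.
  split=> //; have := Lfun2_integrable_sqr Lf; rewrite E => I.
  apply/(integrable_mkcond _ measurable_triangle).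
  by apply: eq_integrable I => //= p _; rewrite !patchE; case: ifP.
have mfr : measurable_fun [set: P] (f \_ T : P -> R).
  exact/(measurable_restrictT f measurable_triangle).
rewrite /L2 inE; apply/andP; split; rewrite inE //=.
rewrite /finite_norm unlock /=; apply: poweR_lty.
have : mu2.-integrable [set: P] (EFin \o (fun p => (f \_ T) p ^+ 2)).
  rewrite E; have /(integrable_mkcond _ measurable_triangle) := if2.
  by apply: eq_integrable => //= p _; rewrite !patchE; case: ifP.
move=> /integrableP[_]; apply: le_lt_trans; rewrite le_eqVlt; apply/orP; left; apply/eqP.
apply: eq_integral => p _ /=.
by rewrite powR_mulrn// normrX.
Qed.

Lemma L2_measT f : L2 f -> measT f.
Proof. by move=> /L2P[]. Qed.

Lemma L2M f g : L2 f -> L2 g -> L1 (fun p => f p * g p).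
Proof.
move=> /L2P[mf if2] /L2P[mg ig2].
apply: (@L1_le _ (fun p => f p ^+ 2 + g p ^+ 2)); [exact: measTM|exact: L1D|].
by move=> p _; rewrite ler_norml; apply/andP; split; nra.
Qed.

Lemma L2D f g : L2 f -> L2 g -> L2 (fun p => f p + g p).
Proof.
move=> Lf Lg; have /L2P[mf if2] := Lf; have /L2P[mg ig2] := Lg.
apply/L2P; split; first exact: measTD.
have I := L1D (L1D if2 ig2) (L1Z 2 (L2M Lf Lg)).
by apply: eq_L1 I => p _; ring.
Qed.

Lemma L2_Mb f g M : L2 f -> measT g -> (forall p, T p -> `|g p| <= M) ->
  L2 (fun p => f p * g p).
Proof.
move=> /L2P[mf if2] mg H; apply/L2P; split; first exact: measTM.
have I := L1_Mb (M := M ^+ 2) if2 (measTM mg mg).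
suff /I : forall p, T p -> `|g p * g p| <= M ^+ 2.
  by apply: eq_L1 => p _; ring.
by move=> p Tp; rewrite normrM expr2 ler_pM// H.
Qed.

Lemma L2_bounded f M : measT f -> (forall p, T p -> `|f p| <= M) -> L2 f.
Proof.
move=> mf H; apply/L2P; split=> //.
apply: (@L1_bounded _ (M ^+ 2)); first by apply: (@eq_measT (fun p => f p * f p)) => //; exact: measTM.
by move=> p Tp; rewrite normrX ler_pXn2r ?nnegrE ?H// (le_trans _ (H p Tp)).
Qed.

Lemma L2_cst (c : R) : L2 (fun=> c).
Proof. by apply: (@L2_bounded _ `|c|); [exact: measT_cst|]. Qed.

Lemma L2Z c f : L2 f -> L2 (fun p => c * f p).
Proof.
move=> Lf; have : L2 (fun p => f p * c) by apply: (@L2_Mb _ _ `|c|) => //; exact: measT_cst.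
by under eq_fun do rewrite mulrC.
Qed.

Lemma L2N f : L2 f -> L2 (fun p => - f p).
Proof. by move=> /(L2Z (-1)); under eq_fun do rewrite mulN1r. Qed.

Lemma L2B f g : L2 f -> L2 g -> L2 (fun p => f p - g p).
Proof. by move=> Lf Lg; exact: L2D Lf (L2N Lg). Qed.

Lemma L2_L1 f : L2 f -> L1 f.
Proof. by move=> Lf; have := L2M Lf (L2_cst 1); apply: eq_L1 => p _; rewrite mulr1. Qed.

Lemma continuous_bounded_triangle f : continuous f -> exists M, forall p, T p -> `|f p| <= M.
Proof.
move=> cf.
have cK : compact (`[(0 : R), 1]%classic `*` `[(0 : R), 1]%classic).
  by apply: compact_setX; exact: segment_compact.
have cn : {within `[(0 : R), 1]%classic `*` `[(0 : R), 1]%classic, continuous (fun p => `|f p|)}.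
  by apply: continuous_subspaceT => p; apply: continuous_comp; [exact: cf|exact: norm_continuous].
have [|c _ H] := @compact_EVT_max _ R (fun p => `|f p|) _ _ cK cn.
  by exists (0, 0); split; rewrite /= in_itv /= lexx ler01.
exists `|f c| => p /triangle_box[a b c' d]; apply: H; rewrite inE; split;
  by rewrite /= in_itv /= !ltW.
Qed.

Lemma L2_cont f : continuous f -> L2 f.
Proof.
move=> cf; have [M H] := continuous_bounded_triangle cf.
exact: L2_bounded (measT_cont cf) H.
Qed.

Lemma L2_smooth f : smooth f -> L2 f.
Proof. by move=> /smooth_cont /L2_cont. Qed.

Lemma L2M_smooth f g : L2 f -> smooth g -> L2 (fun p => f p * g p).
Proof.
move=> Lf sg; have [M H] := continuous_bounded_triangle (smooth_cont sg).
exact: L2_Mb Lf (measT_smooth sg) H.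
Qed.

Lemma L1M_smooth f g : L1 f -> smooth g -> L1 (fun p => f p * g p).
Proof.
move=> Lf sg; have [M H] := continuous_bounded_triangle (smooth_cont sg).
exact: L1_Mb Lf (measT_smooth sg) H.
Qed.

Lemma ip_ge0 f : 0 <= ip f f.
Proof. by apply: intT_ge0 => p _; rewrite -expr2 sqr_ge0. Qed.

Lemma ipC f g : ip f g = ip g f.
Proof. by apply: eq_intT => p _; rewrite mulrC. Qed.

Lemma ipDl f g v : L2 f -> L2 g -> L2 v -> ip (fun p => f p + g p) v = ip f v + ip g v.
Proof.
move=> Lf Lg Lv; rewrite -intTD; [|exact: L2M..].
by apply: eq_intT => p _; rewrite mulrDl.
Qed.

Lemma ipZl c f v : L2 f -> L2 v -> ip (fun p => c * f p) v = c * ip f v.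
Proof.
move=> Lf Lv; rewrite -intTZ; last exact: L2M.
by apply: eq_intT => p _; rewrite mulrA.
Qed.

Lemma cauchy_schwarz_ip f g : L2 f -> L2 g ->
  `|ip f g| <= Num.sqrt (ip f f) * Num.sqrt (ip g g).
Proof.
move=> Lf Lg.
have Q t : 0 <= ip f f - 2 * t * ip f g + t ^+ 2 * ip g g.
  have H : 0 <= intT (fun p => (f p - t * g p) ^+ 2) by apply: intT_ge0 => p _; rewrite sqr_ge0.
  suff <- : intT (fun p => (f p - t * g p) ^+ 2) =
         ip f f - 2 * t * ip f g + t ^+ 2 * ip g g by [].
  rewrite -[2 * t * _]intTZ ?L2M// -[t ^+ 2 * _]intTZ ?L2M//.
  rewrite -intTB; [|exact: L2M|exact/L1Z/L2M].
  rewrite -intTD; [|by apply: L1B; [exact: L2M|exact/L1Z/L2M]|exact/L1Z/L2M].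
  by apply: eq_intT => p _; ring.
rewrite -sqrtrM ?ip_ge0// -sqrtr_sqr ler_wsqrtr//.
have [g0|g0] := eqVneq (ip g g) 0.
  rewrite g0 mulr0; have [->|fg0] := eqVneq (ip f g) 0; first by rewrite expr0n.
  (* When g has norm 0 the quadratic is affine in t, and at this t it would take the value -1. *)
  have := Q ((ip f f + 1) / (2 * ip f g)); rewrite g0 mulr0 addr0.
  have -> : 2 * ((ip f f + 1) / (2 * ip f g)) * ip f g = ip f f + 1 by field.
  by move=> h; lra.
have gp : 0 < ip g g by rewrite lt_neqAle eq_sym g0 ip_ge0.
(* The minimum of the quadratic. *)
have := Q (ip f g / ip g g).
have -> : ip f f - 2 * (ip f g / ip g g) * ip f g + (ip f g / ip g g) ^+ 2 * ip g g
   = (ip f f * ip g g - ip f g ^+ 2) / ip g g by field.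
by rewrite pmulr_lge0 ?invr_gt0// subr_ge0.
Qed.

End Integration.

Arguments L2_cst {R} c.
Arguments L1_cst {R} c.
Arguments measurable_triangle {R}.
Arguments open_triangle {R}.
Arguments triangle_finite {R}.

(** * Integrable functions that vanish almost everywhere *)

Section NullFunctions.
Variable R : realType.
Local Notation P := (measurableTypeR R * measurableTypeR R)%type.
Local Notation mu := (@lebesgue_measure R).
Local Notation mu2 := (mu \x mu)%E.
Local Notation T := (@triangle R).
Implicit Types (f g F G : R * R -> R) (p : R * R) (e : R -> R).

Lemma measT_indic (D : set P) : measurable D -> measT (fun p => \1_D p).
Proof. by move=> mD; apply: measurable_funTS; exact: measurable_indic. Qed.

Lemma indic_le1 X (D : set X) (x : X) : `|\1_D x : R| <= 1.
Proof. by rewrite indicE; case: (_ \in _); rewrite ?normr1 ?normr0. Qed.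

Lemma L1_indic F (D : set P) : measurable D -> L1 F -> L1 (fun p => F p * \1_D p).
Proof.
by move=> mD iF; apply: (@L1_Mb _ _ _ 1) => //; [exact: measT_indic|move=> p _; exact: indic_le1].
Qed.

Lemma indic_preimage d (X : measurableType d) (pi : P -> X) (S : set X) :
  (fun p => \1_S (pi p) : R) = (fun p => \1_(pi @^-1` S) p).
Proof. by apply/funext => p; rewrite !indicE; congr (_%:R); rewrite !inE. Qed.

(** F has no sign, so this is not uniqueness of measures; but the sets over which F integrates to 0
    still form a Dynkin class. The map [pi] will be either projection, then the identity. *)
Lemma dynkin_null d (X : measurableType d) (pi : P -> X) (G : set (set X)) F :
  measurable_fun setT pi -> measurable = <<s G >> -> setI_closed G -> L1 F ->
  intT F = 0 -> (forall S, G S -> intT (fun p => F p * \1_S (pi p)) = 0) ->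
  forall S, measurable S -> intT (fun p => F p * \1_S (pi p)) = 0.
Proof.
move=> mpi mG IG iF F0 H S mS.
have mpre (S' : set X) : measurable S' -> measurable (pi @^-1` S' : set P).
  by move=> mS'; rewrite -[X in measurable X]setTI; exact: mpi.
have i1 (S' : set X) : measurable S' -> L1 (fun p => F p * \1_S' (pi p)).
  move=> mS'; have /(congr1 (fun w => L1 (fun p => F p * w p))) -> := indic_preimage pi S'.
  by apply: L1_indic => //; exact: mpre.
pose Q (S : set X) := intT (fun p => F p * \1_S (pi p)) = 0.
have QT : Q setT.
  by rewrite /Q -[RHS]F0; apply: eq_intT => p _; rewrite indicT mulr1.
have QC S' : measurable S' -> Q S' -> Q (~` S').
  move=> mS' QS'; rewrite /Q.
  have -> : intT (fun p => F p * \1_(~` S') (pi p)) = intT F - intT (fun p => F p * \1_S' (pi p)).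
    rewrite -intTB//; last exact: i1.
    apply: eq_intT => p _; rewrite !indicE in_setC.
    by case: (_ \in _) => /=; rewrite ?mulr0 ?mulr1 ?subrr ?subr0.
  by rewrite QS' F0 subrr.
have QU (D : (set X)^nat) : (forall n, measurable (D n)) -> trivIset [set: nat] D ->
    (forall n, Q (D n)) -> Q (\bigcup_k D k).
  move=> mD tD QD.
  (* Finite disjoint unions by additivity, the countable one by dominated convergence with bound
     |F|. *)
  pose s n p := F p * (\sum_(0 <= k < n) \1_(D k) (pi p)).
  have sE n p : (\sum_(0 <= k < n) \1_(D k) (pi p) : R) = \1_(\bigcup_(k < n) D k) (pi p).
    have [[k /= kn Dk]|nD] := pselect ((\bigcup_(k < n) D k) (pi p)).
      rewrite [RHS]indicE mem_set; last by exists k.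
      rewrite (bigD1_seq k) ?mem_index_iota ?iota_uniq //= [X in _ + X]big1_seq ?addr0.
        by rewrite indicE mem_set.
      move=> j /andP[jk _]; rewrite indicE memNset// => Dj.
      by move: jk => /eqP; apply; apply: tD => //; exists (pi p).
    rewrite [RHS]indicE memNset// big1_seq// => j /andP[_].
    by rewrite mem_index_iota => jn; rewrite indicE memNset// => Dj; apply: nD; exists j.
  have s1 n p : s n p = F p * \1_(\bigcup_(k < n) D k) (pi p) by rewrite /s sE.
  have ms n : measurable (\bigcup_(k < n) D k) by exact: bigcup_measurable.
  have s0 n : intT (s n) = 0.
    elim: n => [|n IH].
      rewrite (@eq_intT _ _ (fun=> 0)) ?intT0// => p _.
      by rewrite /s big_geq// mulr0.
    rewrite (@eq_intT _ _ (fun p => s n p + F p * \1_(D n) (pi p))).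
      rewrite intTD; [by rewrite IH QD addr0| |exact: i1].
      by apply: eq_L1 (i1 _ (ms n)) => p _; rewrite s1.
    by move=> p _; rewrite /s big_nat_recr//= mulrDr.
  have [|p Tp||n p Tp|_ c] := @intT_cvg _ s (fun p => F p * \1_(\bigcup_k D k) (pi p)) (fun p => `|F p|).
  - by move=> n; apply: L1_measT; apply: eq_L1 (i1 _ (ms n)) => p _; rewrite s1.
  - have [[k _ Dk]|nD] := pselect ((\bigcup_k D k) (pi p)).
      apply: cvg_near_cst; exists k.+1 => // n /= kn.
      rewrite s1 !indicE !mem_set//; last by exists k.
      by exists k.
    apply: cvg_near_cst; exists 0%N => // n _.
    rewrite s1 !indicE !memNset// => -[k _ Dk]; apply: nD; by exists k.
  - exact: L1_norm.
  - by rewrite s1 normrM ler_piMr// indic_le1.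
  rewrite /Q; have := cvg_unique _ c; apply => //.
  rewrite (_ : (fun n => _) = fun=> 0); first exact: cvg_cst.
  by apply/funext => n; exact: s0.
apply: (dynkin_induction mG IG QT H QC QU); by rewrite -mG.
Qed.

Let ray_closed : setI_closed (@RGenOInfty.G R).
Proof.
move=> _ _ [a ->] [b ->]; exists (Num.max a b).
by apply/seteqP; split=> x /=; rewrite !in_itv /= !andbT gt_max;
  [move=> [-> ->]|move=> /andP[-> ->]].
Qed.

(** Rays are replaced by arbitrary measurable sets in one coordinate, then in the other. This gives
    rectangles, which generate the product sigma-algebra. The quadrant at the origin contains the
    triangle and yields the total integral 0. *)
Lemma quadrant_null_ae F : L1 F ->
  (forall a b, intT (fun p => F p * (\1_(`]a, +oo[%classic) p.1 * \1_(`]b, +oo[%classic) p.2)) = 0) ->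
  aeT (fun p => F p = 0).
Proof.
move=> iF H.
have m1 (A : set (measurableTypeR R)) : measurable A -> measurable ((@fst R R) @^-1` A : set P).
  by move=> mA; rewrite -[X in measurable X]setTI; exact: measurable_fst.
have m2 (A : set (measurableTypeR R)) : measurable A -> measurable ((@snd R R) @^-1` A : set P).
  by move=> mA; rewrite -[X in measurable X]setTI; exact: measurable_snd.
have i1 F' (A : set (measurableTypeR R)) : measurable A -> L1 F' -> L1 (fun p => F' p * \1_A p.1).
  move=> mA iF'; have /(congr1 (fun w => L1 (fun p => F' p * w p))) -> := @indic_preimage _ _ (@fst _ _ : P -> measurableTypeR R) A.
  by apply: L1_indic => //; exact: m1.
have i2 F' (A : set (measurableTypeR R)) : measurable A -> L1 F' -> L1 (fun p => F' p * \1_A p.2).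
  move=> mA iF'; have /(congr1 (fun w => L1 (fun p => F' p * w p))) -> := @indic_preimage _ _ (@snd _ _ : P -> measurableTypeR R) A.
  by apply: L1_indic => //; exact: m2.
have one x : 0 < x -> \1_(`]0, +oo[%classic) x = 1 :> R.
  by move=> x0; rewrite indicE mem_set //= in_itv /= x0.
have F0 : intT F = 0.
  by rewrite -[RHS](H 0 0); apply: eq_intT => p [p1 p2 _]; rewrite !one// !mulr1.
have S1 (A : set (measurableTypeR R)) b : measurable A ->
    intT (fun p => F p * \1_(`]b, +oo[%classic) p.2 * \1_A p.1) = 0.
  move=> mA.
  apply: (@dynkin_null _ _ (@fst _ _ : P -> measurableTypeR R) (@RGenOInfty.G R)
    (fun p => F p * \1_(`]b, +oo[%classic) p.2)) => //.
  - exact: (RGenOInfty.measurableE R).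
  - exact: (i2 _ _ (measurable_itv _)).
  - by rewrite -[RHS](H 0 b); apply: eq_intT => p [p1 _ _]; rewrite one// mul1r.
  - by move=> _ [a ->]; rewrite -[RHS](H a b); apply: eq_intT => p _; ring.
have S2 (A B : set (measurableTypeR R)) : measurable A -> measurable B ->
    intT (fun p => F p * \1_A p.1 * \1_B p.2) = 0.
  move=> mA mB.
  apply: (@dynkin_null _ _ (@snd _ _ : P -> measurableTypeR R) (@RGenOInfty.G R)
    (fun p => F p * \1_A p.1)) => //.
  - exact: (RGenOInfty.measurableE R).
  - exact: i1.
  - by rewrite -[RHS](S1 A 0 mA); apply: eq_intT => p [_ p2 _]; rewrite one// mulr1.
  - by move=> _ [b ->]; rewrite -[RHS](S1 A b mA); apply: eq_intT => p _; ring.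
have S3 (D : set P) : measurable D -> intT (fun p => F p * \1_D p) = 0.
  move=> mD.
  apply: (@dynkin_null _ _ (id : P -> P) _ F _ (measurable_prod_measurableType _ _)) => //.
  - move=> _ _ [A1 mA1 [B1 mB1 <-]] [A2 mA2 [B2 mB2 <-]].
    exists (A1 `&` A2); first exact: measurableI.
    exists (B1 `&` B2); first exact: measurableI.
    by rewrite setXI.
  - move=> _ [A mA [B mB <-]]; rewrite -[RHS](S2 A B mA mB); apply: eq_intT => p _ /=.
    rewrite -mulrA; congr (_ * _); rewrite !indicE -natrM mulnb; congr ((nat_of_bool _)%:R).
    by apply/idP/andP; rewrite !inE.
have := @integral_ae_eq _ _ _ mu2 T measurable_triangle (cst 0%E) (EFin \o F) iF (measurable_cst _).
case.
  move=> E ET mE; rewrite integral0.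
  have iE : mu2.-integrable E (EFin \o F) by apply: integrableS iF => //; exact: measurable_triangle.
  rewrite -[LHS]fineK; last exact: (integrable_fin_num mE iE).
  congr EFin; rewrite -(S3 E mE) /intT [RHS]Rintegral_mkcond.
  rewrite -/(Rintegral mu2 E F) Rintegral_mkcond; apply: eq_Rintegral => p _.
  rewrite !patchE indicE; have [pE|pE] := boolP (p \in E).
    by rewrite mem_set ?mulr1//; apply: ET; exact/set_mem.
  by rewrite mulr0 if_same.
move=> N [mN N0 sN]; exists N; split => // p /= np; apply: sN => /= h; apply: np => Tp.
by have [] := h Tp.
Qed.

(** Ramps approximate the indicators of rays. The factors vanish up to a positive h so that their
    products stay away from the legs, as test functions must. *)
Lemma tensor_null_ae F : L1 F ->
  (forall e1 e2 h, 0 < h -> smooth1 e1 -> smooth1 e2 ->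
    (forall x, x <= h -> e1 x = 0) -> (forall x, x <= h -> e2 x = 0) ->
    intT (fun p => F p * (e1 p.1 * e2 p.2)) = 0) ->
  aeT (fun p => F p = 0).
Proof.
move=> iF H; apply: quadrant_null_ae => // a0 b0.
(* Inside the triangle a negative threshold has the same effect as 0. *)
wlog [a_ge0 b_ge0] : a0 b0 / 0 <= a0 /\ 0 <= b0.
  move=> W; rewrite -[RHS](W (Num.max a0 0) (Num.max b0 0)); last by rewrite !le_max !lexx !orbT.
  apply: eq_intT => p [p1 p2 _]; congr (_ * (_ * _)); rewrite !indicE; congr ((nat_of_bool _)%:R).
    by apply/idP/idP; rewrite !inE /= !in_itv /= !andbT gt_max p1 andbT.
  by apply/idP/idP; rewrite !inE /= !in_itv /= !andbT gt_max p2 andbT.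
pose d n : R := n.+1%:R^-1.
have d0 n : 0 < d n by rewrite invr_gt0.
(* Both ends lie strictly to the right of a: the ramp vanishes near a, and its limit at a is 0, as
   for the open ray. *)
pose r (a : R) n := ramp (a + d n) (a + 2 * d n).
have rlt (a : R) n : a + d n < a + 2 * d n by rewrite ltrD2l mulr_natl mulr2n ltrDl.
have r01 a n x : `|r a n x| <= 1.
  by rewrite /r; have /andP[? ?] := ramp01 (a + d n) (a + 2 * d n) x; rewrite ger0_norm.
have rcv (a x : R) : r a n x @[n --> \oo] --> (\1_(`]a, +oo[%classic) x : R).
  have [xa|ax] := leP x a.
    rewrite indicE memNset; last by rewrite /= in_itv /= andbT ltNge xa.
    apply: cvg_near_cst; near=> n; rewrite /r ramp0//.
    by rewrite (le_trans xa)// lerDl ltW.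
  rewrite indicE mem_set; last by rewrite /= in_itv /= andbT.
  apply: cvg_near_cst; near=> n; rewrite /r ramp1// -lerBrDl.
  rewrite mulrC -ler_pdivlMr// ltW//.
  near: n; have c := @cvg_harmonic R.
  have /cvgrPdist_lt/(_ ((x - a) / 2)) := c.
  rewrite divr_gt0 ?subr_gt0// => /(_ isT) [N _ HN]; exists N => // n /HN /=.
  by rewrite sub0r normrN ger0_norm// invr_ge0.
have [|p Tp||n p Tp|_ c] := @intT_cvg _ (fun n p => F p * (r a0 n p.1 * r b0 n p.2))
  (fun p => F p * (\1_(`]a0, +oo[%classic) p.1 * \1_(`]b0, +oo[%classic) p.2)) (fun p => `|F p|).
- move=> n; apply: measTM; first exact: L1_measT.
  by apply: measT_smooth; apply: smooth_tensor; exact: smooth1_ramp.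
- by apply: cvgM; [exact: cvg_cst|apply: cvgM; exact: rcv].
- exact: L1_norm.
- rewrite normrM ler_piMr// normrM -[leRHS]mul1r ler_pM//.
have := cvg_unique _ c; apply => //.
rewrite (_ : (fun n => _) = fun=> 0); first exact: cvg_cst.
apply/funext => n; apply: (H _ _ (d n)) => //; try exact: smooth1_ramp.
  by move=> x xd; rewrite /r ramp0// (le_trans xd)// lerDr.
by move=> x xd; rewrite /r ramp0// (le_trans xd)// lerDr.
Unshelve. all: by end_near. Qed.

End NullFunctions.

(** * Test functions: integration by parts and the fundamental lemma *)

Section TestFunctions.
Variable R : realType.
Local Notation P := (measurableTypeR R * measurableTypeR R)%type.
Local Notation mu := (@lebesgue_measure R).
Local Notation mu2 := (mu \x mu)%E.
Local Notation T := (@triangle R).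
Implicit Types (f g phi psi : R * R -> R) (p : R * R) (e : R -> R).

Lemma test_smooth phi : test phi -> smooth phi.
Proof. by case. Qed.

Lemma test_out phi p : test phi -> ~ T p -> phi p = 0.
Proof. by move=> [_ [K [_ KT K0]]] nT; apply: K0 => /KT. Qed.

Lemma test_pd i phi : test phi -> test (pd i phi).
Proof.
move=> [sphi [K [cK KT K0]]]; split; first exact: smooth_pd.
exists K; split=> // p nKp.
have clK : closed K by apply: compact_closed => //; exact: norm_hausdorff.
rewrite (@near_pd _ i phi (fun=> 0)) ?pd_cst//.
have := open_nbhs_nbhs (conj (closed_openC clK) (nKp : (~` K) p)).
by apply: filterS => q; exact: K0.
Qed.

Lemma test_pds w phi : test phi -> test (pds w phi).
Proof. by move=> tphi; elim: w => //= i w IH; exact: test_pd. Qed.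

Lemma test_mull f phi : smooth f -> test phi -> test (fun p => f p * phi p).
Proof.
move=> sf [sphi [K [cK KT K0]]]; split; first exact: smoothM.
by exists K; split=> // p nK; rewrite K0 ?mulr0.
Qed.

Lemma test_inner f h : 0 < h -> smooth f ->
  (forall p, p.1 < h \/ p.2 < h \/ 1 - h < p.1 + p.2 -> f p = 0) -> test f.
Proof.
move=> h0 sf H; split=> //.
exists [set p | [/\ h <= p.1, h <= p.2 & p.1 + p.2 <= 1 - h]]; split.
- apply: (@subclosed_compact _ _ (`[(0 : R), 1]%classic `*` `[(0 : R), 1]%classic)).
  + have -> : [set p : R * R | [/\ h <= p.1, h <= p.2 & p.1 + p.2 <= 1 - h]] =
      fst @^-1` [set x | h <= x] `&` snd @^-1` [set x | h <= x] `&`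
      (fun p => p.1 + p.2) @^-1` [set x | x <= 1 - h].
      by apply/seteqP; split=> p /= => [[]|[[]]].
    have cadd : continuous (fun p : R * R => p.1 + p.2).
      exact: smooth_cont (smoothD (smooth_co 0) (smooth_co 1)).
    apply: closedI; [apply: closedI|].
    * by apply: closed_comp => [p _|]; [exact: cvg_fst|exact: closed_ge].
    * by apply: closed_comp => [p _|]; [exact: cvg_snd|exact: closed_ge].
    * by apply: closed_comp => [p _|]; [exact: cadd|exact: closed_le].
  + by apply: compact_setX; exact: segment_compact.
  + move=> p /= [a b c]; split; rewrite /= in_itv /=; apply/andP; split; lra.
- by move=> p [a b c]; split; lra.
- move=> p /= np; apply: H; apply: contrapT => n; apply: np.
  split; rewrite leNgt; apply/negP => a; apply: n; [by left|by right; left|by right; right].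
Qed.

Definition slice (i : 'I_2) p (t : R) : R * R := if i == 0 then (t, p.2) else (p.1, t).

Lemma slice_cont i p : continuous (slice i p).
Proof.
case: (ord2E i) => -> t.
  exact: (@cvg_pair _ _ _ (nbhs t) (nbhs t) (nbhs p.2) _ _ _ id (cst p.2) cvg_id (cvg_cst _)).
exact: (@cvg_pair _ _ _ (nbhs t) (nbhs p.1) (nbhs t) _ _ _ (cst p.1) id (cvg_cst _) cvg_id).
Qed.

Lemma sliceE i p t h : slice i p (h + t) = h *: basis R i + slice i p t.
Proof.
case: (ord2E i) => ->; apply: injective_projections => /=;
  by rewrite /GRing.scale /= ?mulr1 ?mulr0 ?add0r.
Qed.

Lemma derivable_slice i f p t : derivable f (slice i p t) (basis R i) ->
  derivable (fun t => f (slice i p t)) t 1.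
Proof.
rewrite /derivable => H.
rewrite (_ : (fun h : R => _) = fun h => h^-1 *: ((f \o shift (slice i p t)) (h *: basis R i)
  - f (slice i p t))) //.
by apply/funext => h; rewrite /= -sliceE [h *: 1]mulr1.
Qed.

Lemma derive1_slice i f p t : (fun t => f (slice i p t))^`() t = pd i f (slice i p t).
Proof.
rewrite /derive1 /pd /derive; do 2 f_equal.
by apply/funext => h; rewrite /= -sliceE.
Qed.

Lemma integral_slice0 i psi p : test psi ->
  (\int[mu]_t (pd i psi (slice i p t))%:E = 0)%E.
Proof.
move=> tpsi; have spsi := test_smooth tpsi.
(* The triangle lies in the unit square, so -1 and 2 are safely outside. *)
have outT (t : R) : t <= -1 \/ 2 <= t -> ~ T (slice i p t).
  by move=> ht /triangle_box; rewrite /slice; case: ifP => _ /= [? ? ? ?];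
    case: ht => ?; lra.
pose e (t : R) := psi (slice i p t).
transitivity (\int[mu]_(t in `[(-1)%R, 2%R]) (e^`() t)%:E)%E.
  rewrite [RHS]integral_mkcond; apply: eq_integral => t _.
  rewrite patchE mem_setE; case: ifPn; first by rewrite /e derive1_slice.
  rewrite in_itv /= negb_and -!ltNge => /orP ht.
  rewrite (test_out (test_pd i tpsi))//; apply: outT.
  by case: ht => /ltW; [left|right].
rewrite ftc_C1.
- rewrite /e !(test_out tpsi) ?subrr//; apply: outT; by [left|right].
- by move=> t; apply: derivable_slice; exact: smooth_derivable.
- rewrite (_ : e^`() = fun t => pd i psi (slice i p t)); last first.
    by apply/funext => t; rewrite derive1_slice.
  move=> t; apply: continuous_comp; first exact: slice_cont.
  by apply: smooth_cont; exact: smooth_pd.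
- by lra.
Qed.

(** As psi vanishes outside the triangle, the integral extends to the plane, where integration along
    direction i comes first and gives 0 on each line. *)
Lemma intT_pd_test i psi : test psi -> intT (pd i psi) = 0.
Proof.
move=> tpsi; have tp := test_pd i tpsi.
have ptch : (EFin \o pd i psi) \_ T = EFin \o pd i psi.
  apply/funext => p; rewrite patchE; case: ifPn => // /negP nT /=.
  by rewrite (test_out tp)// => Tp; apply: nT; rewrite inE.
have iF : mu2.-integrable setT (EFin \o pd i psi).
  rewrite -ptch; apply/(integrable_mkcond _ measurable_triangle).
  by apply: L2_L1; apply: L2_smooth; exact: test_smooth.
rewrite /intT /Rintegral integral_mkcond ptch.
have -> : (\int[mu2]_p (EFin \o pd i psi) p = 0)%E.
  case: (ord2E i) => ei.
    rewrite -(integral21_prod_meas1 iF); apply: integral0_eq => y _.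
    by rewrite /fubini_G -[RHS](integral_slice0 i (0, y) tpsi) ei.
  rewrite -(integral12_prod_meas1 iF); apply: integral0_eq => x _.
  by rewrite /fubini_F -[RHS](integral_slice0 i (x, 0) tpsi) ei.
by [].
Qed.

Lemma ip_pd i f phi : smooth f -> test phi -> ip f (pd i phi) = - ip (pd i f) phi.
Proof.
move=> sf tphi; have sphi := test_smooth tphi.
have := intT_pd_test i (test_mull sf tphi); rewrite pdM// => H.
apply/eqP; rewrite -subr_eq0 opprK -[X in _ == X]H; apply/eqP; rewrite -intTD.
- by apply: eq_intT => p _; rewrite [in RHS](mulrC (phi p)).
- exact: L2M (L2_smooth sf) (L2_smooth (smooth_pd i sphi)).
- exact: L2M (L2_smooth (smooth_pd i sf)) (L2_smooth sphi).
Qed.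

(** The outermost derivative of phi is moved first and becomes the innermost one on f, hence
    [rev w]. *)
Lemma ip_pds w f phi : smooth f -> test phi ->
  ip f (pds w phi) = (-1) ^+ size w * ip (pds (rev w) f) phi.
Proof.
move=> sf; elim: w f sf => [|i w IH] f sf tphi; first by rewrite mul1r.
rewrite /= ip_pd//; last exact: test_pds.
rewrite IH//; last exact: smooth_pd.
by rewrite rev_cons /pds -cats1 foldr_cat /= exprS mulN1r mulNr.
Qed.

(** Fundamental lemma of the calculus of variations. The products in [tensor_null_ae] already avoid
    the legs; a cut-off at the hypotenuse, tending to 1, makes them test functions. *)
Lemma test_null_ae g : L2 g -> (forall phi, test phi -> ip g phi = 0) ->
  aeT (fun p => g p = 0).
Proof.
move=> Lg H; apply: tensor_null_ae; first exact: L2_L1.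
move=> e1 e2 h h0 s1 s2 z1 z2.
pose d n : R := n.+1%:R^-1.
have d0 n : 0 < d n by rewrite invr_gt0.
pose c n p := 1 - ramp (1 - 2 * d n) (1 - d n) (p.1 + p.2).
have clt n : 1 - 2 * d n < 1 - d n by rewrite ltrD2l ltrN2 mulr_natl mulr2n ltrDl.
have sc n : smooth (c n).
  by apply: smoothB; [exact: smooth_cst|apply: smooth_add; exact: smooth1_ramp].
have se := smooth_tensor s1 s2.
have [|p [p1 p2 p3]||n p Tp|_ cv] := @intT_cvg _ (fun n p => g p * (c n p * (e1 p.1 * e2 p.2)))
  (fun p => g p * (e1 p.1 * e2 p.2)) (fun p => `|g p * (e1 p.1 * e2 p.2)|).
- by move=> n; apply: measTM; [exact: L2_measT|apply: measT_smooth; exact: smoothM].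
- apply: cvg_near_cst; near=> n; congr (_ * _).
  rewrite /c ramp0// ?subr0 ?mul1r// lerBrDr -lerBrDl mulrC -ler_pdivlMr// ltW//.
  near: n; have ch := @cvg_harmonic R.
  have /cvgrPdist_lt/(_ ((1 - (p.1 + p.2)) / 2)) := ch.
  rewrite divr_gt0 ?subr_gt0// => /(_ isT) [N _ HN]; exists N => // n /HN /=.
  by rewrite sub0r normrN ger0_norm// invr_ge0.
- by apply: L1_norm; apply: L2_L1; exact: L2M_smooth.
- rewrite mulrCA normrM ler_piMl// /c.
  by have /andP[? ?] := ramp01 (1 - 2 * d n) (1 - d n) (p.1 + p.2);
    rewrite ger0_norm ?subr_ge0// gerBl.
have := cvg_unique _ cv; apply => //.
rewrite (_ : (fun n => _) = fun=> 0); first exact: cvg_cst.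
apply/funext => n; apply: H; apply: (@test_inner _ (Num.min h (d n))).
- by rewrite lt_min h0 d0.
- exact: smoothM.
- have [mh md] : Num.min h (d n) <= h /\ Num.min h (d n) <= d n by rewrite !ge_min !lexx orbT.
  move=> p [q|[q|q]].
  + by rewrite z1 ?mul0r ?mulr0// (le_trans (ltW q)).
  + by rewrite z2 ?mulr0// (le_trans (ltW q)).
  + by rewrite /c ramp1 ?subrr ?mul0r// (le_trans _ (ltW q))// lerD2l lerN2.
Unshelve. all: by end_near. Qed.

End TestFunctions.

(** * Weak derivatives, the spaces of the statement, and the pairing with tensors *)

Section WeakDerivatives.
Variable R : realType.
Local Notation T := (@triangle R).
Implicit Types (f g v z phi psi : R * R -> R) (p : R * R).
Implicit Types Theta : 'I_2 -> 'I_2 -> R * R -> R.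

Lemma ip_test_ae_unique g g' : L2 g -> L2 g' ->
  (forall phi, test phi -> ip g phi = ip g' phi) -> aeT (fun p => g p = g' p).
Proof.
move=> Lg Lg' H.
have H0 : aeT (fun p => g p - g' p = 0).
  apply: test_null_ae; first exact: L2B.
  move=> phi tphi; have Lphi := L2_smooth (test_smooth tphi).
  have -> : ip (fun p => g p - g' p) phi = ip g phi - ip g' phi.
    rewrite -intTB; [|exact: L2M..].
    by apply: eq_intT => p _; rewrite mulrBl.
  by rewrite H// subrr.
by apply: (aeTS H0) => p _ /eqP; rewrite subr_eq0 => /eqP.
Qed.

Lemma ae_ip g g' f : L2 g -> L2 g' -> L2 f -> aeT (fun p => g p = g' p) ->
  ip g f = ip g' f.
Proof.
move=> Lg Lg' Lf H; apply: ae_intT.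
- by apply: measTM; exact: L2_measT.
- by apply: measTM; exact: L2_measT.
- by apply: (aeTS H) => p _ ->.
Qed.

Lemma is_wD_unique w z g g' : is_wD w z g -> is_wD w z g' -> aeT (fun p => g p = g' p).
Proof.
move=> [Lg Hg] [Lg' Hg']; apply: ip_test_ae_unique => // phi tphi.
have := Hg _ tphi; rewrite Hg'// => /(congr1 (fun x => (-1) ^+ size w * x)).
by rewrite !mulrA -!expr2 !sqrr_sign !mul1r.
Qed.

Lemma is_wDP w z : (exists g, is_wD w z g) -> is_wD w z (wD w z).
Proof. by move=> [g Hg]; rewrite /wD; apply: (xgetPex (fun=> 0)); exists g. Qed.

Lemma H2_L2 z : H2 z -> L2 z. Proof. by case. Qed.

Lemma H2_wD w z : H2 z -> (size w <= 2)%N -> is_wD w z (wD w z).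
Proof. by move=> [_ H] sw; apply: is_wDP; exact: H. Qed.

Lemma L2_hessian z i j : H2 z -> L2 (hessian z i j).
Proof. by move=> Hz; have [] := H2_wD (w := [:: i; j]) Hz isT. Qed.

Lemma is_wD_lin w a z z' g g' : L2 z -> L2 z' -> is_wD w z g -> is_wD w z' g' ->
  is_wD w (a \*: z \+ z') (fun p => a * g p + g' p).
Proof.
move=> Lz Lz' [Lg Hg] [Lg' Hg']; split; first by apply: L2D => //; exact: L2Z.
move=> phi tphi; have Lp := L2_smooth (test_smooth (test_pds w tphi)).
have Lphi := L2_smooth (test_smooth tphi).
have lin f f' h : L2 f -> L2 f' -> L2 h ->
    ip (fun p => a * f p + f' p) h = a * ip f h + ip f' h.
  by move=> Lf Lf' Lh; rewrite ipDl ?ipZl//; exact: L2Z.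
by rewrite (lin z z')// (lin g g')// Hg// Hg'//; ring.
Qed.

Lemma H2_lin a z z' : H2 z -> H2 z' -> H2 (a \*: z \+ z').
Proof.
move=> [Lz Hz] [Lz' Hz']; split; first by apply: L2D => //; exact: L2Z.
move=> w sw; have [g Hg] := Hz w sw; have [g' Hg'] := Hz' w sw.
by exists (fun p => a * g p + g' p); exact: is_wD_lin.
Qed.

(** Weak derivatives are picked by choice, hence linear only almost everywhere. *)
Lemma hessian_lin a z z' i j : H2 z -> H2 z' ->
  aeT (fun p => hessian (a \*: z \+ z') i j p = a * hessian z i j p + hessian z' i j p).
Proof.
move=> Hz Hz'; apply: (is_wD_unique (w := [:: i; j]) (z := a \*: z \+ z')).
  by apply: H2_wD => //; exact: H2_lin.
by apply: is_wD_lin; [exact: H2_L2|exact: H2_L2|exact: H2_wD|exact: H2_wD].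
Qed.

Lemma is_wD0 w : is_wD w (fun=> 0) (fun=> 0 : R).
Proof.
split; first exact: L2_cst.
move=> phi tphi; rewrite !ipE.
by rewrite !(@eq_intT _ (fun p => 0 * _) (fun=> 0)) ?intT0 ?mulr0// => p _; rewrite mul0r.
Qed.

Lemma H2_0 : H2 (fun=> 0 : R).
Proof. by split; [exact: L2_cst|move=> w _; exists (fun=> 0); exact: is_wD0]. Qed.

Lemma ip_laplace f phi : L2 f -> test phi ->
  ip f (laplace phi) = \sum_(i < 2) ip f (pds [:: i; i] phi).
Proof.
move=> Lf tphi; rewrite big_ord_recl big_ord1 /=.
have L i : L2 (pds [:: i; i] phi) by exact: L2_smooth (smooth_pds _ (test_smooth tphi)).
rewrite -intTD; [|exact: L2M Lf (L _)|exact: L2M Lf (L _)].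
by apply: eq_intT => p _; rewrite /laplace big_ord_recl big_ord1 mulrDr.
Qed.

Lemma smooth_laplace f : smooth f -> smooth (laplace f).
Proof.
move=> sf; have -> : laplace f = fun p => pds [:: ord0; ord0] f p + pds [:: lift ord0 ord0; lift ord0 ord0] f p.
  by apply/funext => p; rewrite /laplace big_ord_recl big_ord1.
by apply: smoothD; exact: smooth_pds.
Qed.

Lemma is_wlaplace_unique v g g' : is_wlaplace v g -> is_wlaplace v g' ->
  aeT (fun p => g p = g' p).
Proof.
move=> [Lg Hg] [Lg' Hg']; apply: ip_test_ae_unique => // phi tphi.
by rewrite -Hg// Hg'.
Qed.

Lemma is_wlaplaceP v : (exists g, is_wlaplace v g) -> is_wlaplace v (wlaplace v).
Proof. by move=> [g Hg]; rewrite /wlaplace; apply: (xgetPex (fun=> 0)); exists g. Qed.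

Lemma is_wlaplace_smooth v : smooth v -> is_wlaplace v (laplace v).
Proof.
move=> sv; split; first exact: L2_smooth (smooth_laplace sv).
move=> phi tphi; rewrite ip_laplace//; last exact: L2_smooth.
have Lphi := L2_smooth (test_smooth tphi).
have L i : L2 (pds [:: i; i] v) by exact: L2_smooth (smooth_pds _ sv).
rewrite [RHS]ipC [RHS]ipE.
transitivity (\sum_(i < 2) ip (pds [:: i; i] v) phi).
  by apply: eq_bigr => i _; rewrite ip_pds//= sqrrN expr1n mul1r.
rewrite big_ord_recl big_ord1 -intTD; [|exact: L2M (L _) Lphi|exact: L2M (L _) Lphi].
apply: eq_intT => p _; rewrite /laplace big_ord_recl big_ord1 mulrDr.
by congr (_ + _); exact: mulrC.
Qed.

Lemma is_wlaplace_H2 z : H2 z -> is_wlaplace z (fun p => \sum_(i < 2) hessian z i i p).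
Proof.
move=> Hz; have Lh i := L2_hessian i i Hz.
have E p : \sum_(i < 2) hessian z i i p =
    hessian z ord0 ord0 p + hessian z (lift ord0 ord0) (lift ord0 ord0) p.
  by rewrite big_ord_recl big_ord1.
split; first by under eq_fun do rewrite E; exact: L2D.
move=> phi tphi; rewrite ip_laplace//; last exact: H2_L2.
have Lphi := L2_smooth (test_smooth tphi).
under [in RHS]eq_fun do rewrite E.
rewrite ipDl// big_ord_recl big_ord1.
have h i : ip z (pds [:: i; i] phi) = ip (hessian z i i) phi.
  have [_ ->] := H2_wD (w := [:: i; i]) Hz isT => //.
  by rewrite /= sqrrN expr1n mul1r.
congr (_ + _); exact: h.
Qed.

(** Classical counterpart of [divDiv], with the order of derivatives that integration by parts
    leaves (see [ip_pds]). *)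
Definition cdivDiv Theta : R * R -> R :=
  fun p => \sum_(i < 2) \sum_(j < 2) pds [:: j; i] (Theta i j) p.

Lemma smooth_sum n (F : 'I_n -> R * R -> R) : (forall i, smooth (F i)) ->
  smooth (fun p => \sum_(i < n) F i p).
Proof.
elim: n F => [|n IH] F s; first by under eq_fun do rewrite big_ord0; exact: smooth_cst.
by under eq_fun do rewrite big_ord_recl; exact: smoothD (s _) (IH _ _).
Qed.

Lemma smooth_cdivDiv Theta : (forall i j, smooth (Theta i j)) -> smooth (cdivDiv Theta).
Proof.
move=> s; apply: (@smooth_sum 2 (fun i p => \sum_(j < 2) pds [:: j; i] (Theta i j) p)) => i.
apply: (@smooth_sum 2 (fun j => pds [:: j; i] (Theta i j))) => j.
exact: (smooth_pds [:: j; i] (s i j)).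
Qed.

Lemma L2_sum n (F : 'I_n -> R * R -> R) : (forall i, L2 (F i)) ->
  L2 (fun p => \sum_(i < n) F i p).
Proof.
elim: n F => [|n IH] F L; first by under eq_fun do rewrite big_ord0; exact: L2_cst.
by under eq_fun do rewrite big_ord_recl; apply: L2D => //; exact: IH.
Qed.

Lemma ip_suml n (F : 'I_n -> R * R -> R) f : (forall i, L2 (F i)) -> L2 f ->
  ip (fun p => \sum_(i < n) F i p) f = \sum_(i < n) ip (F i) f.
Proof.
move=> L Lf; elim: n F L => [|n IH] F L.
  rewrite big_ord0 ipE (@eq_intT _ _ (fun=> 0)) ?intT0// => p _.
  by rewrite big_ord0 mul0r.
rewrite big_ord_recl -IH// -ipDl//; last exact: L2_sum.
by apply: eq_intT => p _; rewrite big_ord_recl.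
Qed.

Lemma is_divDiv_smooth Theta : (forall i j, smooth (Theta i j)) ->
  is_divDiv Theta (cdivDiv Theta).
Proof.
move=> s; split; first exact: L2_smooth (smooth_cdivDiv s).
move=> phi tphi; have Lphi := L2_smooth (test_smooth tphi).
have L i j : L2 (pds [:: j; i] (Theta i j)) by exact: L2_smooth (smooth_pds _ (s i j)).
rewrite /ipt ip_suml//; last by move=> i; exact: L2_sum.
apply: eq_bigr => i _; rewrite ip_suml//; apply: eq_bigr => j _.
by rewrite ip_pds//= sqrrN expr1n mul1r.
Qed.

Lemma is_divDiv_unique Theta g g' : is_divDiv Theta g -> is_divDiv Theta g' ->
  aeT (fun p => g p = g' p).
Proof.
move=> [Lg Hg] [Lg' Hg']; apply: ip_test_ae_unique => // phi tphi.
by rewrite -Hg// Hg'.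
Qed.

Lemma is_divDivP Theta : (exists g, is_divDiv Theta g) -> is_divDiv Theta (divDiv Theta).
Proof. by move=> [g Hg]; rewrite /divDiv; apply: (xgetPex (fun=> 0)); exists g. Qed.

Lemma ip_ae0 g : L2 g -> aeT (fun p => g p = 0) -> ip g g = 0.
Proof.
move=> Lg H; rewrite (@ae_ip g (fun=> 0) g) //; last exact: L2_cst.
by rewrite ipE (@eq_intT _ _ (fun=> 0)) ?intT0// => p _; rewrite mul0r.
Qed.

Lemma HLap_smooth v : smooth v -> HLap v.
Proof.
move=> sv; split; [exact: L2_smooth|by exists (laplace v); exact: is_wlaplace_smooth|].
move=> e e0; exists v; split=> //.
have -> : v \- v = fun=> 0 by apply/funext => p; rewrite /= subrr.
have s0 : is_wlaplace (fun=> 0 : R) (fun=> 0).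
  split; first exact: L2_cst.
  by move=> phi _; rewrite !ipE; apply: eq_intT => p _; rewrite !mul0r.
have [L _] := is_wlaplaceP (ex_intro _ _ s0).
have H := is_wlaplace_unique (is_wlaplaceP (ex_intro _ _ s0)) s0.
rewrite /norm_Lap (ip_ae0 L H) (ip_ae0 (L2_cst 0) (aeTW (fun _ _ => erefl))).
by rewrite addr0 sqrtr0.
Qed.

Lemma HdivDiv_smooth Theta : (forall i j, smooth (Theta i j)) ->
  (forall i j p, Theta i j p = Theta j i p) -> HdivDiv Theta.
Proof.
move=> s sym; split.
- by move=> i j; exact: L2_smooth.
- by exists (cdivDiv Theta); exact: is_divDiv_smooth.
move=> e e0; exists Theta; split=> //.
have -> : (fun i j => Theta i j \- Theta i j) = fun=> fun=> fun=> 0.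
  by apply/funext => i; apply/funext => j; apply/funext => p; rewrite /= subrr.
have z0 f : ip (fun=> 0 : R) f = 0.
  by rewrite ipE (@eq_intT _ _ (fun=> 0)) ?intT0// => p _; rewrite mul0r.
have s0 : is_divDiv (fun _ _ _ => 0 : R) (fun=> 0).
  split; first exact: L2_cst.
  by move=> phi _; rewrite z0 /ipt big1// => i _; rewrite big1// => j _; rewrite z0.
have [L _] := is_divDivP (ex_intro _ _ s0).
have H := is_divDiv_unique (is_divDivP (ex_intro _ _ s0)) s0.
rewrite /norm_divDiv (ip_ae0 L H) /ipt big1 ?addr0 ?sqrtr0// => i _.
by rewrite big1// => j _; rewrite z0.
Qed.

(* For B = div Div A these are the functionals of H^{-3/2,-1/2}(boundary of T). *)
Definition pairing (A : 'I_2 -> 'I_2 -> R * R -> R) (B z : R * R -> R) : R :=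
  ip B z - ipt A (hessian z).

Definition nrm f : R := Num.sqrt (ip f f).

Lemma nrm_ge0 f : 0 <= nrm f. Proof. exact: sqrtr_ge0. Qed.

Lemma ipt_ge0 Theta : 0 <= ipt Theta Theta.
Proof. by apply: sumr_ge0 => i _; apply: sumr_ge0 => j _; exact: ip_ge0. Qed.

Lemma nrm_le_H2 z : nrm z <= norm_H2 z.
Proof. by rewrite ler_wsqrtr// lerDl ipt_ge0. Qed.

Lemma ge_term_sum2 (F : 'I_2 -> 'I_2 -> R) i j : (forall i j, 0 <= F i j) ->
  F i j <= \sum_(i < 2) \sum_(j < 2) F i j.
Proof.
move=> F0; rewrite (bigD1 i)//= (bigD1 j)//= -addrA lerDl addr_ge0//.
  by apply: sumr_ge0.
by apply: sumr_ge0 => k _; apply: sumr_ge0.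
Qed.

Lemma nrm_hessian_le_H2 z i j : nrm (hessian z i j) <= norm_H2 z.
Proof.
apply: ler_wsqrtr.
have := @ge_term_sum2 (fun i j => ip (hessian z i j) (hessian z i j)) i j (fun i j => ip_ge0 _).
move=> H; apply: (le_trans H); rewrite lerDr; exact: ip_ge0.
Qed.

Lemma pairing_bound A B z : (forall i j, L2 (A i j)) -> L2 B -> H2 z ->
  `|pairing A B z| <= (nrm B + \sum_(i < 2) \sum_(j < 2) nrm (A i j)) * norm_H2 z.
Proof.
move=> LA LB Hz; rewrite mulrDl (le_trans (ler_normB _ _))// lerD//.
  rewrite (le_trans (cauchy_schwarz_ip LB (H2_L2 Hz)))// ler_wpM2l ?nrm_ge0//.
  exact: nrm_le_H2.
rewrite mulr_suml (le_trans (ler_norm_sum _ _ _))// ler_sum// => i _.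
rewrite mulr_suml (le_trans (ler_norm_sum _ _ _))// ler_sum// => j _.
rewrite (le_trans (cauchy_schwarz_ip (LA i j) (L2_hessian i j Hz)))//.
by rewrite ler_wpM2l ?nrm_ge0// nrm_hessian_le_H2.
Qed.

Lemma ip_linr a f z z' : L2 f -> L2 z -> L2 z' ->
  ip f (fun p => a * z p + z' p) = a * ip f z + ip f z'.
Proof. by move=> Lf Lz Lz'; rewrite ipC ipDl ?ipZl ?[ip f _]ipC//; exact: L2Z. Qed.

Lemma pairing_H2dual A B : (forall i j, L2 (A i j)) -> L2 B -> H2dual (pairing A B).
Proof.
move=> LA LB; split; last first.
  exists (nrm B + \sum_(i < 2) \sum_(j < 2) nrm (A i j)) => z Hz; exact: pairing_bound.
move=> a z z' Hz Hz'; rewrite /pairing.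
have -> : ip B (a \*: z \+ z') = a * ip B z + ip B z' by apply: ip_linr => //; exact: H2_L2.
have -> : ipt A (hessian (a \*: z \+ z')) = a * ipt A (hessian z) + ipt A (hessian z').
  rewrite /ipt mulr_sumr -big_split; apply: eq_bigr => i _.
  rewrite mulr_sumr -big_split; apply: eq_bigr => j _ /=.
  have Lh := L2_hessian i j Hz; have Lh' := L2_hessian i j Hz'.
  rewrite -(ip_linr a (LA i j) Lh Lh') [LHS]ipC [RHS]ipC.
  exact: (ae_ip (L2_hessian i j (H2_lin a Hz Hz')) (L2D (L2Z a Lh) Lh') (LA i j)
    (hessian_lin a i j Hz Hz')).
move: (ip B z) (ip B z') (ipt A (hessian z)) (ipt A (hessian z')) => x1 x2 x3 x4; ring.
Qed.

Lemma pairing_divDiv Theta z : (forall i j, smooth (Theta i j)) -> H2 z ->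
  ip (divDiv Theta) z - ipt Theta (hessian z) = pairing Theta (cdivDiv Theta) z.
Proof.
move=> s Hz; congr (_ - _); have sd := is_divDiv_smooth s.
have [L _] := is_divDivP (ex_intro _ _ sd); have [L' _] := sd.
apply: ae_ip => //; first exact: H2_L2.
exact: is_divDiv_unique (is_divDivP (ex_intro _ _ sd)) sd.
Qed.

(* The isotropic tensor v I has div Div (v I) = Delta v. *)
Definition iso v : 'I_2 -> 'I_2 -> R * R -> R := fun i j => if i == j then v else fun=> 0.

(** The weak Laplacian of z is the trace of its Hessian, so (Delta z, v) = (v I, D^2 z); the sign
    comes from the opposite order of the two terms. *)
Lemma tr_Lap_pairing v z : smooth v -> H2 z ->
  tr_Lap v z = - pairing (iso v) (laplace v) z.
Proof.
move=> sv Hz; rewrite /tr_Lap /pairing opprB; congr (_ - _).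
  have wz := is_wlaplace_H2 Hz.
  rewrite (@ae_ip _ (fun p => \sum_(i < 2) hessian z i i p)).
  - rewrite ip_suml; [|by move=> i; exact: L2_hessian|exact: L2_smooth].
    apply: eq_bigr => i _; rewrite (bigD1 i)//= big1 ?addr0; last first.
      move=> j ji; rewrite /iso eq_sym (negbTE ji) ipE.
      by rewrite (@eq_intT _ _ (fun=> 0)) ?intT0// => p _; rewrite mul0r.
    by rewrite /iso eqxx ipC.
  - by have [] := is_wlaplaceP (ex_intro _ _ wz).
  - by have [] := wz.
  - exact: L2_smooth.
  - exact: is_wlaplace_unique (is_wlaplaceP (ex_intro _ _ wz)) wz.
have wv := is_wlaplace_smooth sv.
rewrite ipC; apply: ae_ip.
- by have [] := is_wlaplaceP (ex_intro _ _ wv).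
- by have [] := wv.
- exact: H2_L2.
- exact: is_wlaplace_unique (is_wlaplaceP (ex_intro _ _ wv)) wv.
Qed.

End WeakDerivatives.

(** * Cut-off near the legs and its contributions *)

Section Edges.
Variable R : realType.
Local Notation P := (measurableTypeR R * measurableTypeR R)%type.
Local Notation mu := (@lebesgue_measure R).
Local Notation mu2 := (mu \x mu)%E.
Local Notation T := (@triangle R).
Implicit Types (f g v z phi psi A B : R * R -> R) (p : R * R).

(** The factor 1/16 keeps the square of side [2 * mesh n] at the corner inside the triangle, and
    [1 - mesh n] above 7/8, the threshold beyond which the tensors vanish. *)
Definition mesh (n : nat) : R := n.+1%:R^-1 / 16.
Definition rise n := ramp (mesh n) (2 * mesh n).
(* Vanishes near the two legs of the triangle, and is 1 away from them. *)
Definition legcut n p := rise n p.1 * rise n p.2.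

Lemma mesh_gt0 n : 0 < mesh n.
Proof. by rewrite divr_gt0// invr_gt0. Qed.

Lemma mesh_le n : mesh n <= 16^-1.
Proof.
rewrite /mesh mulrC ler_piMr ?invr_ge0// invf_le1//.
by rewrite ler1n.
Qed.

Lemma near_mesh (x : R) : 0 < x -> \forall n \near \oo, 2 * mesh n <= x.
Proof.
move=> x0; have ch := @cvg_harmonic R.
have /cvgrPdist_lt/(_ x x0) [N _ HN] := ch; exists N => // n /HN /=.
rewrite sub0r normrN /harmonic /= ger0_norm ?invr_ge0// => h.
rewrite /mesh; have : 0 < n.+1%:R^-1 :> R by rewrite invr_gt0.
move: h; move: (n.+1%:R^-1) => y h1 h2; lra.
Qed.

Lemma mesh_lt n : mesh n < 2 * mesh n.
Proof. by have := mesh_gt0 n; move: (mesh n) => y h; lra. Qed.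

Lemma smooth1_rise n : smooth1 (rise n).
Proof. exact: smooth1_ramp. Qed.

Lemma rise01 n x : 0 <= rise n x <= 1.
Proof. exact: ramp01. Qed.

Lemma smooth_legcut n : smooth (legcut n).
Proof. exact: smooth_tensor (smooth1_rise n) (smooth1_rise n). Qed.

Definition other (i : 'I_2) : 'I_2 := if i == 0 then 1 else 0.

Lemma pd_legcut n i : pd i (legcut n) =
  fun p => (rise n)^`() (co i p) * rise n (co (other i) p).
Proof.
rewrite /legcut (pd_tensor i (smooth1_rise n) (smooth1_rise n)); apply/funext => p.
by case: (ord2E i) => ->; rewrite /co /other //= mulrC.
Qed.

Lemma pds_legcut n i : pds [:: other i; i] (legcut n) =
  fun p => (rise n)^`() p.1 * (rise n)^`() p.2.
Proof.
have s1 := smooth1_rise n; have s2 := smooth1_derive1 s1.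
rewrite /= (_ : pd i (legcut n) = fun p => if i == 0 then (rise n)^`() p.1 * rise n p.2
  else rise n p.1 * (rise n)^`() p.2); last exact: pd_tensor.
by case: (ord2E i) => -> /=; rewrite pd_tensor.
Qed.

Lemma rise0 n x : x <= mesh n -> rise n x = 0.
Proof. exact: ramp0 (mesh_lt n). Qed.

Lemma rise_far n x : 2 * mesh n <= x -> rise n x = 1.
Proof. exact: ramp1 (mesh_lt n). Qed.

Lemma derive1_rise0 n x : x <= mesh n -> (rise n)^`() x = 0.
Proof. by move=> h; apply: derive1_ramp0; [exact: mesh_lt|left]. Qed.

Lemma derive1_rise_far n x : 2 * mesh n <= x -> (rise n)^`() x = 0.
Proof. by move=> h; apply: derive1_ramp0; [exact: mesh_lt|right]. Qed.

(** The slope is of order 1/mesh, but it lives only where x is at most twice the mesh. *)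
Lemma derive1_rise_bound : exists2 M, 0 <= M & forall n x, 0 <= x ->
  `|(rise n)^`() x| * x <= M.
Proof.
have [M M0 H] := derive1_ramp_bound R; exists (2 * M); first by rewrite mulr_ge0.
move=> n x x0; have [xl|/ltW xl] := leP x (2 * mesh n); last first.
  by rewrite derive1_rise_far// normr0 mul0r mulr_ge0.
apply: (@le_trans _ _ (M / (2 * mesh n - mesh n) * (2 * mesh n))).
  by rewrite ler_pM// H// mesh_lt.
have m0 := mesh_gt0 n; have -> : 2 * mesh n - mesh n = mesh n by ring.
by rewrite le_eqVlt; apply/orP; left; apply/eqP; field; rewrite lt0r_neq0.
Qed.

Lemma co_gt0 i p : T p -> 0 < co i p.
Proof. by move=> [? ? _]; rewrite /co; case: ifP. Qed.

Lemma legcut_cvg p : T p -> \forall n \near \oo, legcut n p = 1.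
Proof.
move=> [p1 p2 _]; near=> n.
have h1 : 2 * mesh n <= p.1 by near: n; exact: near_mesh.
have h2 : 2 * mesh n <= p.2 by near: n; exact: near_mesh.
by rewrite /legcut (rise_far h1) (rise_far h2) mulr1.
Unshelve. all: by end_near. Qed.

Lemma pd_legcut_cvg i p : T p -> \forall n \near \oo, pd i (legcut n) p = 0.
Proof.
move=> Tp; near=> n; rewrite pd_legcut derive1_rise_far ?mul0r//.
by near: n; apply: near_mesh; exact: co_gt0.
Unshelve. all: by end_near. Qed.

Lemma legcut_norm n p : `|legcut n p| <= 1.
Proof.
rewrite /legcut normrM; have /andP[? ?] := rise01 n p.1; have /andP[? ?] := rise01 n p.2.
by rewrite !ger0_norm// mulr_ile1.
Qed.

Lemma bulk_cvg f B : L2 f -> smooth B ->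
  ip f (fun p => legcut n p * B p) @[n --> \oo] --> ip f B.
Proof.
move=> Lf sB.
have [|p Tp||n p Tp|_ c] := @intT_cvg _ (fun n p => f p * (legcut n p * B p))
  (fun p => f p * B p) (fun p => `|f p * B p|).
- move=> n; apply: measTM; first exact: L2_measT.
  exact: measT_smooth (smoothM (smooth_legcut n) sB).
- by apply: cvg_near_cst; apply: filterS (legcut_cvg Tp) => n ->; rewrite mul1r.
- exact: L1_norm (L2M Lf (L2_smooth sB)).
- by rewrite mulrCA normrM ler_piMl// legcut_norm.
exact: c.
Qed.

(** The linear decay of A at the leg offsets the slope of the cut-off. The integrand is then
    dominated by a multiple of |f| and tends to 0 pointwise. This is how a leg contribution
    disappears without taking a trace of f. *)
Lemma strip_cvg f A i M : L2 f -> smooth A -> (forall p, T p -> `|A p| <= M * co i p) ->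
  ip f (fun p => A p * pd i (legcut n) p) @[n --> \oo] --> 0.
Proof.
move=> Lf sA HA; have [M0 M00 HM0] := derive1_rise_bound.
have [|p Tp||n p Tp|_ c] := @intT_cvg _ (fun n p => f p * (A p * pd i (legcut n) p))
  (fun p => 0) (fun p => (M0 * M) * `|f p|).
- move=> n; apply: measTM; first exact: L2_measT.
  exact: measT_smooth (smoothM sA (smooth_pd i (smooth_legcut n))).
- by apply: cvg_near_cst; apply: filterS (pd_legcut_cvg i Tp) => n ->; rewrite !mulr0.
- exact: L1Z (L1_norm (L2_L1 Lf)).
- rewrite normrM mulrC ler_wpM2r// normrM mulrC pd_legcut normrM.
  have cp := ltW (co_gt0 i Tp).
  have M_ge0 : 0 <= M by have := le_trans (normr_ge0 _) (HA p Tp); rewrite pmulr_lge0// co_gt0.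
  have /andP[r0 r1] := rise01 n (co (other i) p).
  apply: (@le_trans _ _ (`|(rise n)^`() (co i p)| * (M * co i p))).
    by rewrite ler_pM ?mulr_ge0// ?HA// (ger0_norm r0) ler_piMr.
  by rewrite mulrCA mulrC ler_wpM2r// HM0.
by move: c; rewrite intT0.
Qed.

(** Here u is the cut-off or one of its derivatives: u takes care of the legs, f of the
    hypotenuse. *)
Lemma test_legcut n (u f : R * R -> R) : smooth u ->
  (forall p, p.1 <= mesh n \/ p.2 <= mesh n -> u p = 0) -> smooth f ->
  (forall p, 0 < p.1 -> 0 < p.2 -> 7 / 8 <= p.1 + p.2 -> f p = 0) ->
  test (fun p => u p * f p).
Proof.
move=> su u0 sf f0; apply: (test_inner (mesh_gt0 n)); first exact: smoothM.
move=> p [h|[h|h]]; first by rewrite u0 ?mul0r//; left; exact: ltW.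
  by rewrite u0 ?mul0r//; right; exact: ltW.
have [p1|p1] := leP p.1 (mesh n); first by rewrite u0 ?mul0r//; left.
have [p2|p2] := leP p.2 (mesh n); first by rewrite u0 ?mul0r//; right.
have m0 := mesh_gt0 n; have m1 := mesh_le n.
rewrite f0 ?mulr0//; [exact: lt_trans p1|exact: lt_trans p2|].
apply: le_trans (ltW h); move: m0 m1; move: (mesh n) => y; lra.
Qed.

Lemma legcut0 n p : p.1 <= mesh n \/ p.2 <= mesh n -> legcut n p = 0.
Proof. by rewrite /legcut => -[h|h]; rewrite (rise0 h) ?mulr0 ?mul0r. Qed.

Lemma pd_legcut0 n i p : p.1 <= mesh n \/ p.2 <= mesh n -> pd i (legcut n) p = 0.
Proof.
rewrite pd_legcut; case: (ord2E i) => -> /=; rewrite /co /=.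
  by case=> h; rewrite ?(derive1_rise0 h) ?(rise0 h) ?mul0r ?mulr0.
by case=> h; rewrite ?(derive1_rise0 h) ?(rise0 h) ?mul0r ?mulr0.
Qed.

Lemma ipDr f v z : L2 f -> L2 v -> L2 z ->
  ip f (fun p => v p + z p) = ip f v + ip f z.
Proof. by move=> Lf Lv Lz; rewrite [LHS]ipC (ipDl Lv Lz Lf) ipC [ip z f]ipC. Qed.

Lemma ipZr c f v : L2 f -> L2 v -> ip f (fun p => c * v p) = c * ip f v.
Proof. by move=> Lf Lv; rewrite [LHS]ipC (ipZl c Lv Lf) ipC. Qed.

Lemma ipDr4 f a b c d : L2 f -> L2 a -> L2 b -> L2 c -> L2 d ->
  ip f (fun p => (a p + b p) + (c p + d p)) = (ip f a + ip f b) + (ip f c + ip f d).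
Proof.
by move=> Lf La Lb Lc Ld; rewrite (ipDr Lf (L2D La Lb) (L2D Lc Ld)) !ipDr.
Qed.

Section Entry.
Variables (z : R * R -> R) (n : nat) (A : R * R -> R).
Hypotheses (Hz : H2 z) (sA : smooth A)
  (A0 : forall p, 0 < p.1 -> 0 < p.2 -> 7 / 8 <= p.1 + p.2 -> A p = 0).

Let sg := smooth_legcut n.
Let tst : test (fun p => legcut n p * A p).
Proof. exact: (test_legcut sg (@legcut0 n) sA A0). Qed.

Let hess i j : ip (hessian z i j) (fun p => legcut n p * A p) =
  ip z (pds [:: i; j] (fun p => legcut n p * A p)).
Proof.
have [_ H] := H2_wD (w := [:: i; j]) Hz isT.
by rewrite (H _ tst) /= sqrrN expr1n mul1r.
Qed.

(** The Leibniz rule would leave A times the second derivative of the cut-off, which is too singular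
    for an A that vanishes only linearly. So A'c' + A c'', with c the cut-off, is kept as the
    derivative (A c')', and this derivative is put back on z. *)
Lemma diag_entry i : ip (hessian z i i) (fun p => legcut n p * A p) =
  - ip (wD [:: i] z) (fun p => A p * pd i (legcut n) p)
  + ip z (fun p => pd i A p * pd i (legcut n) p)
  + ip z (fun p => legcut n p * pds [:: i; i] A p).
Proof.
have sp := smooth_pd i sg; have sAp := smooth_pd i sA; have sApp := smooth_pd i sAp.
have t' : test (fun p => A p * pd i (legcut n) p).
  have := test_legcut sp (@pd_legcut0 n i) sA A0.
  by congr test; apply/funext => p; rewrite mulrC.
have [_ /(_ _ t') Hw] := H2_wD (w := [:: i]) Hz isT.
rewrite hess.
have -> : pds [:: i; i] (fun p => legcut n p * A p) =
    fun p => (legcut n p * pds [:: i; i] A p + pd i A p * pd i (legcut n) p)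
      + pd i (fun p => A p * pd i (legcut n) p) p.
  rewrite /= (pdM i sg sA) (pdD i (smoothM sg sAp) (smoothM sA sp)).
  by rewrite (pdM i sg sAp).
have L1' := L2_smooth (smoothM sg sApp); have L2' := L2_smooth (smoothM sAp sp).
have L3' := L2_smooth (smooth_pd i (smoothM sA sp)).
rewrite (ipDr (H2_L2 Hz) (L2D L1' L2') L3') (ipDr (H2_L2 Hz) L1' L2').
move: Hw; rewrite /= expr1 mulN1r => ->.
move: (ip (wD _ _) _) (ip z _) (ip z _) => a b c; ring.
Qed.

(** Here the second derivative of the cut-off is a product of two slopes, concentrated at the
    corner; it stays on z and produces the point value. *)
Lemma offdiag_entry i j : ip (hessian z i j) (fun p => legcut n p * A p) =
  ip z (fun p => A p * pds [:: i; j] (legcut n) p)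
  + ip z (fun p => pd i A p * pd j (legcut n) p)
  + ip z (fun p => pd j A p * pd i (legcut n) p)
  + ip z (fun p => legcut n p * pds [:: i; j] A p).
Proof.
have sp k := smooth_pd k sg; have sAp k := smooth_pd k sA.
have sApp := smooth_pd i (sAp j); have spp := smooth_pd i (sp j).
rewrite hess.
have -> : pds [:: i; j] (fun p => legcut n p * A p) =
    fun p => (legcut n p * pds [:: i; j] A p + pd j A p * pd i (legcut n) p)
      + (A p * pds [:: i; j] (legcut n) p + pd i A p * pd j (legcut n) p).
  rewrite /= (pdM j sg sA) (pdD i (smoothM sg (sAp j)) (smoothM sA (sp j))).
  rewrite (pdM i sg (sAp j)) (pdM i sA (sp j)).
  by apply/funext => p; congr (_ + (_ + _)); rewrite mulrC.
have L1' := L2_smooth (smoothM sg sApp); have L2' := L2_smooth (smoothM (sAp j) (sp i)).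
have L3' := L2_smooth (smoothM sA spp); have L4' := L2_smooth (smoothM (sAp i) (sp j)).
have Lz := H2_L2 Hz.
have perm (a b c d : R) : (a + b) + (c + d) = c + d + b + a by ring.
exact: (etrans (ipDr4 Lz L1' L2' L3' L4') (perm _ _ _ _)).
Qed.

End Entry.

End Edges.

(** * The mixed derivative of the cut-off as an approximate Dirac distribution *)

Section CornerLimit.
Variable R : realType.
Local Notation P := (measurableTypeR R * measurableTypeR R)%type.
Local Notation mu := (@lebesgue_measure R).
Local Notation mu2 := (mu \x mu)%E.
Local Notation T := (@triangle R).
Implicit Types (f g v z A B F G : R * R -> R) (p : R * R) (e : R -> R).

Lemma intT_le_ae F G : L1 F -> L1 G -> aeT (fun p => F p <= G p) -> intT F <= intT G.
Proof.
move=> iF iG H; rewrite -subr_ge0 -(intTB iG iF).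
have iB := L1B iG iF.
rewrite (@ae_intT _ _ (fun p => `|G p - F p|)).
- by apply: intT_ge0 => p _; exact: normr_ge0.
- exact: L1_measT.
- exact: L1_measT (L1_norm iB).
- by apply: (aeTS H) => p _ h; rewrite ger0_norm// subr_ge0.
Qed.

Lemma integral_derive1_unit e : smooth1 e -> (forall x, x <= 0 \/ 1 <= x -> e^`() x = 0) ->
  (\int[mu]_x (e^`() x)%:E = (e 1 - e 0)%:E)%E.
Proof.
move=> se H; have se' := smooth1_derive1 se.
rewrite -(ftc_C1 (smooth1_derivable se) (smooth1_cont se') ltr01).
rewrite [RHS]integral_mkcond; apply: eq_integral => t _.
rewrite patchE mem_setE; case: ifPn => //.
rewrite in_itv /= negb_and -!ltNge => /orP ht; rewrite H//.
by case: ht => /ltW; [left|right].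
Qed.

(** The support is a square inside the triangle, so the integral is the product of the two total
    rises, each equal to 1. *)
Lemma intT_derive1_rise n :
  intT (fun p => (rise n)^`() p.1 * (rise n)^`() p.2) = 1 :> R.
Proof.
set F := fun p => _.
have m0 := mesh_gt0 R n; have m1 := mesh_le R n.
have sr := @smooth1_rise R n; have sr' := smooth1_derive1 sr.
have sF : smooth F := smooth_tensor sr' sr'.
have r1 : rise n 1 = 1 :> R by apply: rise_far; move: m0 m1; move: (mesh R n) => y; lra.
have r0 : rise n 0 = 0 :> R by apply: rise0; exact: ltW.
have dr (x : R) : x <= 0 \/ 1 <= x -> (rise n)^`() x = 0.
  case=> h; first by apply: derive1_rise0; exact: le_trans h (ltW m0).
  by apply: derive1_rise_far; apply: le_trans h; move: m0 m1; move: (mesh R n) => y; lra.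
have ptch : (EFin \o F) \_ T = EFin \o F.
  apply/funext => p; rewrite patchE; case: ifPn => // /negP nT /=; congr EFin; apply/esym.
  have [h1|h1] := leP p.1 (mesh R n); first by rewrite /F (derive1_rise0 h1) mul0r.
  have [h2|h2] := leP p.2 (mesh R n); first by rewrite /F (derive1_rise0 h2) mulr0.
  have [h3|h3] := leP (2 * mesh R n) p.1; first by rewrite /F (derive1_rise_far h3) mul0r.
  have [h4|h4] := leP (2 * mesh R n) p.2; first by rewrite /F (derive1_rise_far h4) mulr0.
  exfalso; apply: nT; rewrite inE; move: m0 m1 h1 h2 h3 h4; move: (mesh R n) => y *.
  by split; lra.
have iF : mu2.-integrable setT (EFin \o F).
  rewrite -ptch; apply/(integrable_mkcond _ measurable_triangle).
  exact: L2_L1 (L2_smooth sF).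
rewrite /intT /Rintegral integral_mkcond ptch -(integral21_prod_meas1 iF).
have -> : (\int[mu]_y fubini_G mu (EFin \o F) y = \int[mu]_y ((rise n)^`() y)%:E)%E.
  apply: eq_integral => y _; rewrite /fubini_G.
  have s2 := smooth1M sr (smooth1_cst ((rise n)^`() y)).
  have D : (fun x => rise n x * (rise n)^`() y)^`() = fun x => (rise n)^`() x * (rise n)^`() y.
    apply/funext => x; rewrite (derive1Mx (smooth1_derivable sr x) (smooth1_derivable (smooth1_cst _) x)).
    by rewrite derive1_cst mulr0 add0r; exact: mulrC.
  transitivity (\int[mu]_x ((fun x => rise n x * (rise n)^`() y)^`() x)%:E)%E.
    by rewrite D.
  rewrite integral_derive1_unit//; first by rewrite r0 r1 mul0r mul1r subr0.
  by move=> x hx; rewrite D (dr x hx) mul0r.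
by rewrite (integral_derive1_unit sr dr) r1 r0 subr0.
Qed.

Lemma closure_origin : closure T (0, 0).
Proof.
move=> U /nbhs_ballP[e /= e0 eU].
pose t := Num.min (e / 2) (1 / 4).
have t0 : 0 < t by rewrite lt_min !divr_gt0.
have [t1 t2] : t <= e / 2 /\ t <= 1 / 4 by rewrite !ge_min !lexx orbT.
exists (t, t); split; first by split => /=; lra.
by apply: eU; split; rewrite /ball /= sub0r normrN gtr0_norm//; lra.
Qed.

(** The kernels are nonnegative, of mass 1, and supported in squares shrinking to the origin: an
    approximate identity, applied to the continuous function B g. *)
Lemma corner_cvg z g B : L2 z -> smooth B -> {within closure T, continuous g} ->
  aeT (fun p => g p = z p) ->
  ip z (fun p => B p * ((rise n)^`() p.1 * (rise n)^`() p.2)) @[n --> \oo] -->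
    B (0, 0) * g (0, 0).
Proof.
move=> Lz sB /subspace_continuousP cg gz.
pose F := within (closure T) (nbhs ((0, 0) : R * R)).
have cF : (fun p => B p * g p) @ F --> B (0, 0) * g (0, 0).
  apply: cvgM; last exact: cg closure_origin.
  move=> U U0; have HU := @smooth_cont R B sB (0, 0) U U0.
  by apply: (@filterS _ (nbhs ((0, 0) : R * R)) _ _ _ _ HU) => p hp _.
apply/cvgrPdist_le => eps eps0.
have /cvgrPdist_le/(_ eps eps0) := cF.
rewrite near_withinE => /nbhs_ballP[d /= d0 dH].
near=> n.
have hd : 2 * mesh R n <= d / 2 by near: n; apply: near_mesh; rewrite divr_gt0.
pose k p := (rise n)^`() p.1 * (rise n)^`() p.2.
have sr' := smooth1_derive1 (@smooth1_rise R n).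
have sk : smooth k := smooth_tensor sr' sr'.
have k0 p : 0 <= k p by rewrite mulr_ge0// derive1_ramp_ge0// mesh_lt.
have Lk := L2_L1 (L2_smooth sk).
have I1 : L1 (fun p => z p * (B p * k p)) := L2M Lz (L2_smooth (smoothM sB sk)).
have I2 := L1Z (B (0, 0) * g (0, 0)) Lk.
have I3 := L1B I2 I1.
have K1 : intT k = 1 := intT_derive1_rise n.
have -> : ip z (fun p => B p * k p) = intT (fun p => z p * (B p * k p)) by [].
(* The unit mass turns the limit, and below also eps, into integrals against k, so that the
   integrands can be compared pointwise. *)
rewrite -[B (0, 0) * g (0, 0)]mulr1 -K1 -(intTZ _ Lk) -(intTB I2 I1).
apply: (le_trans (intT_norm I3)).
rewrite -[leRHS]mulr1 -K1 -(intTZ _ Lk); apply: intT_le_ae.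
- exact: L1_norm.
- exact: L1Z.
apply: (aeTS gz) => p Tp gzp.
have -> : B (0, 0) * g (0, 0) * k p - z p * (B p * k p) =
  (B (0, 0) * g (0, 0) - B p * g p) * k p by rewrite gzp; ring.
rewrite normrM (ger0_norm (k0 p)).
have [h3|h3] := leP (2 * mesh R n) p.1.
  by rewrite /k (derive1_rise_far h3) mul0r !mulr0.
have [h4|h4] := leP (2 * mesh R n) p.2.
  by rewrite /k (derive1_rise_far h4) !mulr0.
rewrite ler_wpM2r//; apply: dH; last exact: subset_closure.
have [p1 p2 _] := Tp.
by split; rewrite /ball /= sub0r normrN gtr0_norm//; [move: h3|move: h4]; move: hd;
  move: (mesh R n) => y *; lra.
Unshelve. all: by end_near. Qed.

End CornerLimit.

(** * The corner formula for tensors satisfying the leg conditions *)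

Section EdgeFormula.
Variable R : realType.

Lemma sum_ord2 (F : 'I_2 -> R) : \sum_(i < 2) F i = F 0 + F 1.
Proof. by rewrite big_ord_recl big_ord1; congr (_ + F _); exact: val_inj. Qed.

Lemma sum_ord22 (F : 'I_2 -> 'I_2 -> R) :
  \sum_(i < 2) \sum_(j < 2) F i j = F 0 0 + F 0 1 + (F 1 0 + F 1 1).
Proof. by rewrite !sum_ord2. Qed.

Local Notation T := (@triangle R).
Variables (Theta : 'I_2 -> 'I_2 -> R * R -> R) (M : R).
Hypotheses (sTheta : forall i j, smooth (Theta i j))
  (symTheta : forall i j p, Theta i j p = Theta j i p)
  (suppTheta : forall i j p, 0 < p.1 -> 0 < p.2 -> 7 / 8 <= p.1 + p.2 -> Theta i j p = 0)
  (normal0 : forall i p, T p -> `|Theta i i p| <= M * co i p)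
  (flux0 : forall i p, T p ->
    `|pd i (Theta i i) p + 2 * pd (other i) (Theta 0 1) p| <= M * co i p).

(* Integration by parts on the truncation by legcut; the two legs contribute
   nothing in the limit, except for the value of z at their common end. *)
Lemma edge_formula z g : H2 z -> {within closure T, continuous g} ->
  aeT (fun p => g p = z p) ->
  pairing Theta (cdivDiv Theta) z = - 2 * (Theta 0 1 (0, 0) * g (0, 0)).
Proof.
move=> Hz cg gz; have Lz := H2_L2 Hz.
have T10 : Theta 1 0 = Theta 0 1 by apply/funext => p; exact: symTheta.
pose B := Theta 0 1; have sB : smooth B := sTheta 0 1.
pose X i j n := ip (hessian z i j) (fun p => legcut n p * Theta i j p).
have cX i j : X i j n @[n --> \oo] --> ip (Theta i j) (hessian z i j).
  by rewrite ipC; exact: bulk_cvg (L2_hessian i j Hz) (sTheta i j).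
pose k n p : R := (rise n)^`() p.1 * (rise n)^`() p.2.
(* [Y] and [Z] are the contributions of the legs, controlled by [normal0] and [flux0]; [W] is that
   of the interior, [K] that of the corner. *)
pose Y i n := ip (wD [:: i] z) (fun p => Theta i i p * pd i (legcut n) p).
pose Z i n := ip z (fun p => (pd i (Theta i i) p + 2 * pd (other i) B p) * pd i (legcut n) p).
pose W i j n := ip z (fun p => legcut n p * pds [:: i; j] (Theta i j) p).
pose K n := ip z (fun p => B p * k n p).
have cY i : Y i n @[n --> \oo] --> 0.
  have [Lw _] := H2_wD (w := [:: i]) Hz isT.
  exact: (strip_cvg (M := M) Lw (sTheta i i) (normal0 i)).
have cZ i : Z i n @[n --> \oo] --> 0.
  have sA : smooth (fun p => pd i (Theta i i) p + 2 * pd (other i) B p).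
    exact: smoothD (smooth_pd i (sTheta i i)) (smoothM (smooth_cst 2) (smooth_pd (other i) sB)).
  exact: (strip_cvg (M := M) Lz sA (flux0 i)).
have cW i j : W i j n @[n --> \oo] --> ip z (pds [:: i; j] (Theta i j)).
  exact: bulk_cvg Lz (smooth_pds [:: i; j] (sTheta i j)).
have cK : K n @[n --> \oo] --> B (0, 0) * g (0, 0) by exact: corner_cvg.
have ZE i n : Z i n = ip z (fun p => pd i (Theta i i) p * pd i (legcut n) p)
    + 2 * ip z (fun p => pd (other i) B p * pd i (legcut n) p).
  have sg := smooth_pd i (@smooth_legcut R n).
  have l1 := L2_smooth (smoothM (smooth_pd i (sTheta i i)) sg).
  have l2 := L2_smooth (smoothM (smooth_pd (other i) sB) sg).
  rewrite -(ipZr 2 Lz l2) -(ipDr Lz l1 (L2Z 2 l2)).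
  by apply: eq_intT => p _; congr (_ * _); ring.
(* Each mixed first-order term occurs in both off-diagonal entries. Its double joins the diagonal
   term with the same derivative of the cut-off to form the flux in [Z]; the corner term also occurs
   twice. *)
have sum n : X 0 0 n + X 0 1 n + (X 1 0 n + X 1 1 n) =
    (- Y 0 n - Y 1 n) + (Z 0 n + Z 1 n) + 2 * K n
    + (W 0 0 n + W 0 1 n + (W 1 0 n + W 1 1 n)).
  pose a i := ip z (fun p => pd i (Theta i i) p * pd i (legcut n) p).
  pose b i j := ip z (fun p => pd i B p * pd j (legcut n) p).
  have K' i : ip z (fun p => B p * pds [:: other i; i] (legcut n) p) = K n.
    apply: eq_intT => p _.
    exact: (congr1 (fun f => z p * (B p * f p)) (pds_legcut R n i)).
  have eD i : X i i n = - Y i n + a i + W i i n.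
    exact: (diag_entry n Hz (sTheta i i) (suppTheta i i) i).
  have e01 : X 0 1 n = K n + b 0 1 + b 1 0 + W 0 1 n.
    rewrite -(K' 1); exact: (offdiag_entry n Hz sB (suppTheta 0 1) 0 1).
  have e10 : X 1 0 n = K n + b 1 0 + b 0 1 + W 1 0 n.
    rewrite -(K' 0) /X /W T10; exact: (offdiag_entry n Hz sB (suppTheta 0 1) 1 0).
  have z0 : Z 0 n = a 0 + 2 * b 1 0 by exact: ZE.
  have z1 : Z 1 n = a 1 + 2 * b 0 1 by exact: ZE.
  rewrite (eD 0) (eD 1) e01 e10 z0 z1.
  move: (Y 0 n) (Y 1 n) (K n) (W 0 0 n) (W 0 1 n) (W 1 0 n) (W 1 1 n) => y0 y1 kn w0 w1 w2 w3.
  move: (a 0) (a 1) (b 0 1) (b 1 0) => a0 a1 b0 b1; ring.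
have l1 : X 0 0 n + X 0 1 n + (X 1 0 n + X 1 1 n) @[n --> \oo] --> ipt Theta (hessian z).
  have -> : ipt Theta (hessian z) = ip (Theta 0 0) (hessian z 0 0) + ip (Theta 0 1) (hessian z 0 1)
     + (ip (Theta 1 0) (hessian z 1 0) + ip (Theta 1 1) (hessian z 1 1)).
    exact: (sum_ord22 (fun i j => ip (Theta i j) (hessian z i j))).
  by apply: cvgD; apply: cvgD; exact: cX.
have l2 : X 0 0 n + X 0 1 n + (X 1 0 n + X 1 1 n) @[n --> \oo] -->
   (- 0 - 0) + (0 + 0) + 2 * (B (0, 0) * g (0, 0)) + ip (cdivDiv Theta) z.
  rewrite (_ : (fun n => _) = fun n => (- Y 0 n - Y 1 n) + (Z 0 n + Z 1 n) + 2 * K n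
    + (W 0 0 n + W 0 1 n + (W 1 0 n + W 1 1 n))); last exact/funext.
  apply: cvgD.
    apply: cvgD; last by apply: cvgM; [exact: cvg_cst|exact: cK].
    apply: cvgD; last by apply: cvgD; exact: cZ.
    by apply: cvgB; [apply: cvgN; exact: cY|exact: cY].
  have -> : ip (cdivDiv Theta) z =
    ip z (pds [:: 0; 0] (Theta 0 0)) + ip z (pds [:: 0; 1] (Theta 0 1))
    + (ip z (pds [:: 1; 0] (Theta 1 0)) + ip z (pds [:: 1; 1] (Theta 1 1))).
    have L i j := L2_smooth (smooth_pds [:: i; j] sB).
    have L0 := L2_smooth (smooth_pds [:: 0; 0] (sTheta 0 0)).
    have L1 := L2_smooth (smooth_pds [:: 1; 1] (sTheta 1 1)).
    rewrite T10 -/B [LHS]ipC -(ipDr4 Lz L0 (L 0 1) (L 1 0) L1).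
    apply: eq_intT => p _; congr (_ * _).
    (* [cdivDiv] takes the derivatives in the reversed order; by symmetry of the tensor this only
       swaps the two off-diagonal summands. *)
    have perm (a b c c' d : R) : c' = c -> (a + b) + (c' + d) = (a + c) + (b + d).
      by move=> ->; ring.
    exact: (etrans (sum_ord22 (fun i j => pds [:: j; i] (Theta i j) p))
      (perm _ _ _ _ _ (congr1 (fun f => pds [:: 0; 1] f p) T10))).
  by apply: cvgD; apply: cvgD; exact: cW.
have E := cvg_unique _ l1 l2.
rewrite /pairing E// -/B; move: (B _ * _) (ip _ _) => b c; ring.
Qed.

End EdgeFormula.

(** * Exchange of integrals for a bounded kernel *)

Section Fubini.
Variable R : realType.

(** A finite measure makes W times a bounded kernel integrable on the product. It will be Lebesgue
    measure restricted to the triangle. *)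
Lemma fubini_kernel d (X : measurableType d) (nu : {finite_measure set X -> \bar R})
    (W : X -> R) (K : X * X -> R) (C : R) :
  nu.-integrable setT (EFin \o W) -> measurable_fun setT K -> (forall pq, `|K pq| <= C) ->
  (\int[nu]_p (\int[nu]_q (W q * K (p, q))%:E) =
   \int[nu]_q ((W q)%:E * \int[nu]_p (K (p, q))%:E))%E.
Proof.
move=> iW mK HK.
have mW : measurable_fun setT W by move/measurable_int : iW => /measurable_EFinP.
pose f (pq : X * X) := (W pq.2 * K pq)%:E.
have mf : measurable_fun setT f.
  apply/measurable_EFinP; apply: measurable_funM => //.
  by apply: measurableT_comp => //; exact: measurable_snd.
have C0 (x : X) : 0 <= C := le_trans (normr_ge0 _) (HK (x, x)).
have iWC (p : X) : nu.-integrable setT (fun q => (C * `|W q|)%:E).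
  by have := integrableZl measurableT C (integrable_norm iW).
have If : (nu \x nu)%E.-integrable setT f.
  apply/(integrable12ltyP nu nu mf).
  apply: (@le_lt_trans _ _ (\int[nu]_p ((C * \int[nu]_q `|W q|)%R)%:E)%E).
    apply: ge0_le_integral => //.
    - by move=> p _; apply: integral_ge0.
    - apply: (@measurable_fun_fubini_tonelli_F _ _ _ _ _ nu (abse \o f)).
        by apply: measurableT_comp.
      by move=> x; exact: abse_ge0.
    move=> p _.
    have -> : ((C * \int[nu]_q `|W q|)%R)%:E = (\int[nu]_q (C * `|W q|)%:E)%E.
      rewrite -(RintegralZl _ measurableT (integrable_norm iW)) /Rintegral fineK//.
      exact: (integrable_fin_num measurableT (iWC p)).
    apply: ge0_le_integral => //.
    - apply: (@measurableT_comp _ _ _ _ _ _ (@abse R)) => //; apply/measurable_EFinP.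
      apply: measurable_funM => //.
      exact: (measurable_fun_pair2 p mK).
    - by apply: measurable_int (iWC p).
    - by move=> q _; rewrite lee_fin normrM mulrC ler_wpM2r// HK.
  rewrite integral_cst//= ltey_eq fin_numM//.
  exact: fin_num_measure.
rewrite (Fubini If); apply: eq_integral => q _; rewrite /f /=.
have mKq : measurable_fun setT (fun p => K (p, q)) := measurable_fun_pair1 q mK.
have iK : nu.-integrable setT (EFin \o (fun p => K (p, q))).
  apply: measurable_bounded_integrable => //; first by rewrite ltey_eq fin_num_measure.
  by exists C; split; [rewrite num_real|move=> y Cy x _ /=; rewrite (le_trans (HK _))// ltW].
rewrite -(integralZl measurableT iK).
by [].
Qed.

End Fubini.

(** * Inversion of the mixed derivative by integration over quadrants *)

Section QuadrantPotential.
Variable R : realType.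
Local Notation P := (measurableTypeR R * measurableTypeR R)%type.
Local Notation mu := (@lebesgue_measure R).
Local Notation mu2 := (mu \x mu)%E.
Local Notation T := (@triangle R).
Implicit Types (f g F W : R * R -> R) (p q : R * R) (e : R -> R).

(** A product of two Heaviside functions: the kernel that inverts d_1 d_2 on functions vanishing far
    up and to the right. *)
Definition below p q : R := (p.1 <= q.1)%R%:R * (p.2 <= q.2)%R%:R.

(* Since d_1 d_2 (potential W) = W, the continuous representative of a function
   cut off near the corner is the potential of its mixed derivative. *)
Definition potential W p : R := intT (fun q => W q * below p q).

Lemma below_le1 p q : `|below p q| <= 1.
Proof.
rewrite /below; case: (p.1 <= q.1); case: (p.2 <= q.2);
  by rewrite ?mulr1 ?mulr0 ?mul0r ?normr1 ?normr0.
Qed.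

Lemma measurable_below : measurable_fun setT (fun pq : P * P => below pq.1 pq.2).
Proof.
have c (b : P * P -> bool) : measurable_fun setT b ->
    measurable_fun setT (fun pq => (b pq)%:R : R).
  move=> mb; have := measurable_fun_ifT mb (@measurable_cst _ _ _ _ setT (1 : measurableTypeR R))
    (@measurable_cst _ _ _ _ setT (0 : measurableTypeR R)).
  by congr measurable_fun; apply/funext => pq; case: (b pq).
have m11 : measurable_fun setT (fun pq : P * P => pq.1.1).
  by apply: (measurableT_comp measurable_fst); exact: measurable_fst.
have m12 : measurable_fun setT (fun pq : P * P => pq.1.2).
  by apply: (measurableT_comp measurable_snd); exact: measurable_fst.
have m21 : measurable_fun setT (fun pq : P * P => pq.2.1).
  by apply: (measurableT_comp measurable_fst); exact: measurable_snd.
have m22 : measurable_fun setT (fun pq : P * P => pq.2.2).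
  by apply: (measurableT_comp measurable_snd); exact: measurable_snd.
by apply: measurable_funM; apply: c; exact: measurable_fun_ler.
Qed.

Lemma measurable_below1 p : measurable_fun (setT : set P) (fun q => below p q).
Proof. exact: (measurable_fun_pair2 (p : P) measurable_below). Qed.

Lemma L1_below W p : L1 W -> L1 (fun q => W q * below p q).
Proof.
move=> iW; apply: (L1_Mb (M := 1)) => //.
  exact: measurable_funTS (measurable_below1 p).
by move=> q _; exact: below_le1.
Qed.

Let nuT : {finite_measure set P -> \bar R} := mfrestr measurable_triangle triangle_finite.

Lemma integral_restrT (h : P -> \bar R) : (\int[nuT]_p (h \_ T) p = \int[mu2]_(p in T) h p)%E.
Proof.
rewrite -integral_mkcond; apply: eq_measure_integral => A mA AT.
by rewrite /nuT /= /mfrestr /mrestr setIidl.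
Qed.

Lemma integral_restr_intT F : L1 F -> (\int[nuT]_p ((F \_ T) p)%:E = (intT F)%:E)%E.
Proof.
move=> iF; rewrite /intT /Rintegral fineK; last exact: (integrable_fin_num measurable_triangle).
rewrite -integral_restrT; apply: eq_integral => p _.
by rewrite !patchE; case: ifP.
Qed.

Lemma integrable_restrT F : L1 F -> nuT.-integrable setT (EFin \o (F \_ T)).
Proof.
move=> iF; apply/integrableP; split.
  by apply/measurable_EFinP/(measurable_restrictT _ measurable_triangle); exact: L1_measT.
have := integral_restr_intT (L1_norm iF).
rewrite (_ : (\int[nuT]_p _)%E = (\int[nuT]_x `|(EFin \o (F \_ T)) x|)%E); first by move=> ->; rewrite ltry.
apply: eq_integral => p _; rewrite /= !patchE.
by case: ifP => //=; rewrite normr0.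
Qed.

(** Fubini: the transpose of [potential] integrates over the opposite quadrant, below and to the
    left of q, which is what [J] records. *)
Lemma intT_potential W f J C : L1 W -> measT f -> (forall p, T p -> `|f p| <= C) ->
  measT (potential W) -> (forall q, T q -> intT (fun p => f p * below p q) = J q) ->
  L1 (fun q => W q * J q) ->
  intT (fun p => f p * potential W p) = intT (fun q => W q * J q).
Proof.
move=> iW mf Hf mpot HJ iJ.
have potb p : `|potential W p| <= intT (fun q => `|W q|).
  rewrite (le_trans (intT_norm (L1_below p iW)))// intT_le//.
  - exact: L1_norm (L1_below p iW).
  - exact: L1_norm.
  - by move=> q _; rewrite normrM ler_piMr// below_le1.
have i1 : L1 (fun p => f p * potential W p).
  by apply: (L1_Mb (M := intT (fun q => `|W q|))) => //; exact: L1_bounded mf Hf.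
have fb q : L1 (fun p => f p * below p q).
  apply: (L1_Mb (M := 1)); first exact: L1_bounded mf Hf.
    exact: measurable_funTS (measurable_fun_pair1 (q : P) measurable_below).
  by move=> p _; exact: below_le1.
pose K (pq : P * P) := (f \_ T) pq.1 * below pq.1 pq.2.
have mfT : measurable_fun setT (f \_ T : P -> R).
  exact/(measurable_restrictT _ measurable_triangle).
have mK : measurable_fun setT K.
  apply: measurable_funM; last exact: measurable_below.
  by apply: measurableT_comp mfT _; exact: measurable_fst.
have HK pq : `|K pq| <= `|C|.
  rewrite normrM -[leRHS]mulr1 ler_pM// ?below_le1// patchE; case: ifPn => [/set_mem Tp|_].
    by rewrite (le_trans (Hf _ Tp))// ler_norm.
  by rewrite normr0.
have := fubini_kernel (integrable_restrT iW) mK HK.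
have -> : (\int[nuT]_p \int[nuT]_q ((W \_ T) q * K (p, q))%:E =
    (intT (fun p => f p * potential W p))%:E)%E.
  rewrite -(integral_restr_intT i1); apply: eq_integral => p _.
  rewrite patchE; case: ifPn => [Tp|nTp].
    rewrite -[f p * _](intTZ _ (L1_below p iW)) -(integral_restr_intT (L1Z _ (L1_below p iW))).
    apply: eq_integral => q _; rewrite /K /= !patchE Tp; case: ifP => _; last by rewrite mul0r.
    by congr EFin; ring.
  apply: integral0_eq => q _; rewrite /K /= (patchE _ _ p) ifF ?mul0r ?mulr0//.
  exact: negbTE.
move=> E; apply: EFin_inj; rewrite E.
rewrite -(integral_restr_intT iJ); apply: eq_integral => q _.
rewrite !(patchE _ T); case: ifPn => [/set_mem Tq|nTq]; last by rewrite mul0e.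
rewrite EFinM -(HJ q Tq) -(integral_restr_intT (fb q)); congr (_ * _)%E.
apply: eq_integral => p _; rewrite /K /= !patchE; case: ifP => // _; by rewrite mul0r.
Qed.

Lemma prim_indicator e a c : continuous e -> (forall x, x <= a -> e x = 0) ->
  mu.-integrable setT (EFin \o (fun x => e x * (x <= c)%R%:R)) /\
  (\int[mu]_x (e x * (x <= c)%R%:R)%:E = (prim e c)%:E)%E.
Proof.
move=> ce e0; have I := prim_integrable c ce e0.
have ptch : (EFin \o e) \_ `]-oo, c]%classic = EFin \o (fun x => e x * (x <= c)%R%:R).
  apply/funext => x; rewrite patchE mem_setE in_itv /=.
  by case: (x <= c); rewrite /= ?mulr1 ?mulr0.
split.
  by move: (I) => /integrable_mkcond => /(_ (measurable_itv _)); rewrite ptch.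
rewrite /prim /Rintegral fineK; last by apply: integrable_fin_num; [exact: measurable_itv|exact: I].
rewrite integral_mkcond; apply: eq_integral => x _; exact: (esym (congr1 (fun h => h x) ptch)).
Qed.

(** For q in the triangle, the open rectangle spanned by the origin and q is contained in the
    triangle, so the integral factorises. *)
Lemma intT_tensor_below e1 e2 q : smooth1 e1 -> smooth1 e2 ->
  (forall x, x <= 0 -> e1 x = 0) -> (forall x, x <= 0 -> e2 x = 0) -> T q ->
  intT (fun p => e1 p.1 * e2 p.2 * below p q) = prim e1 q.1 * prim e2 q.2.
Proof.
move=> s1 s2 z1 z2 Tq.
have [I1 E1] := prim_indicator q.1 (smooth1_cont s1) z1.
have [I2 E2] := prim_indicator q.2 (smooth1_cont s2) z2.
pose F p := (e1 p.1 * (p.1 <= q.1)%R%:R) * (e2 p.2 * (p.2 <= q.2)%R%:R).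
have FE p : e1 p.1 * e2 p.2 * below p q = F p by rewrite /F /below; ring.
have iF0 : L1 (fun p => e1 p.1 * e2 p.2 * below p q).
  apply: (L1_Mb (M := 1)); first exact: L2_L1 (L2_smooth (smooth_tensor s1 s2)).
    exact: measurable_funTS (measurable_fun_pair1 (q : P) measurable_below).
  by move=> p _; exact: below_le1.
have iFT : L1 F by apply: eq_L1 iF0 => p _.
have ptch : (EFin \o F) \_ T = EFin \o F.
  apply/funext => p; rewrite patchE; case: ifPn => // /negP nT /=; congr EFin; apply/esym.
  have [h1|h1] := leP p.1 0; first by rewrite /F (z1 _ h1) !mul0r.
  have [h2|h2] := leP p.2 0; first by rewrite /F (z2 _ h2) mul0r mulr0.
  rewrite /F; case: (leP p.1 q.1) => h3; last by rewrite mulr0 mul0r.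
  case: (leP p.2 q.2) => h4; last by rewrite !mulr0.
  by exfalso; apply: nT; rewrite inE; have [_ _ h5] := Tq; split=> //; lra.
have iF : mu2.-integrable setT (EFin \o F).
  by rewrite -ptch; apply/(integrable_mkcond _ measurable_triangle).
rewrite (eq_intT (fun p _ => FE p)).
rewrite /intT /Rintegral integral_mkcond ptch -(integral21_prod_meas1 iF).
have -> : (\int[mu]_y fubini_G mu (EFin \o F) y =
    \int[mu]_y ((prim e1 q.1)%:E * (e2 y * (y <= q.2)%R%:R)%:E))%E.
  apply: eq_integral => y _; rewrite /fubini_G /F /= -E1.
  by rewrite -(integralZr measurableT I1).
by rewrite (integralZl measurableT I2) E2 -EFinM.
Qed.

(** Within the unit square, the quadrants at p and p' differ only in two strips of widths |p_1 -
    p'_1| and |p_2 - p'_2|; absolute continuity of the integral does the rest. *)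
Lemma potential_cont W : L1 W -> continuous (potential W).
Proof.
move=> iW p; apply/cvgrPdist_lt => eps eps0.
have I : mu2.-integrable setT (EFin \o (W \_ T)).
  have /(integrable_mkcond _ measurable_triangle) := iW.
  by congr (_.-integrable); apply/funext => q; rewrite /= !patchE; case: ifP.
have [d [d0 Hd]] := integral_normr_continuous I eps0.
have d2 : 0 < d / 2 by rewrite divr_gt0.
have nb := @nbhsx_ballx R (R * R)%type p (d / 2) d2.
apply: (@filterS _ (nbhs p) _ _ _ _ nb) => p' [b1 b2].
have strip (a b : R) : (mu `[Num.min a b, Num.max a b]%classic <= `|a - b|%:E)%E.
  rewrite lebesgue_measure_itv /=; case: ifPn => _; last by rewrite lee_fin.
  rewrite -EFinB lee_fin; case: (leP a b) => h; last by rewrite ler_norm.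
  by rewrite distrC ler_norm.
have unit1 : mu `[(0 : R), 1]%classic = 1%E by rewrite lebesgue_measure_itv /= lte01 -EFinB subr0.
pose A1 : set P := `[Num.min p.1 p'.1, Num.max p.1 p'.1]%classic `*` `[(0 : R), 1]%classic.
pose A2 : set P := `[(0 : R), 1]%classic `*` `[Num.min p.2 p'.2, Num.max p.2 p'.2]%classic.
have mA1 : measurable A1 by apply: measurableX; exact: measurable_itv.
have mA2 : measurable A2 by apply: measurableX; exact: measurable_itv.
have mA : measurable (A1 `|` A2) by exact: measurableU.
have A_small : (mu2 (A1 `|` A2) < d%:E)%E.
  apply: (le_lt_trans (measureU2 _ mA1 mA2)).
  have mI (a b : R) : measurable (`[a, b]%classic : set (measurableTypeR R)) := measurable_itv _.
  have e1 : (mu2 A1 <= `|p.1 - p'.1|%:E)%E.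
    have -> := product_measure1E mu mu (mI (Num.min p.1 p'.1) (Num.max p.1 p'.1)) (mI 0 1).
    have := strip p.1 p'.1; rewrite -[X in (X <= _)%E -> _]mule1 -unit1; exact.
  have e2 : (mu2 A2 <= `|p.2 - p'.2|%:E)%E.
    have -> := product_measure1E mu mu (mI 0 1) (mI (Num.min p.2 p'.2) (Num.max p.2 p'.2)).
    have := strip p.2 p'.2; rewrite -[X in (X <= _)%E -> _]mul1e -unit1; exact.
  apply: (le_lt_trans (leeD e1 e2)).
  by rewrite -EFinD lte_fin; have := ltrD b1 b2; rewrite /= -splitr.
have IA := Hd _ mA A_small.
rewrite /potential -(intTB (L1_below p iW) (L1_below p' iW)).
have iB := L1B (L1_below p iW) (L1_below p' iW).
apply: (le_lt_trans (intT_norm iB)); apply: le_lt_trans IA.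
have -> : \int[mu2]_(x in A1 `|` A2) `|(W \_ T) x| = intT (fun q => `|W q| * \1_(A1 `|` A2) q).
  rewrite /intT Rintegral_mkcond [RHS]Rintegral_mkcond; apply: eq_Rintegral => q _.
  rewrite !patchE indicE; case: ifP => _; case: ifP => _;
    by rewrite ?mulr1 ?mulr0 ?normr0.
apply: intT_le.
- exact: L1_norm.
- apply: (L1_Mb (M := 1)); first exact: L1_norm.
    exact: measT_indic.
  by move=> q _; exact: indic_le1.
move=> q Tq; rewrite -mulrBr normrM ler_wpM2l// indicE.
have [q1 q2 q3 q4] := triangle_box Tq.
case: (boolP (q \in _)) => [_|/negP nA].
  by rewrite /below; case: (p.1 <= q.1); case: (p.2 <= q.2); case: (p'.1 <= q.1);
    case: (p'.2 <= q.2); rewrite /= ?mulr1 ?mulr0 ?mul0r ?subrr ?subr0 ?sub0r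
    ?normrN ?normr1 ?normr0 ?ler01.
have nA1 : ~ (Num.min p.1 p'.1 <= q.1 <= Num.max p.1 p'.1).
  by move=> h; apply: nA; rewrite inE; left; split; rewrite /= in_itv //= !ltW.
have nA2 : ~ (Num.min p.2 p'.2 <= q.2 <= Num.max p.2 p'.2).
  by move=> h; apply: nA; rewrite inE; right; split; rewrite /= in_itv //= !ltW.
have eqs (a b x : R) : ~ (Num.min a b <= x <= Num.max a b) -> (a <= x) = (b <= x).
  rewrite ge_min le_max; case: (leP a x); case: (leP b x) => //= h1 h2 h; exfalso; apply: h.
    by rewrite (ltW h1) orbT.
  by rewrite (ltW h2).
by rewrite /below (eqs _ _ _ nA1) (eqs _ _ _ nA2) subrr normr0.
Qed.

End QuadrantPotential.

(** * Representation of a function of H^2(T) near the corner at the origin *)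

Section Corner.
Variable R : realType.
Local Notation T := (@triangle R).
Implicit Types (f g F W z phi : R * R -> R) (p q : R * R) (e : R -> R).

Definition descent a b (x : R) : R := 1 - ramp a b x.

Lemma smooth1_descent a b : smooth1 (descent a b).
Proof. exact: smooth1B (smooth1_cst 1) (smooth1_ramp a b). Qed.

Lemma descent1 a b x : a < b -> x <= a -> descent a b x = 1.
Proof. by move=> ab xa; rewrite /descent (ramp0 ab xa) subr0. Qed.

Lemma descent0 a b x : a < b -> b <= x -> descent a b x = 0.
Proof. by move=> ab bx; rewrite /descent (ramp1 ab bx) subrr. Qed.

Lemma descent01 a b x : 0 <= descent a b x <= 1.
Proof.
by have /andP[h1 h2] := ramp01 a b x; rewrite /descent subr_ge0 h2 gerBl.
Qed.

Lemma derive1_descent0 a b x : a < b -> x <= a \/ b <= x -> (descent a b)^`() x = 0.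
Proof.
move=> ab H; have sr := smooth1_ramp a b.
have -> : descent a b = fun x => 1 + - ramp a b x by [].
rewrite (derive1Dx (smooth1_derivable (smooth1_cst 1) x) (smooth1_derivable (smooth1N sr) x)).
rewrite derive1_cst add0r.
have -> : (fun x => - ramp a b x) = (fun x => -1 * ramp a b x).
  by apply/funext => y; rewrite mulN1r.
rewrite (derive1Mx (smooth1_derivable (smooth1_cst _) x) (smooth1_derivable sr x)).
by rewrite derive1_cst (derive1_ramp0 ab H) mulr0 mulr0 addr0.
Qed.

Lemma near_derive1 (e e' : R -> R) x : (\near x, e x = e' x) -> e^`() x = e'^`() x.
Proof. by move=> H; rewrite !derive1E; exact: near_eq_derive. Qed.

Lemma derive2_descent0 a b x : a < b -> b < x -> (descent a b)^`()^`() x = 0.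
Proof.
move=> ab bx; rewrite (@near_derive1 _ (fun=> 0)) ?derive1_cst//.
near=> y; apply: derive1_descent0 => //; right; apply: ltW.
by near: y; exact: lt_nbhsr.
Unshelve. all: by end_near. Qed.

(** Premise and conclusion hold on the same open set, so the lemma can be iterated to reach higher
    derivatives. *)
Lemma pd_open_eq i f g (U : set (R * R)) : open U -> (forall q, U q -> f q = g q) ->
  forall q, U q -> pd i f q = pd i g q.
Proof.
move=> oU H q Uq; apply: near_pd.
by apply: (@filterS _ (nbhs q) _ _ _ H); exact: open_nbhs_nbhs.
Qed.

(** The value 3/4 makes three turned copies cover the closed triangle ([cut_sum_gt0]); 7/8 leaves
    room for the second cut-off in [corner_rep]. *)
Let c : R -> R := descent (3 / 4) (7 / 8).
Let sc : smooth1 c. Proof. exact: smooth1_descent. Qed.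
Let clt : (3 / 4 : R) < 7 / 8. Proof. by lra. Qed.

Definition corner_cut p := c (p.1 + p.2).
Let C1 p := c^`() (p.1 + p.2).
Let C2 p := c^`()^`() (p.1 + p.2).
Let sC0 : smooth corner_cut. Proof. exact: smooth_add sc. Qed.
Let sC1 : smooth C1. Proof. exact: smooth_add (smooth1_derive1 sc). Qed.
Let sC2 : smooth C2. Proof. exact: smooth_add (smooth1_derive1 (smooth1_derive1 sc)). Qed.
Let pdC0 i : pd i corner_cut = C1. Proof. exact: pd_add sc. Qed.
Let pdC1 i : pd i C1 = C2. Proof. exact: pd_add (smooth1_derive1 sc). Qed.

Section FixedFunction.
Variable z : R * R -> R.
Hypothesis Hz : H2 z.

(* The weak derivative d_1 d_2 (corner_cut * z). *)
Definition corner_mixed p := z p * C2 p + (wD [:: 0] z p * C1 p + wD [:: 1] z p * C1 p)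
  + hessian z 0 1 p * corner_cut p.

Let Lz := H2_L2 Hz.
Let L0 : L2 (wD [:: 0] z). Proof. by have [] := H2_wD (w := [:: 0]) Hz isT. Qed.
Let L1' : L2 (wD [:: 1] z). Proof. by have [] := H2_wD (w := [:: 1]) Hz isT. Qed.
Let Lh := L2_hessian 0 1 Hz.

Lemma L2_corner_mixed : L2 corner_mixed.
Proof.
exact: L2D (L2D (L2M_smooth Lz sC2) (L2D (L2M_smooth L0 sC1) (L2M_smooth L1' sC1)))
  (L2M_smooth Lh sC0).
Qed.

Lemma ip_corner_mixed phi : test phi ->
  ip z (fun p => corner_cut p * pds [:: 0; 1] phi p) = ip corner_mixed phi.
Proof.
move=> tphi; have sphi := test_smooth tphi.
have t0 := test_mull sC0 tphi; have t1 := test_mull sC1 tphi.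
have s1 := smooth_pd 1 sphi.
have E2 : pds [:: 0; 1] (fun p => corner_cut p * phi p) = fun p =>
    corner_cut p * pds [:: 0; 1] phi p + pd 1 phi p * C1 p + (phi p * C2 p + C1 p * pd 0 phi p).
  rewrite /= (pdM 1 sC0 sphi) (pdD 0 (smoothM sC0 s1) (smoothM sphi (smooth_pd 1 sC0))).
  by rewrite (pdM 0 sC0 s1) (pdM 0 sphi (smooth_pd 1 sC0)) !pdC0 pdC1.
have E1 i : pds [:: i] (fun p => C1 p * phi p) = fun p => C1 p * pd i phi p + phi p * C2 p.
  by rewrite /= (pdM i sC1 sphi) pdC1.
have [_ /(_ _ t0) H2'] := H2_wD (w := [:: 0; 1]) Hz isT.
have [_ /(_ _ t1) H0'] := H2_wD (w := [:: 0]) Hz isT.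
have [_ /(_ _ t1) H1'] := H2_wD (w := [:: 1]) Hz isT.
have sgn2 (x : R) : (-1) ^+ 2 * x = x by rewrite sqrrN expr1n mul1r.
have sgn1 (x : R) : (-1) ^+ 1 * x = - x by rewrite expr1 mulN1r.
have h2 := etrans (congr1 (ip z) (esym E2)) (etrans H2' (sgn2 _)).
have h0 := etrans (congr1 (ip z) (esym (E1 0))) (etrans H0' (sgn1 _)).
have h1 := etrans (congr1 (ip z) (esym (E1 1))) (etrans H1' (sgn1 _)).
have La := L2_smooth (smoothD (smoothD (smoothM sC0 (smooth_pd 0 s1)) (smoothM s1 sC1))
   (smoothD (smoothM sphi sC2) (smoothM sC1 (smooth_pd 0 sphi)))).
have Lb i := L2_smooth (smoothD (smoothM sC1 (smooth_pd i sphi)) (smoothM sphi sC2)).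
have Lphi := L2_smooth sphi; have Lphi2 := L2_smooth (smoothM sC2 sphi).
(* With c the cut-off, c d_1 d_2 phi = d_1 d_2 (c phi) - d_2 (c' phi) - d_1 (c' phi) + c'' phi,
   where every derivative falls on a test function and can be moved to z. *)
have key : ip z (fun p => corner_cut p * pds [:: 0; 1] phi p) =
   ip z (fun p => corner_cut p * pd 0 (pd 1 phi) p + pd 1 phi p * C1 p
      + (phi p * C2 p + C1 p * pd 0 phi p))
   - ip z (fun p => C1 p * pd 1 phi p + phi p * C2 p)
   - ip z (fun p => C1 p * pd 0 phi p + phi p * C2 p) + ip z (fun p => C2 p * phi p).
  rewrite -(intTB (L2M Lz La) (L2M Lz (Lb 1))).
  rewrite -(intTB (L1B (L2M Lz La) (L2M Lz (Lb 1))) (L2M Lz (Lb 0))).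
  rewrite -(intTD (L1B (L1B (L2M Lz La) (L2M Lz (Lb 1))) (L2M Lz (Lb 0))) (L2M Lz Lphi2)).
  apply: eq_intT => p _; rewrite [pds _ _ _]/=.
  move: (pd 0 (pd 1 phi) p) (pd 1 phi p) (pd 0 phi p) (phi p) (C1 p) (C2 p) (corner_cut p) (z p).
  by move=> *; ring.
have W1 := ipDl (L2D (L2M_smooth Lz sC2) (L2D (L2M_smooth L0 sC1) (L2M_smooth L1' sC1)))
  (L2M_smooth Lh sC0) Lphi.
have W2 := ipDl (L2M_smooth Lz sC2) (L2D (L2M_smooth L0 sC1) (L2M_smooth L1' sC1)) Lphi.
have W3 := ipDl (L2M_smooth L0 sC1) (L2M_smooth L1' sC1) Lphi.
have as_ f C : ip (fun p => f p * C p) phi = ip f (fun p => C p * phi p).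
  by apply: eq_intT => p _; exact: esym (mulrA _ _ _).
have W : ip corner_mixed phi = ip z (fun p => C2 p * phi p)
    + (ip (wD [:: 0] z) (fun p => C1 p * phi p) + ip (wD [:: 1] z) (fun p => C1 p * phi p))
    + ip (hessian z 0 1) (fun p => corner_cut p * phi p).
  have add2 (a b a' b' : R) : a = a' -> b = b' -> a + b = a' + b' by move=> -> ->.
  exact: (etrans W1 (add2 _ _ _ _ (etrans W2 (add2 _ _ _ _ (as_ z C2)
    (etrans W3 (add2 _ _ _ _ (as_ _ C1) (as_ _ C1))))) (as_ _ corner_cut))).
have alg (a b k d H w0 w1 : R) : a = H -> b = - w1 -> k = - w0 ->
  a - b - k + d = d + (w0 + w1) + H by move=> -> -> ->; ring.
exact: (etrans key (etrans (alg _ _ _ _ _ _ _ h2 h1 h0) (esym W))).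
Qed.

Lemma corner_mixed0 p : 7 / 8 < p.1 + p.2 -> corner_mixed p = 0.
Proof.
move=> h; have k0 : corner_cut p = 0 := descent0 clt (ltW h).
have k1 : C1 p = 0 := derive1_descent0 clt (or_intror (ltW h)).
have k2 : C2 p = 0 := derive2_descent0 clt h.
have alg (a b k d x y w : R) : x = 0 -> y = 0 -> w = 0 -> a * y + (b * x + k * x) + d * w = 0.
  by move=> -> -> ->; ring.
exact: alg.
Qed.

(** Both sides are tested against products e1 e2. The product of their primitives has the mixed
    derivative e1 e2, so that the left side becomes an integral of [corner_mixed]; [intT_potential]
    does the same for the right side. *)
Lemma corner_rep : aeT (fun p => corner_cut p * z p = potential corner_mixed p).
Proof.
have iW := L2_L1 L2_corner_mixed; have cP := potential_cont iW.
have LP := L2_cont cP; have LcZ := L2M_smooth Lz sC0.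
have LF := L2B LcZ LP.
suff H : aeT (fun p => z p * corner_cut p - potential corner_mixed p = 0).
  by apply: (aeTS H) => p _ /eqP; rewrite subr_eq0 mulrC => /eqP.
apply: (tensor_null_ae (L2_L1 LF)) => e1 e2 h h0 s1 s2 z1 z2.
have z10 x : x <= 0 -> e1 x = 0 by move=> x0; apply: z1; exact: le_trans x0 (ltW h0).
have z20 x : x <= 0 -> e2 x = 0 by move=> x0; apply: z2; exact: le_trans x0 (ltW h0).
pose E1 := prim e1; pose E2 := prim e2.
have sE1 : smooth1 E1 := smooth1_prim s1 z1; have sE2 : smooth1 E2 := smooth1_prim s2 z2.
have dE1 : E1^`() = e1 := derive1_prim (smooth1_cont s1) z1.
have dE2 : E2^`() = e2 := derive1_prim (smooth1_cont s2) z2.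
(* The primitives do not vanish at the hypotenuse. This cut-off is 1 up to 29/32, hence wherever the
   first cut-off, which ends at 7/8, is nonzero; and it is 0 from 15/16 on. *)
pose b : R -> R := descent (29 / 32) (15 / 16).
have blt : (29 / 32 : R) < 15 / 16 by lra.
have sb : smooth1 b := smooth1_descent _ _.
pose phi p := b (p.1 + p.2) * (E1 p.1 * E2 p.2).
have stens := smooth_tensor sE1 sE2.
have sphi : smooth phi := smoothM (smooth_add sb) stens.
have tphi : test phi.
  apply: (@test_inner _ _ (Num.min h (1 / 16))) => //; first by rewrite lt_min h0 /=; lra.
  have [m1 m2] : Num.min h (1 / 16) <= h /\ Num.min h (1 / 16) <= 1 / 16.
    by rewrite !ge_min !lexx orbT.
  move=> p [k|[k|k]]; rewrite /phi.
  - by rewrite /E1 (prim_eq0 z1 (le_trans (ltW k) m1)) mul0r mulr0.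
  - by rewrite /E2 (prim_eq0 z2 (le_trans (ltW k) m1)) !mulr0.
  - by rewrite /b (descent0 blt) ?mul0r//; lra.
have open_s a : open [set p : R * R | p.1 + p.2 < a].
  have cadd : continuous (fun p : R * R => p.1 + p.2).
    exact: smooth_cont (smoothD (smooth_co 0) (smooth_co 1)).
  apply: (@open_comp _ _ (fun p : R * R => p.1 + p.2) [set x : R | x < a]) => [p _|].
    exact: cadd.
  exact: open_lt.
have phiE p : p.1 + p.2 < 29 / 32 -> pds [:: 0; 1] phi p = e1 p.1 * e2 p.2.
  move=> hp; have oU := open_s (29 / 32).
  have e0 q : q.1 + q.2 < 29 / 32 -> phi q = E1 q.1 * E2 q.2.
    by move=> hq; rewrite /phi /b (descent1 blt (ltW hq)) mul1r.
  rewrite /= (pd_open_eq 0 oU (pd_open_eq 1 oU e0) hp).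
  rewrite (pd_tensor 1 sE1 sE2) /= dE2.
  by rewrite (pd_tensor 0 sE1 s2) /= dE1.
have st := smooth_tensor s1 s2.
have A1 : intT (fun p => z p * corner_cut p * (e1 p.1 * e2 p.2)) = ip corner_mixed phi.
  rewrite -(ip_corner_mixed tphi) ipE; apply: eq_intT => p _.
  rewrite -mulrA; congr (_ * _).
  have [hp|hp] := leP (29 / 32) (p.1 + p.2); last by rewrite (phiE _ hp).
  by rewrite /corner_cut /c (descent0 clt) ?mul0r//; lra.
have A2 : ip corner_mixed phi = intT (fun p => corner_mixed p * (E1 p.1 * E2 p.2)).
  apply: eq_intT => p _; have [hp|hp] := leP (p.1 + p.2) (7 / 8).
    by rewrite /phi /b (descent1 blt) ?mul1r//; lra.
  by rewrite (corner_mixed0 hp) !mul0r.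
have [M HM] := continuous_bounded_triangle (smooth_cont st).
have iWE := L1M_smooth iW stens.
have A3 := intT_potential iW (measT_smooth st) HM (measT_cont cP)
  (fun q Tq => intT_tensor_below s1 s2 z10 z20 Tq) iWE.
have I1 := L1M_smooth (L2_L1 LcZ) st; have I2 := L1M_smooth (L2_L1 LP) st.
rewrite (@eq_intT _ _ (fun p => z p * corner_cut p * (e1 p.1 * e2 p.2)
   - potential corner_mixed p * (e1 p.1 * e2 p.2))); last by move=> p _; rewrite mulrBl.
rewrite (intTB I1 I2) A1 A2 -A3.
apply/eqP; rewrite subr_eq0; apply/eqP; apply: eq_intT => p _; exact: mulrC.
Qed.

End FixedFunction.

End Corner.

(** * Change of variables under a measure-preserving map *)

Section MeasurePreserving.
Variables (d : measure_display) (X : measurableType d) (R : realType).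
Variables (m : {measure set X -> \bar R}) (f : X -> X).
Hypotheses (mf : measurable_fun setT f)
  (Hm : forall A, measurable A -> m (f @^-1` A) = m A).

Lemma integral_preserving (G : X -> \bar R) : m.-integrable setT G ->
  m.-integrable setT (G \o f) /\ (\int[m]_x (G \o f) x = \int[m]_x G x)%E.
Proof.
move=> iG; have mG : measurable_fun setT G := measurable_int _ iG.
pose nu : {measure set X -> \bar R} :=
  measure_function_pushforward__canonical__measure_function_Measure m mf.
have nuE (g : X -> \bar R) : (\int[nu]_p g p = \int[m]_p g p)%E.
  by apply: eq_measure_integral => A mA _; exact: Hm.
have iGf : m.-integrable setT (G \o f).
  apply/integrableP; split; first exact: measurableT_comp mG mf.
  have /integrableP[_] := iG; rewrite -(nuE (fun p => `|G p|%E)).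
  rewrite (ge0_integral_pushforward mf)//.
  exact: measurableT_comp.
split=> //; rewrite -(nuE G).
exact: esym (integral_pushforward mf mG iGf measurableT).
Qed.

End MeasurePreserving.

(** * The affine symmetry of the triangle and its action on derivatives *)

Section Rotation.
Variable R : realType.
Local Notation P := (measurableTypeR R * measurableTypeR R)%type.
Local Notation mu := (@lebesgue_measure R).
Local Notation mu2 := (mu \x mu)%E.
Local Notation T := (@triangle R).
Implicit Types (f g F W z phi : R * R -> R) (p q : R * R) (e : R -> R).

(* The affine map of order 3 that permutes the vertices of the triangle. *)
Definition turn p : R * R := (p.2, 1 - p.1 - p.2).

Lemma turn3 p : turn (turn (turn p)) = p.
Proof. by case: p => x y; rewrite /turn /=; congr pair; ring. Qed.

Lemma turnT p : T (turn p) <-> T p.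
Proof. by case: p => x y; rewrite /turn /triangle /=; split=> -[? ? ?]; split; lra. Qed.

Lemma measurable_reflect (a : R) : measurable_fun setT (fun x : measurableTypeR R => a - x : measurableTypeR R).
Proof. by apply: measurable_funB; [exact: measurable_cst|exact: measurable_id]. Qed.

(** By uniqueness of Lebesgue measure it suffices to look at half-open intervals; a reflected one is
    closed at the other end, but has the same length. *)
Lemma lebesgue_reflect (a : R) (Y : set (measurableTypeR R)) : measurable Y ->
  mu ((fun x => a - x) @^-1` Y) = mu Y.
Proof.
move=> mY.
pose nu : {measure set (measurableTypeR R) -> \bar R} :=
  measure_function_pushforward__canonical__measure_function_Measure mu (measurable_reflect a).
rewrite (@lebesgue_measure_unique R nu _ Y mY)// => X [[u v] /= _ <-].
rewrite /nu /= /pushforward.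
have -> : (fun x => a - x) @^-1` `]u, v]%classic = `[a - v, a - u[%classic.
  by apply/seteqP; split=> x /=; rewrite !in_itv /= => /andP[h1 h2]; apply/andP; split; lra.
rewrite !lebesgue_measure_itv /= !lte_fin; case: ltP => h1; case: ltP => h2 //.
- by rewrite -!EFinB; congr EFin; ring.
- by exfalso; lra.
- by exfalso; lra.
Qed.

Lemma measurable_turn : measurable_fun (setT : set P) (turn : P -> P).
Proof.
apply: measurable_fun_pair; first exact: measurable_snd.
apply: measurable_funB; last exact: measurable_snd.
by apply: measurable_funB; [exact: measurable_cst|exact: measurable_fst].
Qed.

Let nu : {measure set P -> \bar R} :=
  measure_function_pushforward__canonical__measure_function_Measure mu2 measurable_turn.

(** By uniqueness of the product measure, rectangles suffice. For a fixed second coordinate the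
    first one is merely reflected, so Tonelli reduces the claim to [lebesgue_reflect]. *)
Lemma turn_measure (A : set P) : measurable A -> mu2 (turn @^-1` A) = mu2 A.
Proof.
move=> mA; have H X Y : measurable X -> measurable Y -> nu (X `*` Y) = (mu X * mu Y)%E.
  move=> mX mY; have mXY : measurable (X `*` Y : set P) by exact: measurableX.
  have mB : measurable (turn @^-1` (X `*` Y) : set P).
    by rewrite -[X in measurable X]setTI; exact: measurable_turn.
  pose f (p : P) : \bar R := (\1_(turn @^-1` (X `*` Y)) p)%:E.
  have mf : measurable_fun setT f by apply/measurable_EFinP; exact: measurable_indic.
  have f0 p : (0 <= f p)%E by rewrite lee_fin.
  rewrite /nu /= /pushforward -[X in mu2 X]setIT.
  rewrite -(integral_indic mu2 measurableT mB) (fubini_tonelli1 f)// (fubini_tonelli f)//.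
  transitivity (\int[mu]_y ((\1_X y)%:E * mu Y))%E.
    apply: eq_integral => y _.
    rewrite -(lebesgue_reflect (1 - y) mY).
    have mR : measurable ((fun x : measurableTypeR R => 1 - y - x) @^-1` Y).
      by rewrite -[X in measurable X]setTI; exact: measurable_reflect.
    rewrite -[X in mu X]setIT -(integral_indic mu measurableT mR).
    rewrite -ge0_integralZl//; last by apply/measurable_EFinP; exact: measurable_indic.
    apply: eq_integral => x _; rewrite /f -EFinM; congr EFin; rewrite !indicE -natrM mulnb.
    congr ((nat_of_bool _)%:R).
    by apply/idP/andP; rewrite !inE /= /turn /= addrAC.
  rewrite ge0_integralZr//; last by apply/measurable_EFinP; exact: measurable_indic.
  by rewrite (integral_indic mu measurableT mX) setIT.
exact: esym (product_measure_unique H mA).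
Qed.

Lemma patch_turn F : (fun p => F (turn p)) \_ T = (F \_ T) \o turn.
Proof.
apply/funext => p; rewrite /= !patchE; congr (if _ then _ else _).
by apply/idP/idP; rewrite !inE => /turnT.
Qed.

Lemma measT_turn F : measT F -> measT (fun p => F (turn p)).
Proof.
move=> mF; apply/(measurable_restrictT _ measurable_triangle); rewrite patch_turn.
apply: (measurableT_comp _ measurable_turn).
exact/(measurable_restrictT _ measurable_triangle).
Qed.

Lemma intT_turn F : L1 F -> L1 (fun p => F (turn p)) /\ intT (fun p => F (turn p)) = intT F.
Proof.
move=> iF; pose G : P -> \bar R := EFin \o (F \_ T).
have ptch F' : EFin \o (F' \_ T) = (EFin \o F') \_ T.
  by apply/funext => p; rewrite /= !patchE; case: ifP.
have iG : mu2.-integrable setT G.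
  rewrite /G ptch; exact/(integrable_mkcond _ measurable_triangle).
have [iGr EGr] := integral_preserving measurable_turn turn_measure iG.
have GE : G \o turn = (EFin \o (fun p => F (turn p))) \_ T.
  by rewrite -ptch patch_turn.
split; first by rewrite GE in iGr; exact/(integrable_mkcond _ measurable_triangle).
rewrite /intT /Rintegral integral_mkcond [in RHS]integral_mkcond; congr fine.
by rewrite -[in RHS](ptch F) -/G -GE.
Qed.

Lemma aeT_turn (Q : R * R -> Prop) : aeT Q -> aeT (fun p => Q (turn p)).
Proof.
move=> [N [mN N0 sN]]; exists (turn @^-1` N); split.
- by rewrite -[X in measurable X]setTI; exact: measurable_turn.
- by rewrite -[RHS]N0; exact: turn_measure.
- move=> p /= np; apply: sN => /= H; apply: np => Tp.
  by apply: H; apply/turnT.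
Qed.

Lemma L2_turn f : L2 f -> L2 (fun p => f (turn p)).
Proof.
move=> /L2P[mf if2]; apply/L2P; split; first exact: measT_turn.
by have [] := intT_turn if2.
Qed.

Lemma ip_turn f g : L2 f -> L2 g -> ip (fun p => f (turn p)) (fun p => g (turn p)) = ip f g.
Proof. by move=> Lf Lg; have [_] := intT_turn (L2M Lf Lg). Qed.

Lemma mvt_abs e a b M : (forall x, derivable e x 1) ->
  (forall x, `|x - a| <= `|b - a| -> `|e^`() x| <= M) -> `|e b - e a| <= M * `|b - a|.
Proof.
move=> de H; have ce := derivable_cont1 de.
have dd (x : R) : is_derive x 1 e (e^`() x) by rewrite derive1E; exact: derivableP.
have [ab|/ltW ba] := leP a b.
- have [|c] := @MVT_segment R e e^`() a b ab (fun x _ => dd x).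
    by apply: continuous_subspaceT => x; exact: ce.
  rewrite in_itv /= => /andP[h1 h2] ->; rewrite normrM ler_wpM2r//; apply: H.
  by rewrite !ger0_norm ?subr_ge0// lerD2r.
- have [|c] := @MVT_segment R e e^`() b a ba (fun x _ => dd x).
    by apply: continuous_subspaceT => x; exact: ce.
  rewrite in_itv /= => /andP[h1 h2] E; rewrite distrC E normrM [in leRHS]distrC ler_wpM2r//.
  by apply: H; rewrite distrC [leRHS]distrC !ger0_norm ?subr_ge0// lerD2l lerN2.
Qed.

Lemma slice_step i f p t t' d M : smooth f ->
  (forall x, `|x - t| <= `|t' - t| -> `|pd i f (slice i p x) - d| <= M) ->
  `|f (slice i p t') - f (slice i p t) - (t' - t) * d| <= M * `|t' - t|.
Proof.
move=> sf H; pose e x := f (slice i p x) + (- d * x + 0).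
have d1 (x : R) : derivable (fun x => f (slice i p x)) x 1.
  by apply: derivable_slice; exact: smooth_derivable.
have d2 := smooth1_derivable (smooth1_lin (- d) 0).
have de (x : R) : derivable e x 1 by exact: derivableD (d1 x) (d2 x).
have eE x : e^`() x = pd i f (slice i p x) - d.
  by rewrite (derive1Dx (d1 x) (d2 x)) derive1_slice derive1_lin.
have := @mvt_abs e t t' M de; rewrite /e => V.
have {}V := V (fun x hx => (eq_ind_r (fun u => `|u| <= M) (H x hx) (eE x))).
by move: V; congr (`|_| <= _); ring.
Qed.

(** [smooth] only provides derivatives along the axes. The increment is split into two axis-parallel
    steps, each controlled by [slice_step] and the continuity of the partial derivatives. *)
Lemma is_derive_plane f p (a b : R) : smooth f ->
  is_derive p (a, b) f (a * pd 0 f p + b * pd 1 f p).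
Proof.
move=> sf; set L := a * _ + _.
have c : h^-1 *: ((f \o shift p) (h *: (a, b)) - f p) @[h --> 0^'] --> L.
  apply/cvgrPdist_le => eps eps0.
  (* The summand 1 keeps k positive for the zero direction. *)
  pose k := `|a| + `|b| + 1.
  have k0 : 0 < k by rewrite ltr_wpDl// addr_ge0.
  have e'0 : 0 < eps / k by rewrite divr_gt0.
  have c0 := @smooth_cont R _ (smooth_pd 0 sf) p.
  have c1 := @smooth_cont R _ (smooth_pd 1 sf) p.
  have /nbhs_ballP[r0 /= r0p H0] : \forall q \near p, `|pd 0 f p - pd 0 f q| <= eps / k.
    by move/cvgrPdist_le : c0; apply.
  have /nbhs_ballP[r1 /= r1p H1] : \forall q \near p, `|pd 1 f p - pd 1 f q| <= eps / k.
    by move/cvgrPdist_le : c1; apply.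
  have d0 : 0 < Num.min r0 r1 / k by rewrite divr_gt0// lt_min r0p.
  exists (Num.min r0 r1 / k) => //= h; rewrite /ball_ /= sub0r normrN => hd h0.
  have hk : `|h| * k < Num.min r0 r1 by rewrite -ltr_pdivlMr.
  have [m0 m1] : Num.min r0 r1 <= r0 /\ Num.min r0 r1 <= r1 by rewrite !ge_min !lexx orbT.
  have ha : `|h * a| <= `|h| * k.
    by rewrite normrM ler_wpM2l// /k -addrA lerDl addr_ge0.
  have hb : `|h * b| <= `|h| * k.
    by rewrite normrM ler_wpM2l// /k -addrA addrCA lerDl addr_ge0.
  have S0 := @slice_step 0 f p p.1 (p.1 + h * a) (pd 0 f p) (eps / k) sf.
  have S1 := @slice_step 1 f (p.1 + h * a, p.2) p.2 (p.2 + h * b) (pd 1 f p) (eps / k) sf.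
  have {}S0 := S0 _; have {}S1 := S1 _.
  have T0 : `|f (p.1 + h * a, p.2) - f p - h * a * pd 0 f p| <= eps / k * `|h * a|.
    have := S0; rewrite /slice /= addrAC subrr add0r -surjective_pairing; apply => x hx.
    rewrite distrC; apply: H0; split; rewrite /ball /=; last by rewrite subrr normr0.
    by rewrite distrC (le_lt_trans hx)// (le_lt_trans ha)// (lt_le_trans hk).
  have T1 : `|f (p.1 + h * a, p.2 + h * b) - f (p.1 + h * a, p.2) - h * b * pd 1 f p|
      <= eps / k * `|h * b|.
    have := S1; rewrite /slice /= addrAC subrr add0r; apply => x hx.
    rewrite distrC; apply: H1; split; rewrite /ball /= distrC.
      by rewrite addrAC subrr add0r (le_lt_trans ha)// (lt_le_trans hk).
    by rewrite (le_lt_trans hx)// (le_lt_trans hb)// (lt_le_trans hk).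
  have shE : shift p (h *: (a, b)) = (p.1 + h * a, p.2 + h * b).
    by apply: injective_projections; rewrite /= addrC.
  rewrite /= -/(shift p (h *: (a, b))) shE.
  have -> : L - h^-1 *: (f (p.1 + h * a, p.2 + h * b) - f p) = - (h^-1 *
    ((f (p.1 + h * a, p.2 + h * b) - f (p.1 + h * a, p.2) - h * b * pd 1 f p)
     + (f (p.1 + h * a, p.2) - f p - h * a * pd 0 f p))).
    by rewrite /GRing.scale /= /L; move: (pd 0 f p) (pd 1 f p) (f _) (f _) (f _) => *; field.
  rewrite normrN normrM normfV ler_pdivrMl ?normr_gt0//.
  apply: (le_trans (ler_normD _ _)); apply: (le_trans (lerD T1 T0)).
  rewrite !normrM.
  have -> : eps / k * (`|h| * `|b|) + eps / k * (`|h| * `|a|) =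
    `|h| * eps * ((`|b| + `|a|) / k) by ring.
  rewrite ler_piMr ?mulr_ge0 ?(ltW eps0)// ler_pdivrMr// mul1r /k.
  by rewrite [leLHS]addrC lerDl.
by split; [apply/cvg_ex; exists L|exact: cvg_lim].
Qed.

(** The columns of the linear part of [turn]. *)
Definition turn_dir (i : 'I_2) : R * R := if i == 0 then (0, -1) else (1, -1).

(* The derivative that pd i becomes under composition with turn. *)
Definition pd_turn i f p := (turn_dir i).1 * pd 0 f p + (turn_dir i).2 * pd 1 f p.

Lemma is_derive_turn i f p : smooth f ->
  is_derive p (basis R i) (fun p => f (turn p)) (pd_turn i f (turn p)).
Proof.
move=> sf; apply/is_derive_line.
have := is_derive_plane (turn p) (turn_dir i).1 (turn_dir i).2 sf.
rewrite -surjective_pairing => /is_derive_line; congr is_derive.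
apply/funext => h; congr f; case: (ord2E i) => ->; apply: injective_projections;
  by rewrite /turn /turn_dir /basis /GRing.scale /=; ring.
Qed.

Lemma smooth_pd_turn i f : smooth f -> smooth (pd_turn i f).
Proof.
move=> sf; exact: smoothD (smoothM (smooth_cst _) (smooth_pd 0 sf))
  (smoothM (smooth_cst _) (smooth_pd 1 sf)).
Qed.

Lemma pd_comp_turn i f : smooth f -> pd i (fun p => f (turn p)) = fun p => pd_turn i f (turn p).
Proof.
move=> sf; apply/funext => p.
by rewrite /pd (@derive_val _ _ _ _ _ _ _ (is_derive_turn i p sf)).
Qed.

Lemma turn_cont : continuous turn.
Proof.
move=> p; apply: (@cvg_pair _ _ _ (nbhs p) (nbhs p.2) (nbhs (1 - p.1 - p.2))).
  exact: cvg_snd.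
by apply: cvgB; [apply: cvgB; [exact: cvg_cst|exact: cvg_fst]|exact: cvg_snd].
Qed.

Lemma smooth_turn f : smooth f -> smooth (fun p => f (turn p)).
Proof.
move=> sf; apply/smoothE => n; elim: n f sf => [|n IH] f sf.
  by split=> // p; apply: continuous_comp; [exact: turn_cont|exact: smooth_cont].
split; first by move=> p; apply: continuous_comp; [exact: turn_cont|exact: smooth_cont].
move=> i; split; first by move=> p; have [] := is_derive_turn i p sf.
by rewrite (pd_comp_turn i sf); apply: IH; exact: smooth_pd_turn.
Qed.

Lemma test_turn phi : test phi -> test (fun p => phi (turn p)).
Proof.
move=> [sphi [K [cK KT K0]]]; split; first exact: smooth_turn.
(* The double turn is the inverse of [turn]. *)
exists ((fun p => turn (turn p)) @` K); split.
- apply: continuous_compact => //; apply: continuous_subspaceT => p.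
  by apply: continuous_comp; exact: turn_cont.
- by move=> _ [p /KT Tp <-]; apply/turnT; apply/turnT.
- move=> p np; apply: K0 => Kp; apply: np; exists (turn p) => //; exact: turn3.
Qed.

End Rotation.

(** * Continuity of functions of H^2(T) up to the boundary *)

Section ContinuousRepresentative.
Variable R : realType.
Local Notation T := (@triangle R).
Implicit Types (f g F W z phi psi : R * R -> R) (p q : R * R) (a b c d : R).

Lemma ip_lin2 z u v a b : L2 z -> L2 u -> L2 v ->
  ip z (fun p => a * u p + b * v p) = a * ip z u + b * ip z v.
Proof.
move=> Lz Lu Lv; have := ipDr Lz (L2Z a Lu) (L2Z b Lv).
by rewrite (ipZr a Lz Lu) (ipZr b Lz Lv).
Qed.

Lemma ip_lin2l z u v a b : L2 z -> L2 u -> L2 v ->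
  ip (fun p => a * u p + b * v p) z = a * ip u z + b * ip v z.
Proof.
move=> Lz Lu Lv; have e := ip_lin2 a b Lz Lu Lv.
apply: (etrans (ipC _ _)); apply: (etrans e).
by rewrite (ipC u z) (ipC v z).
Qed.

Lemma L2_lin2 u v a b : L2 u -> L2 v -> L2 (fun p => a * u p + b * v p).
Proof. by move=> Lu Lv; exact: L2D (L2Z a Lu) (L2Z b Lv). Qed.

(** Every test function is psi composed with [turn], for psi its composition with the double turn; a
    change of variables then removes [turn] from the identity. [D] is the transformed differential
    operator. *)
Lemma is_wD_turn w z g (D : (R * R -> R) -> R * R -> R) : L2 z -> L2 g ->
  (forall psi, smooth psi -> pds w (fun p => psi (turn p)) = fun p => D psi (turn p)) ->
  (forall psi, smooth psi -> smooth (D psi)) ->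
  (forall psi, test psi -> ip z (D psi) = (-1) ^+ size w * ip g psi) ->
  is_wD w (fun p => z (turn p)) (fun p => g (turn p)).
Proof.
move=> Lz Lg HD sD Hip; split; first exact: L2_turn.
move=> phi tphi; pose psi p := phi (turn (turn p)).
have tpsi : test psi := test_turn (test_turn tphi).
have spsi := test_smooth tpsi.
have phiE : phi = fun p => psi (turn p) by apply/funext => p; rewrite /psi turn3.
rewrite phiE (HD _ spsi) (ip_turn Lz (L2_smooth (sD _ spsi))) (Hip _ tpsi).
by congr (_ * _); exact: esym (ip_turn Lg (L2_smooth spsi)).
Qed.

Lemma H2_turn z : H2 z -> H2 (fun p => z (turn p)).
Proof.
move=> Hz; have Lz := H2_L2 Hz; split; first exact: L2_turn.
have W1 i := H2_wD (w := [:: i]) Hz isT.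
have W2 i j := H2_wD (w := [:: i; j]) Hz isT.
case=> [|i [|k [|//]]] _.
- exists (fun p => z (turn p)); split; first exact: L2_turn.
  by move=> phi _; rewrite expr0 mul1r.
- pose a := (turn_dir R i).1; pose b := (turn_dir R i).2.
  pose g q := a * wD [:: 0] z q + b * wD [:: 1] z q.
  exists (fun p => g (turn p)).
  have [L0 H0] := W1 0; have [L1 H1] := W1 1.
  refine (@is_wD_turn [:: i] z g (pd_turn i) Lz _ _ _ _).
  + exact: (L2_lin2 a b L0 L1).
  + by move=> psi spsi; exact: (pd_comp_turn i spsi).
  + by move=> psi spsi; exact: (smooth_pd_turn i spsi).
  + move=> psi tpsi; have spsi := test_smooth tpsi; have Lpsi := L2_smooth spsi.
    have l := ip_lin2 a b Lz (L2_smooth (smooth_pd 0 spsi)) (L2_smooth (smooth_pd 1 spsi)).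
    have r : ip g psi = _ := ip_lin2l a b Lpsi L0 L1.
    have e0 := H0 _ tpsi; have e1 := H1 _ tpsi.
    have alg (x y : R) : a * ((-1) ^+ 1 * x) + b * ((-1) ^+ 1 * y) = (-1) ^+ 1 * (a * x + b * y).
      by rewrite expr1; ring.
    apply: (etrans l); apply: (etrans (f_equal2 (fun x y => a * x + b * y) e0 e1)).
    exact: etrans (alg _ _) (congr1 (fun x => (-1) ^+ 1 * x) (esym r)).
- pose a := (turn_dir R i).1; pose b := (turn_dir R i).2.
  pose a' := (turn_dir R k).1; pose b' := (turn_dir R k).2.
  have L l m : L2 (wD [:: l; m] z) by have [] := W2 l m.
  have H l m psi (tpsi : test psi) : ip z (pd l (pd m psi)) = ip (wD [:: l; m] z) psi.
    by have [_ /(_ _ tpsi) /= ->] := W2 l m; rewrite sqrrN expr1n mul1r.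
  (* The chain rule for an affine map: the second derivative is contracted with the two image
     directions. *)
  pose g q := a * (a' * wD [:: 0; 0] z q + b' * wD [:: 0; 1] z q)
            + b * (a' * wD [:: 1; 0] z q + b' * wD [:: 1; 1] z q).
  exists (fun p => g (turn p)).
  have sp l psi : smooth psi -> smooth (pd l (pd_turn k psi)).
    by move=> spsi; exact: smooth_pd (smooth_pd_turn k spsi).
  refine (@is_wD_turn [:: i; k] z g (fun psi => pd_turn i (pd_turn k psi)) Lz _ _ _ _).
  + exact: (L2_lin2 a b (L2_lin2 a' b' (L 0 0) (L 0 1)) (L2_lin2 a' b' (L 1 0) (L 1 1))).
  + move=> psi spsi; rewrite [LHS]/= (pd_comp_turn k spsi).
    exact: (pd_comp_turn i (smooth_pd_turn k spsi)).
  + by move=> psi spsi; exact: (smooth_pd_turn i (smooth_pd_turn k spsi)).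
  + move=> psi tpsi; have spsi := test_smooth tpsi; have Lpsi := L2_smooth spsi.
    have s0 := smooth_pd 0 spsi; have s1 := smooth_pd 1 spsi.
    have E l : ip z (pd l (pd_turn k psi)) = ip (fun q => a' * wD [:: l; 0] z q + b' * wD [:: l; 1] z q) psi.
      have e : pd l (pd_turn k psi) = fun p => a' * pd l (pd 0 psi) p + b' * pd l (pd 1 psi) p.
        rewrite /pd_turn (pdD l (smoothM (smooth_cst _) s0) (smoothM (smooth_cst _) s1)).
        by rewrite (pdZ l _ s0) (pdZ l _ s1).
      apply: (etrans (congr1 (ip z) e)).
      apply: (etrans (ip_lin2 a' b' Lz (L2_smooth (smooth_pd l s0)) (L2_smooth (smooth_pd l s1)))).
      apply: (etrans (f_equal2 (fun x y => a' * x + b' * y) (H l 0 _ tpsi) (H l 1 _ tpsi))).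
      exact: (esym (ip_lin2l a' b' Lpsi (L l 0) (L l 1))).
    have l := ip_lin2 a b Lz (L2_smooth (sp 0 _ spsi)) (L2_smooth (sp 1 _ spsi)).
    have r : ip g psi = _ :=
      ip_lin2l a b Lpsi (L2_lin2 a' b' (L 0 0) (L 0 1)) (L2_lin2 a' b' (L 1 0) (L 1 1)).
    have sgn (x : R) : x = (-1) ^+ 2 * x by rewrite sqrrN expr1n mul1r.
    apply: (etrans l); apply: (etrans (f_equal2 (fun x y => a * x + b * y) (E 0) (E 1))).
    exact: (etrans (esym r) (sgn (ip g psi))).
Qed.

Lemma closure_triangle p : closure T p -> [/\ 0 <= p.1, 0 <= p.2 & p.1 + p.2 <= 1].
Proof.
have cadd : continuous (fun p : R * R => p.1 + p.2).
  exact: smooth_cont (smoothD (smooth_co 0) (smooth_co 1)).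
pose C : set (R * R) := fst @^-1` [set x | 0 <= x] `&` snd @^-1` [set x | 0 <= x] `&`
      (fun p => p.1 + p.2) @^-1` [set x | x <= 1].
have cC : closed C.
  apply: closedI; [apply: closedI|].
  - by apply: closed_comp => [q _|]; [exact: cvg_fst|exact: closed_ge].
  - by apply: closed_comp => [q _|]; [exact: cvg_snd|exact: closed_ge].
  - by apply: closed_comp => [q _|]; [exact: cadd|exact: closed_le].
have TC : T `<=` C by move=> q [h1 h2 h3]; split; [split|]; rewrite /= ltW.
by move=> cp; have [[h1 h2] h3] : C p by rewrite ((closure_id C).1 cC); exact: closure_subset cp.
Qed.

Definition cut_sum p : R := corner_cut p + corner_cut (turn (turn p)) + corner_cut (turn p).

Lemma corner_cut_cont : continuous (@corner_cut R).
Proof. exact: smooth_cont (smooth_add (smooth1_descent _ _)). Qed.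

(** One barycentric coordinate is at least 1/4, and the cut-off of the corresponding vertex is then
    1. *)
Lemma cut_sum_gt0 p : closure T p -> 0 < cut_sum p.
Proof.
move=> /closure_triangle[h1 h2 h3].
have ge0 q : 0 <= corner_cut q :> R by have /andP[] := descent01 (3 / 4 : R) (7 / 8) (q.1 + q.2).
have lt34 : (3 / 4 : R) < 7 / 8 by lra.
have eq1 q : q.1 + q.2 <= 3 / 4 -> corner_cut q = 1 :> R.
  by move=> h; rewrite /corner_cut (descent1 lt34 h).
have := ge0 p; have := ge0 (turn p); have := ge0 (turn (turn p)); rewrite /cut_sum.
have [k|k] := leP (p.1 + p.2) (3 / 4); first by rewrite (eq1 _ k); lra.
have [k'|k'] := leP p.1 (1 / 4); last first.
  by rewrite (eq1 (turn p)); [lra|rewrite /turn /=; lra].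
by rewrite (eq1 (turn (turn p))); [lra|rewrite /turn /=; lra].
Qed.

(** The three cut-offs, divided by their positive sum, form a partition of unity; z times each
    cut-off is a turned potential, hence continuous. *)
Lemma continuous_rep z : H2 z ->
  exists g, {within closure T, continuous g} /\ aeT (fun p => g p = z p).
Proof.
move=> Hz; have Hz1 := H2_turn Hz; have Hz2 := H2_turn Hz1.
pose G z := potential (corner_mixed z).
have cG z' : H2 z' -> continuous (G z').
  by move=> Hz'; apply: potential_cont; exact: L2_L1 (L2_corner_mixed Hz').
pose z1 p := z (turn p); pose z2 p := z (turn (turn p)).
(* Each potential is evaluated at the inverse turn, so that by [turn3] all three terms contain z at
   the same point p. *)
pose num p := G z p + G z1 (turn (turn p)) + G z2 (turn p).
have cturn (f : R * R -> R) : continuous f -> continuous (fun p => f (turn p)).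
  by move=> cf p; apply: continuous_comp; [exact: turn_cont|exact: cf].
have cD3 (f g h : R * R -> R) : continuous f -> continuous g -> continuous h ->
    continuous (fun p => f p + g p + h p).
  by move=> cf cg ch p; exact: cvgD (cvgD (cf p) (cg p)) (ch p).
have cnum : continuous num :=
  cD3 _ _ _ (cG z Hz) (cturn _ (cturn _ (cG z1 Hz1))) (cturn _ (cG z2 Hz2)).
have cden : continuous cut_sum :=
  cD3 _ _ _ corner_cut_cont (cturn _ (cturn _ corner_cut_cont)) (cturn _ corner_cut_cont).
exists (fun p => num p / cut_sum p); split.
  apply: continuous_in_subspaceT => p /set_mem cp.
  apply: cvgM (cnum p) _; apply: cvgV (cden p).
  by rewrite gt_eqF// cut_sum_gt0.
have r0 := corner_rep Hz.
have r1 := aeT_turn (aeT_turn (corner_rep Hz1)).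
have r2 := aeT_turn (corner_rep Hz2).
apply: (aeTS (aeTI r0 (aeTI r1 r2))) => p Tp [e0 [e1 e2]].
have pos := cut_sum_gt0 (subset_closure Tp).
rewrite /num /G -e0 -e1 -e2 /= !turn3.
have -> : corner_cut p * z p + corner_cut (turn (turn p)) * z p + corner_cut (turn p) * z p
  = z p * cut_sum p by rewrite /cut_sum; ring.
by rewrite mulfK// gt_eqF.
Qed.

Lemma crepP z : H2 z ->
  {within closure T, continuous (crep z)} /\ aeT (fun p => crep z p = z p).
Proof. by move=> Hz; exact: (xgetPex z (continuous_rep Hz)). Qed.

End ContinuousRepresentative.

(** * The one-variable profiles phi_eps, P and Pi *)

Section Profiles.
Variable R : realType.
Variables (C eps : R).
Implicit Types (x y t : R).
Local Notation mu := (@lebesgue_measure R).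

(** phi_eps as a function of the squared radius: smoothness of [v_eps] at the origin then involves
    no square root. *)
Definition bell s : R := C * eps^-1 * flat 0 (1 - s / eps ^+ 2).
Definition mollifier t : R := bell (t ^+ 2).
(** P, extended smoothly to the whole line. P(0) = 1/2 is built in; the normalisation of C makes it
    vanish from eps on. *)
Definition tail y : R := 2^-1 - (prim mollifier y - prim mollifier 0).
Definition moment t : R := t * mollifier t.
(** Pi after an integration by parts. [tail] does not vanish on a left half-line, so [prim] suits
    [moment] rather than [tail]. *)
Definition area x : R := x * tail x + (prim moment x - prim moment 0).

Hypotheses (C0 : 0 < C) (eps0 : 0 < eps).

Lemma flat0_le1 x : flat 0 x <= 1.
Proof.
rewrite /flat; case: ifPn => // x0; rewrite expr0 mul1r -expR0 ler_expR oppr_le0.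
by rewrite invr_ge0 ltW.
Qed.

Lemma smooth1_bell : smooth1 bell.
Proof.
have a : smooth1 (fun s : R => 1 - s / eps ^+ 2) :=
  smooth1B (smooth1_cst 1) (smooth1M smooth1_id (smooth1_cst _)).
exact: (smooth1M (smooth1_cst (C * eps^-1)) (smooth1_comp (@smooth1_flat R 0) a)).
Qed.

Lemma bell0 s : eps ^+ 2 <= s -> bell s = 0.
Proof.
move=> h; rewrite /bell flat_eq0 ?mulr0// subr_le0 ler_pdivlMr ?exprn_gt0//.
by rewrite mul1r.
Qed.

Lemma bell_ge0 s : 0 <= bell s.
Proof. by rewrite mulr_ge0 ?flat_ge0// mulr_ge0 ?invr_ge0 1?ltW. Qed.

Lemma bell_le s : bell s <= C * eps^-1.
Proof.
by rewrite /bell -[leRHS]mulr1 ler_wpM2l ?flat0_le1// mulr_ge0 ?invr_ge0 1?ltW.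
Qed.

Lemma phi_epsE t : 0 <= t -> phi_eps C eps t = mollifier t.
Proof.
move=> t0; rewrite /phi_eps /mollifier; case: ltP => h; last first.
  by rewrite bell0// ler_sqr ?nnegrE// ltW.
have h2 : t ^+ 2 < eps ^+ 2 by rewrite ltr_sqr ?nnegrE ?(ltW eps0).
have e2 : eps ^+ 2 != 0 by rewrite lt0r_neq0// exprn_gt0.
have d : 1 - t ^+ 2 / eps ^+ 2 = (eps ^+ 2 - t ^+ 2) / eps ^+ 2 by rewrite mulrBl divff.
have d0 : 0 < eps ^+ 2 - t ^+ 2 by rewrite subr_gt0.
rewrite /bell /flat d divr_gt0 ?exprn_gt0// expr0 mul1r invf_div.
by [].
Qed.

Lemma smooth1_mollifier : smooth1 mollifier.
Proof. exact: smooth1_comp smooth1_bell (smooth1X 2 smooth1_id). Qed.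

Lemma mollifierN t : mollifier (- t) = mollifier t.
Proof. by rewrite /mollifier sqrrN. Qed.

Lemma mollifier_ge t : eps <= t -> mollifier t = 0.
Proof. by move=> h; apply: bell0; rewrite ler_sqr ?nnegrE ?(ltW eps0)// (le_trans (ltW eps0)). Qed.

Lemma mollifier_le t : t <= - eps -> mollifier t = 0.
Proof. by move=> h; rewrite -mollifierN mollifier_ge// lerNr. Qed.

Lemma mollifier_ge0 t : 0 <= mollifier t. Proof. exact: bell_ge0. Qed.

Lemma moment_ge t : eps <= t -> moment t = 0.
Proof. by move=> h; rewrite /moment mollifier_ge ?mulr0. Qed.

Lemma moment_le t : t <= - eps -> moment t = 0.
Proof. by move=> h; rewrite /moment mollifier_le ?mulr0. Qed.

Lemma smooth1_moment : smooth1 moment.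
Proof. exact: smooth1M smooth1_id smooth1_mollifier. Qed.

(** phi_eps is at most C / eps, but on its support t is at most eps: the extra factor t is what
    keeps K bounded. *)
Lemma moment_bound t : 0 <= t -> `|moment t| <= C.
Proof.
move=> t0; have [h|h] := leP eps t; first by rewrite moment_ge// normr0 ltW.
rewrite /moment ger0_norm; last by rewrite mulr_ge0// mollifier_ge0.
apply: (@le_trans _ _ (t * (C * eps^-1))); first by rewrite ler_wpM2l// bell_le.
have -> : t * (C * eps^-1) = C * (t / eps) by ring.
by rewrite -[leRHS]mulr1 ler_wpM2l ?(ltW C0)// ler_pdivrMr// mul1r ltW.
Qed.

Lemma smooth1_tail : smooth1 tail.
Proof.
exact: (smooth1B (smooth1_cst _) (smooth1B (smooth1_prim smooth1_mollifier mollifier_le)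
  (smooth1_cst _))).
Qed.

Lemma derive1_shift (e : R -> R) (a b : R) x : smooth1 e ->
  (fun x => a + b * e x)^`() x = b * e^`() x.
Proof.
move=> se; have := @derive1_compx _ (fun u => b * u + a) e x.
rewrite derive1_lin => <-; [|exact: smooth1_derivable (smooth1_lin _ _) _|
  exact: smooth1_derivable].
by congr derive1; apply/funext => u; rewrite addrC.
Qed.

Lemma derive1_tail : tail^`() = fun y => - mollifier y.
Proof.
apply/funext => y; have sp := smooth1_prim smooth1_mollifier mollifier_le.
have := derive1_shift (2^-1 + prim mollifier 0) (-1) y sp.
rewrite (derive1_prim (smooth1_cont smooth1_mollifier) mollifier_le) mulN1r => <-.
by congr derive1; apply/funext => u; rewrite /tail; ring.
Qed.

Lemma tail0 : tail 0 = 2^-1.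
Proof. by rewrite /tail subrr subr0. Qed.

Lemma smooth1_area : smooth1 area.
Proof.
exact: (smooth1D (smooth1M smooth1_id smooth1_tail)
  (smooth1B (smooth1_prim smooth1_moment moment_le) (smooth1_cst _))).
Qed.

Lemma area0 : area 0 = 0.
Proof. by rewrite /area mul0r subrr addr0. Qed.

Lemma derive1_area : area^`() = tail.
Proof.
apply/funext => x; have sp := smooth1_prim smooth1_moment moment_le.
have dt := smooth1_derivable smooth1_tail x; have di := smooth1_derivable (@smooth1_id R) x.
have -> : area = fun x => x * tail x + (- prim moment 0 + 1 * prim moment x).
  by apply/funext => u; rewrite /area; ring.
rewrite derive1Dx; [|exact: smooth1_derivable (smooth1M smooth1_id smooth1_tail) x|
  exact: smooth1_derivable (smooth1D (smooth1_cst _) (smooth1M (smooth1_cst _) sp)) x].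
rewrite derive1_shift// derive1Mx// derive1_id derive1_tail.
rewrite (derive1_prim (smooth1_cont smooth1_moment) moment_le) /moment; ring.
Qed.

Hypothesis eps1 : eps < 1.
Hypothesis mass : (\int[mu]_(t in `[0, 1]) phi_eps C eps t)%R = 2^-1.

(** The normalisation of C enters here: the mass of phi_eps on [0, 1] equals the initial value 1/2
    of P. *)
Lemma tail_ge y : eps <= y -> tail y = 0.
Proof.
have sp := smooth1_prim smooth1_mollifier mollifier_le.
have dp := derive1_prim (smooth1_cont smooth1_mollifier) mollifier_le.
have e1 : prim mollifier 1 - prim mollifier 0 = 2^-1.
  have := @ftc_C1 _ (prim mollifier) 0 1 (smooth1_derivable sp) _ ltr01.
  rewrite dp => /(_ (smooth1_cont smooth1_mollifier)) E.
  rewrite -mass -[LHS]/(fine (_%:E)) -E /Rintegral; congr fine.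
  apply: eq_integral => t /set_mem; rewrite /= in_itv /= => /andP[t0 _].
  by rewrite phi_epsE.
move=> h; rewrite /tail (prim_cst mollifier_ge h) -(prim_cst mollifier_ge (ltW eps1)).
by rewrite e1 subrr.
Qed.

Lemma tail_anti x y : x <= y -> tail y <= tail x.
Proof.
move=> xy; rewrite -lerN2.
have sN : smooth1 (fun y => - tail y) by exact: smooth1N smooth1_tail.
apply: (mvt_ge0 sN xy) => t _.
have := derive1_shift 0 (-1) t smooth1_tail; rewrite derive1_tail mulN1r opprK.
rewrite (_ : (fun x => _) = fun y => - tail y); first by move=> ->; exact: mollifier_ge0.
by apply/funext => u; rewrite add0r mulN1r.
Qed.

Lemma tail_ge0 y : 0 <= tail y.
Proof.
rewrite -(@tail_ge (Num.max eps y)) ?le_max ?lexx// tail_anti// le_max lexx orbT.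
by [].
Qed.

Lemma tail_le y : 0 <= y -> tail y <= 2^-1.
Proof. by move=> y0; rewrite -tail0 tail_anti. Qed.

Lemma tail_bound y : 0 <= y -> `|tail y| <= 1.
Proof. by move=> y0; rewrite ger0_norm ?tail_ge0// (le_trans (tail_le y0))//; lra. Qed.

Lemma area_ge x : eps <= x -> area x = area eps.
Proof.
move=> h; apply/eqP; rewrite -subr_eq0 -normr_le0.
have := @mvt_bound _ area eps x 0 smooth1_area h; rewrite mul0r; apply => t /andP[t1 _].
by rewrite derive1_area tail_ge ?normr0.
Qed.

(** The derivative P is bounded by 1 and vanishes from eps on. *)
Lemma area_bound x : 0 <= x -> `|area x| <= eps.
Proof.
have H y : 0 <= y -> y <= eps -> `|area y| <= eps.
  move=> y0 ye; have := @mvt_bound _ area 0 y 1 smooth1_area y0.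
  rewrite area0 !subr0 mul1r => /(_ _)/le_trans; apply => // t /andP[t0 _].
  by rewrite derive1_area tail_bound.
move=> x0; have [h|/ltW h] := leP eps x; last exact: H.
by rewrite (area_ge h); apply: H => //; exact: ltW.
Qed.

End Profiles.

(** * Products of one-variable functions, and functions vanishing on a leg *)

Section Tens.
Variable R : realType.
Local Notation T := (@triangle R).
Implicit Types (f g F : R * R -> R) (p q : R * R) (e : R -> R).

Definition tens (i : 'I_2) (e1 e2 : R -> R) p : R := e1 (co i p) * e2 (co (other i) p).

Lemma smooth_tens i e1 e2 : smooth1 e1 -> smooth1 e2 -> smooth (tens i e1 e2).
Proof.
move=> s1 s2.
exact: (smoothM (smooth_comp s1 (smooth_co i)) (smooth_comp s2 (smooth_co (other i)))).
Qed.

Lemma tens_other i e1 e2 : tens (other i) e1 e2 = tens i e2 e1.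
Proof.
by apply/funext => p; rewrite /tens mulrC; case: (ord2E i) => ->.
Qed.

Lemma pd_tens i e1 e2 : smooth1 e1 -> smooth1 e2 ->
  pd i (tens i e1 e2) = tens i e1^`() e2.
Proof.
move=> s1 s2; case: (ord2E i) => ->; first exact: (pd_tensor 0 s1 s2).
have -> : tens 1 e1 e2 = fun p => e2 p.1 * e1 p.2 by apply/funext => p; rewrite /tens mulrC.
by rewrite (pd_tensor 1 s2 s1); apply/funext => p; rewrite [RHS]/tens [RHS]mulrC.
Qed.

Lemma pd_tens_other i e1 e2 : smooth1 e1 -> smooth1 e2 ->
  pd (other i) (tens i e1 e2) = tens i e1 e2^`().
Proof. by move=> s1 s2; rewrite -tens_other pd_tens// tens_other. Qed.

(** Mean value theorem on the segment from p perpendicular to the leg, whose interior lies in the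
    triangle, where the derivative is bounded. *)
Lemma vanish_bound i F : smooth F -> (forall p, co i p = 0 -> F p = 0) ->
  exists2 M, 0 <= M & forall p, T p -> `|F p| <= M * co i p.
Proof.
move=> sF F0.
have [M HM] := continuous_bounded_triangle (smooth_cont (smooth_pd i sF)).
have M0 : 0 <= M.
  (* Any point of the triangle shows that the bound is nonnegative. *)
  apply: le_trans (normr_ge0 _) (HM (4^-1, 4^-1) _).
  by split; rewrite /=; lra.
exists M => // p Tp; pose e t := F (slice i p t).
have co0 t : co i (slice i p t) = t by case: (ord2E i) => ->.
have Tsl t : 0 < t < co i p -> T (slice i p t).
  move=> /andP[]; case: Tp; case: (ord2E i) => -> h1 h2 h3; rewrite /co /slice /= => k1 k2.
    by split => //=; lra.
  by split => //=; lra.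
have slp : slice i p (co i p) = p by case: p {Tp e co0 Tsl} => x y; case: (ord2E i) => ->.
have p0 : 0 < co i p by case: Tp; case: (ord2E i) => ->.
have de (t : R) : derivable e t 1 := derivable_slice (@smooth_derivable _ F i (slice i p t) sF).
have [| |c ] := @MVT R e e^`() 0 (co i p) p0.
- by move=> x _; rewrite derive1E; apply: derivableP.
- by apply: continuous_subspaceT => x; exact: derivable_cont1.
rewrite in_itv /= => cp; rewrite /e slp (F0 _ (co0 0)) !subr0 => ->.
rewrite derive1_slice normrM (gtr0_norm p0) ler_wpM2r ?(ltW p0)//.
exact: HM (Tsl _ cp).
Qed.

Lemma vanish_bounds (F G : 'I_2 -> R * R -> R) :
  (forall i, smooth (F i)) -> (forall i p, co i p = 0 -> F i p = 0) ->
  (forall i, smooth (G i)) -> (forall i p, co i p = 0 -> G i p = 0) ->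
  exists M, (forall i p, T p -> `|F i p| <= M * co i p) /\
            (forall i p, T p -> `|G i p| <= M * co i p).
Proof.
move=> sF F0 sG G0.
have [M0 p0 H0] := vanish_bound (sF 0) (F0 0); have [M1 p1 H1] := vanish_bound (sF 1) (F0 1).
have [N0 q0 K0] := vanish_bound (sG 0) (G0 0); have [N1 q1 K1] := vanish_bound (sG 1) (G0 1).
have up x M p i : T p -> M <= M0 + M1 + (N0 + N1) -> x <= M * co i p ->
    x <= (M0 + M1 + (N0 + N1)) * co i p.
  move=> Tp ML /le_trans; apply; rewrite ler_wpM2r//.
  by case: Tp => /ltW h1 /ltW h2 _; case: (ord2E i) => ->.
exists (M0 + M1 + (N0 + N1)); split=> i p Tp; case: (ord2E i) => ->.
- by apply: up Tp _ (H0 p Tp); lra.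
- by apply: up Tp _ (H1 p Tp); lra.
- by apply: up Tp _ (K0 p Tp); lra.
- by apply: up Tp _ (K1 p Tp); lra.
Qed.

End Tens.

(** * The tensor K and its double divergence *)

Section Corrector.
Variable R : realType.
Local Notation T := (@triangle R).
Implicit Types (p : R * R) (x y s t : R).

(** The cut-off b. It is 1 on the support of phi_eps in [0, 1], as eps <= 1/16 < 1/8. Both 3/8 + 3/8
    and 3/8 + 1/16 stay below 7/8, so the products in K vanish near the hypotenuse. *)
Definition plateau : R -> R := descent (1 / 8) (3 / 8).

Lemma plateau_lt : 1 / 8 < 3 / 8 :> R. Proof. by lra. Qed.

Lemma smooth1_plateau : smooth1 plateau.
Proof. exact: smooth1_descent. Qed.

Let sb := smooth1_plateau.
Let sb' := smooth1_derive1 sb.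
Let sb'' := smooth1_derive1 sb'.

Lemma derive1_plateau0 x : x <= 1 / 8 \/ 3 / 8 <= x -> plateau^`() x = 0.
Proof. exact: (derive1_descent0 plateau_lt). Qed.

Lemma derive2_plateau0 x : x < 1 / 8 -> plateau^`()^`() x = 0.
Proof.
move=> h; rewrite (@near_derive1 _ _ (fun=> 0)) ?derive1_cst//.
near=> y; apply: derive1_plateau0; left; apply: ltW.
by near: y; exact: lt_nbhsl.
Unshelve. all: by end_near. Qed.

Variables (C eps : R).
Hypotheses (C0 : 0 < C) (eps0 : 0 < eps) (eps_le : eps <= 1 / 16).
Hypothesis mass : (\int[@lebesgue_measure R]_(t in `[0, 1]) phi_eps C eps t)%R = 2^-1.

Let eps1 : eps < 1. Proof. by move: eps_le; lra. Qed.

Local Notation bell := (bell C eps).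
Local Notation mollifier := (mollifier C eps).
Local Notation tail := (tail C eps).
Local Notation moment := (moment C eps).
Local Notation area := (area C eps).

Let st := smooth1_tail C eps0.
Let st' := smooth1_derive1 st.
Let sm := smooth1_moment C eps.
Let sa := smooth1_area C eps0.

Definition cutoff_area x : R := area x * plateau x.

Let sab : smooth1 cutoff_area. Proof. exact: smooth1M sa sb. Qed.
Let sab' := smooth1_derive1 sab.
Lemma derive1M_fun (e1 e2 d1 d2 : R -> R) : smooth1 e1 -> smooth1 e2 ->
  e1^`() = d1 -> e2^`() = d2 ->
  (fun x => e1 x * e2 x)^`() = fun x => e1 x * d2 x + e2 x * d1 x.
Proof.
move=> s1 s2 <- <-; apply/funext => x.
exact: (derive1Mx (smooth1_derivable s1 x) (smooth1_derivable s2 x)).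
Qed.

Lemma derive1_cutoff_area :
  cutoff_area^`() = fun x => area x * plateau^`() x + plateau x * tail x.
Proof. exact: derive1M_fun sa sb (derive1_area C eps0) erefl. Qed.

(** From eps on, Pi is constant; below eps, b is 1. So the term with both first derivatives never
    appears. *)
Lemma derive2_cutoff_area x :
  cutoff_area^`()^`() x = area eps * plateau^`()^`() x - mollifier x.
Proof.
have d1 := smooth1_derivable (smooth1M sa sb') x.
have d2 := smooth1_derivable (smooth1M sb st) x.
rewrite derive1_cutoff_area; apply: (etrans (derive1Dx d1 d2)).
have e1 := congr1 (fun e => e x) (derive1M_fun sa sb' (derive1_area C eps0) erefl).
have e2 := congr1 (fun e => e x) (derive1M_fun sb st erefl (derive1_tail C eps0)).
apply: (etrans (f_equal2 +%R e1 e2)) => /=.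
have [h|h] := leP eps x.
  rewrite (tail_ge eps0 eps1 mass h) (area_ge eps0 eps1 mass h) (mollifier_ge C eps0 h).
  move: (area eps) (plateau x) (plateau^`() x) (plateau^`()^`() x) => a b c d; ring.
have x8 : x < 1 / 8 by move: eps_le h; lra.
rewrite (derive2_plateau0 x8) (derive1_plateau0 (or_introl (ltW x8))).
rewrite /plateau (descent1 plateau_lt (ltW x8)).
move: (area eps) (area x) (tail x) (mollifier x) => a b c d; ring.
Qed.

(* The off-diagonal entry is chosen so that v_eps I + corrector takes the value
   -1/2 at the corner; the diagonal ones cancel v_eps on the legs, and the flux
   through them. *)
Definition corrector (i j : 'I_2) p : R :=
  if i == j then tens i cutoff_area plateau^`() p + tens i plateau moment p
  else - 2^-1 * (tens i plateau tail p + tens i tail plateau p).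

Lemma other_neq i : (i == other i) = false.
Proof. by case: (ord2E i) => ->. Qed.

Lemma corrector_diag i : corrector i i =
  fun p => tens i cutoff_area plateau^`() p + tens i plateau moment p.
Proof. by apply/funext => p; rewrite /corrector eqxx. Qed.

Lemma corrector_other i : corrector i (other i) =
  fun p => - 2^-1 * (tens i plateau tail p + tens i tail plateau p).
Proof. by apply/funext => p; rewrite /corrector other_neq. Qed.

Lemma ord2_other i j : j = i \/ j = other i.
Proof. by case: (ord2E i) (ord2E j) => -> [] ->; [left|right|right|left]. Qed.

Lemma smooth_corrector i j : smooth (corrector i j).
Proof.
case: (ord2_other i j) => ->.
  rewrite corrector_diag.
  exact: (smoothD (smooth_tens i sab sb') (smooth_tens i sb sm)).
rewrite corrector_other.
exact: (smoothM (smooth_cst _) (smoothD (smooth_tens i sb st) (smooth_tens i st sb))).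
Qed.

Lemma corrector_sym i j p : corrector i j p = corrector j i p.
Proof.
case: (ord2_other i j) => -> //.
have o2 : other (other i) = i by case: (ord2E i) => ->.
have := corrector_other (other i); rewrite o2 corrector_other => ->.
by rewrite !tens_other [in RHS]addrC.
Qed.

Lemma pds_corrector_diag i : pds [:: i; i] (corrector i i) =
  fun p => tens i cutoff_area^`()^`() plateau^`() p + tens i plateau^`()^`() moment p.
Proof.
rewrite corrector_diag /= (pdD i (smooth_tens i sab sb') (smooth_tens i sb sm)).
rewrite (pd_tens i sab sb') (pd_tens i sb sm).
rewrite (pdD i (smooth_tens i sab' sb') (smooth_tens i sb' sm)).
by rewrite (pd_tens i sab' sb') (pd_tens i sb' sm).
Qed.

Lemma pds_corrector_other i : pds [:: other i; i] (corrector i (other i)) =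
  fun p => - 2^-1 * (tens i plateau^`() tail^`() p + tens i tail^`() plateau^`() p).
Proof.
have s1 := smoothD (smooth_tens i sb st) (smooth_tens i st sb).
have s2 := smoothD (smooth_tens i sb' st) (smooth_tens i st' sb).
rewrite corrector_other /= (pdZ i _ s1) (pdD i (smooth_tens i sb st) (smooth_tens i st sb)).
rewrite (pd_tens i sb st) (pd_tens i st sb) (pdZ _ _ s2).
rewrite (pdD _ (smooth_tens i sb' st) (smooth_tens i st' sb)).
by rewrite (pd_tens_other i sb' st) (pd_tens_other i st' sb).
Qed.

(** The diagonal entries contribute - phi_eps(x) b'(y) and - phi_eps(y) b'(x), the off-diagonal ones
    the opposite terms, because P' = - phi_eps. *)
Lemma cdivDiv_corrector : cdivDiv corrector = fun p =>
  area eps * (plateau^`()^`() p.1 * plateau^`() p.2 + plateau^`()^`() p.2 * plateau^`() p.1)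
  + (plateau^`()^`() p.1 * moment p.2 + plateau^`()^`() p.2 * moment p.1).
Proof.
apply/funext => p; rewrite /cdivDiv sum_ord22.
rewrite (pds_corrector_diag 0) (pds_corrector_diag 1).
rewrite (pds_corrector_other 0) (pds_corrector_other 1).
have alg (b1 b2 c1 c2 A1 A2 t1 t2 m1 m2 M1 M2 k : R) :
    A1 = k * c1 - m1 -> A2 = k * c2 - m2 -> t1 = - m1 -> t2 = - m2 ->
    (A1 * b2 + c1 * M2) + - 2^-1 * (b1 * t2 + t1 * b2)
      + (- 2^-1 * (b2 * t1 + t2 * b1) + (A2 * b1 + c2 * M1))
    = k * (c1 * b2 + c2 * b1) + (c1 * M2 + c2 * M1).
  by move=> -> -> -> ->; field.
exact: (alg _ _ _ _ _ _ _ _ _ _ _ _ _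
  (derive2_cutoff_area p.1) (derive2_cutoff_area p.2)
  (congr1 (fun e => e p.1) (derive1_tail C eps0)) (congr1 (fun e => e p.2) (derive1_tail C eps0))).
Qed.

End Corrector.

(** * The tensor that represents the Dirac distribution *)

Section EdgeData.
Variable R : realType.
Local Notation T := (@triangle R).
Implicit Types (p : R * R) (x y s t : R).
Variables (C eps : R).
Hypotheses (C0 : 0 < C) (eps0 : 0 < eps).

Local Notation bell := (bell C eps).
Local Notation mollifier := (mollifier C eps).
Local Notation tail := (tail C eps).
Local Notation moment := (moment C eps).
Local Notation corrector := (corrector C eps).
Local Notation cutoff_area := (cutoff_area C eps).
Local Notation v := (v_eps C eps).
Local Notation plateau := (@plateau R).

Lemma v_eps_co i : v = fun p =>
  - (co i p + co (other i) p) * bell (co i p * co i p + co (other i) p * co (other i) p).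
Proof.
apply/funext => p; rewrite /v_eps phi_epsE ?sqrtr_ge0// /mollifier.
rewrite sqr_sqrtr; last by rewrite addr_ge0 ?sqr_ge0.
by case: (ord2E i) => ->; rewrite !expr2 // [co 1 p + _]addrC [co 1 p * _ + _]addrC.
Qed.

Let sco i := @smooth_co R i.
Let slin i := smoothN (smoothD (sco i) (sco (other i))).
Let ssq i := smoothD (smoothM (sco i) (sco i)) (smoothM (sco (other i)) (sco (other i))).
Let sbell := smooth1_bell C eps.

Lemma smooth_v_eps : smooth v.
Proof. rewrite (v_eps_co 0); exact: (smoothM (slin 0) (smooth_comp sbell (ssq 0))). Qed.

(** The normal derivative of the squared radius vanishes on the leg, so only the linear factor is
    differentiated. *)
Lemma pd_v_eps i p : co i p = 0 -> pd i v p = - mollifier (co (other i) p).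
Proof.
move=> p0; rewrite (v_eps_co i) (pdM i (slin i) (smooth_comp sbell (ssq i))).
rewrite (pd_comp i sbell (ssq i)) (pdD i (smoothM (sco i) (sco i))).
rewrite (pdM i (sco i) (sco i)) (pdM i (sco (other i)) (sco (other i))).
rewrite (pdN i (smoothD (sco i) (sco (other i)))) (pdD i (sco i) (sco (other i))) !pd_co.
rewrite p0 eqxx [other i == i]eq_sym other_neq /mollifier expr2.
  by rewrite !mul0r !add0r !mulr0 !addr0 ?mulr0 ?add0r mulrN1.
exact: (smoothM (sco _) (sco _)).
Qed.

Definition edge_tensor (i j : 'I_2) p : R := iso v i j p + corrector i j p.

Hypotheses (eps_le : eps <= 1 / 16)
  (mass : (\int[@lebesgue_measure R]_(t in `[0, 1]) phi_eps C eps t)%R = 2^-1).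

Lemma edge_tensor_diag i : edge_tensor i i =
  fun p => v p + (tens i cutoff_area plateau^`() p + tens i plateau moment p).
Proof. by apply/funext => p; rewrite /edge_tensor /iso eqxx corrector_diag. Qed.

Lemma edge_tensor_other i : edge_tensor i (other i) =
  fun p => - 2^-1 * (tens i plateau tail p + tens i tail plateau p).
Proof. by apply/funext => p; rewrite /edge_tensor /iso other_neq add0r corrector_other. Qed.

Lemma smooth_iso_v i j : smooth (iso v i j).
Proof. by rewrite /iso; case: ifP => _; [exact: smooth_v_eps|exact: smooth_cst]. Qed.

Lemma smooth_edge_tensor i j : smooth (edge_tensor i j).
Proof. exact: (smoothD (smooth_iso_v i j) (smooth_corrector C eps0 i j)). Qed.

Lemma edge_tensor_sym i j p : edge_tensor i j p = edge_tensor j i p.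
Proof. by rewrite /edge_tensor corrector_sym /iso eq_sym; case: ifP. Qed.

Let p1 i p : co i p = 0 -> plateau (co i p) = 1.
Proof. by move=> ->; apply: (descent1 (@plateau_lt R)); lra. Qed.

(** On the leg Pi is 0 and b is 1; there remains - t phi_eps(t) + t phi_eps(t). *)
Lemma edge_tensor_normal0 i p : co i p = 0 -> edge_tensor i i p = 0.
Proof.
move=> p0; rewrite edge_tensor_diag (v_eps_co i) /tens (p1 p0) p0.
rewrite /cutoff_area area0 !mul0r !add0r mul1r /moment /mollifier expr2.
by rewrite mulNr addNr.
Qed.

Let sb := @smooth1_plateau R.
Let sb' := smooth1_derive1 sb.
Let st := smooth1_tail C eps0.
Let sm := smooth1_moment C eps.
Let sab : smooth1 cutoff_area := smooth1M (smooth1_area C eps0) sb.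

(** On the leg, v_eps contributes - phi_eps(t), the diagonal entry of K contributes b'(t)/2, and the
    doubled off-diagonal entry phi_eps(t) - b'(t)/2. *)
Lemma edge_tensor_flux0 i p : co i p = 0 ->
  pd i (edge_tensor i i) p + 2 * pd (other i) (edge_tensor 0 1) p = 0.
Proof.
move=> p0.
have -> : edge_tensor 0 1 = edge_tensor i (other i).
  by case: (ord2E i) => ->; apply/funext => q //; exact: edge_tensor_sym.
have s1 := smooth_tens i sab sb'; have s2 := smooth_tens i sb sm.
have s3 := smooth_tens i sb st; have s4 := smooth_tens i st sb.
rewrite edge_tensor_diag (pdD i smooth_v_eps (smoothD s1 s2)) (pdD i s1 s2).
rewrite (pd_tens i sab sb') (pd_tens i sb sm) (pd_v_eps p0).
rewrite edge_tensor_other (pdZ _ _ (smoothD s3 s4)) (pdD _ s3 s4).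
rewrite (pd_tens_other i sb st) (pd_tens_other i st sb) /tens.
have b0 : plateau^`() (co i p) = 0.
  by apply: derive1_plateau0; left; rewrite p0; lra.
have c0 : cutoff_area^`() (co i p) = 2^-1.
  apply: (etrans (congr1 (fun e => e (co i p)) (derive1_cutoff_area C eps0))).
  by rewrite /= b0 mulr0 add0r (p1 p0) mul1r p0 tail0.
have t0 : tail (co i p) = 2^-1 by rewrite p0 tail0.
have t1 := congr1 (fun e => e (co (other i) p)) (derive1_tail C eps0).
rewrite b0 c0 t0 (p1 p0).
move: t1 => /= ->; move: (mollifier _) (moment _) (plateau^`() _) => a b c; field=> //.
Qed.

(** The two coordinates cannot both be small: in every product one factor is beyond its support. *)
Lemma edge_tensor_support i j p : 0 < p.1 -> 0 < p.2 -> 7 / 8 <= p.1 + p.2 ->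
  edge_tensor i j p = 0.
Proof.
move=> h1 h2 h3.
have c0 k : 0 < co k p by case: (ord2E k) => ->.
have cs k : 7 / 8 <= co k p + co (other k) p.
  by case: (ord2E k) => -> //; rewrite addrC.
have e1 : eps < 1 by move: eps_le; lra.
have far k : eps <= co k p \/ eps <= co (other k) p.
  have [h|h] := leP eps (co k p); [by left|right].
  by move: eps_le h (cs k); lra.
have pl x : 3 / 8 <= x -> plateau x = 0 by exact: (descent0 (@plateau_lt R)).
have pl' x : 3 / 8 <= x -> plateau^`() x = 0 by move=> h; apply: derive1_plateau0; right.
have far' k x : 3 / 8 <= x \/ x < 3 / 8 by have [h|h] := leP (3 / 8) x; [left|right].
have n1 k : tens k cutoff_area plateau^`() p = 0.
  rewrite /tens /cutoff_area; have [h|h] := leP (3 / 8) (co k p).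
    by rewrite (pl _ h) mulr0 mul0r.
  by rewrite (pl' (co (other k) p)) ?mulr0//; move: h (cs k); lra.
have n2 k e : (forall x, eps <= x -> e x = 0) -> tens k plateau e p = 0.
  move=> H; rewrite /tens; have [h|h] := leP (3 / 8) (co k p).
    by rewrite (pl _ h) mul0r.
  by rewrite (H (co (other k) p)) ?mulr0//; move: eps_le h (cs k); lra.
have gm := moment_ge C eps0; have gt := tail_ge eps0 e1 mass.
case: (ord2_other i j) => ->.
  rewrite edge_tensor_diag n1 (n2 _ _ gm) !addr0 (v_eps_co 0) bell0 ?mulr0//.
  have sq k : eps <= co k p -> eps ^+ 2 <= co k p * co k p.
    by rewrite -expr2 => h; rewrite ler_sqr ?nnegrE ?(ltW eps0) ?(ltW (c0 k)).
  case: (far 0) => /sq h; first by rewrite (le_trans h)// lerDl -expr2 sqr_ge0.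
  by rewrite (le_trans h)// lerDr -expr2 sqr_ge0.
rewrite edge_tensor_other (n2 _ _ gt) -tens_other (n2 _ _ gt) addr0 mulr0.
by [].
Qed.

Lemma edge_tensor_corner : edge_tensor 0 1 (0, 0) = - 2^-1.
Proof.
have := edge_tensor_other 0; rewrite (_ : other 0 = 1)// => ->.
rewrite /tens /co /other /= tail0 /plateau (descent1 (@plateau_lt R)); first by field.
by lra.
Qed.

Lemma edge_pairing z : H2 z -> pairing edge_tensor (cdivDiv edge_tensor) z = delta0 z.
Proof.
move=> Hz; have [cz ez] := crepP Hz.
have sE := smooth_edge_tensor.
have [M [HM1 HM2]] := vanish_bounds (fun i => sE i i) edge_tensor_normal0
  (fun i => smoothD (smooth_pd i (sE i i))
     (smoothM (smooth_cst 2) (smooth_pd (other i) (sE 0 1)))) edge_tensor_flux0.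
rewrite (edge_formula sE edge_tensor_sym edge_tensor_support HM1 HM2 Hz cz ez).
rewrite edge_tensor_corner /delta0; move: (crep z (0, 0)) => x; field=> //.
Qed.

End EdgeData.

(** * A criterion for convergence to 0 in L_2(T) *)

Section Vanishing.
Variable R : realType.
Local Notation T := (@triangle R).
Implicit Types (p : R * R) (eps M : R).

(** Dominated convergence with a constant bound. The threshold d may depend on p: a fixed p leaves
    the supports of the concentrating terms as eps decreases. *)
Lemma nrm_cvg0 (F : R -> R * R -> R) (h M : R) : 0 < h ->
  (forall eps, 0 < eps <= h -> measT (F eps)) ->
  (forall eps p, 0 < eps <= h -> T p -> `|F eps p| <= M) ->
  (forall p, T p -> exists K, exists2 d, 0 < d &
    forall eps, 0 < eps <= h -> eps <= d -> `|F eps p| <= K * eps) ->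
  nrm (F eps) @[eps --> 0^'+] --> 0.
Proof.
move=> h0 mF bF cF; apply/cvg_at_rightP => u [u0 uc].
(* The sequence is below h only eventually; truncation makes the hypotheses available for every
   n. *)
pose w n := Num.min (u n) h.
have w0 n : 0 < w n <= h by rewrite lt_min u0 h0 ge_min lexx orbT.
have wc : w n @[n --> \oo] --> 0.
  apply: (squeeze_cvgr _ (@cvg_cst _ _ _ _ _) uc); near=> n.
  by have /andP[/ltW -> _] := w0 n; rewrite ge_min lexx.
have sq_cvg p : T p -> F (w n) p * F (w n) p @[n --> \oo] --> (0 : R).
  move=> Tp; suff c : F (w n) p @[n --> \oo] --> (0 : R).
    by rewrite -[X in _ --> X](mulr0 (0 : R)); exact: (cvgM c c).
  have [K [d d0 H]] := cF p Tp.
  apply/norm_cvg0P; have Kc : K * w n @[n --> \oo] --> (0 : R).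
    by rewrite -[X in _ --> X](mulr0 K); exact: (cvgMl_tmp wc).
  apply: (squeeze_cvgr _ (@cvg_cst _ _ _ _ _) Kc); near=> n.
  rewrite normr_ge0 /=; apply: (H _ (w0 n)); apply: ltW.
  by near: n; exact: (cvgr_lt _ wc d d0).
have c : intT (fun p => F (w n) p * F (w n) p) @[n --> \oo] --> intT (fun=> (0 : R)).
  apply: (intT_cvg (D := fun=> M ^+ 2) _ sq_cvg (L1_cst _) _).2 => n.
    exact: measTM (mF _ (w0 n)) (mF _ (w0 n)).
  move=> p Tp; have b := bF _ _ (w0 n) Tp.
  by rewrite normrM -expr2 lerXn2r ?nnegrE// (le_trans _ b).
suff cw : nrm (F (w n)) @[n --> \oo] --> (0 : R).
  apply: cvg_trans cw; apply: near_eq_cvg; near=> n; rewrite /w min_l//; apply: ltW.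
  by near: n; exact: (cvgr_lt _ uc h h0).
rewrite -[X in _ --> X]sqrtr0 -(intT0 R).
exact: (@continuous_cvg _ _ _ _ _ _ _ _ (@sqrt_continuous R _) c).
Unshelve. all: by end_near. Qed.

End Vanishing.

(** * The trace error as the functional of K, and its limit *)

Section TraceError.
Variable R : realType.
Local Notation T := (@triangle R).
Local Notation plateau := (@plateau R).
Implicit Types (z B : R * R -> R) (p : R * R) (A : 'I_2 -> 'I_2 -> R * R -> R).
Implicit Types l : (R * R -> R) -> R.

Lemma pairingD A A' B B' z :
  (forall i j, L2 (A i j)) -> (forall i j, L2 (A' i j)) -> L2 B -> L2 B' -> H2 z ->
  pairing (fun i j p => A i j p + A' i j p) (fun p => B p + B' p) z =
  pairing A B z + pairing A' B' z.
Proof.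
move=> LA LA' LB LB' Hz; rewrite /pairing /ipt (ipDl LB LB' (H2_L2 Hz)).
have e i j : ip (fun p => A i j p + A' i j p) (hessian z i j)
    = ip (A i j) (hessian z i j) + ip (A' i j) (hessian z i j).
  exact: (ipDl (LA i j) (LA' i j) (L2_hessian i j Hz)).
rewrite !sum_ord22 (e 0 0) (e 0 1) (e 1 0) (e 1 1).
have alg (a b c d f g h k x y : R) : x + y - (a + b + (c + d) + (f + g + (h + k))) =
    x - (a + c + (f + h)) + (y - (b + d + (g + k))) by ring.
exact: alg.
Qed.

Lemma H2dual_ext l l' : (forall z, H2 z -> l z = l' z) -> H2dual l' -> H2dual l.
Proof.
move=> ll' [lin [M HM]]; split; last by exists M => z Hz; rewrite ll'//; exact: HM.
move=> a z z' Hz Hz'.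
by rewrite (ll' _ (H2_lin a Hz Hz')) (ll' _ Hz) (ll' _ Hz') lin.
Qed.

Lemma H2dualN l : H2dual l -> H2dual (fun z => - l z).
Proof.
move=> [lin [M HM]]; split; last by exists M => z Hz; rewrite normrN; exact: HM.
by move=> a z z' Hz Hz'; rewrite lin// opprD mulrN.
Qed.

Lemma cdivDivD A A' : (forall i j, smooth (A i j)) -> (forall i j, smooth (A' i j)) ->
  cdivDiv (fun i j p => A i j p + A' i j p) = fun p => cdivDiv A p + cdivDiv A' p.
Proof.
move=> sA sA'; apply/funext => p; rewrite /cdivDiv -big_split; apply: eq_bigr => i _ /=.
rewrite -big_split; apply: eq_bigr => j _ /=.
by rewrite (pdD i (sA i j) (sA' i j)) (pdD j (smooth_pd i (sA i j)) (smooth_pd i (sA' i j))).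
Qed.

Lemma cdivDiv_iso (v : R * R -> R) : cdivDiv (iso v) = laplace v.
Proof.
apply/funext => p; rewrite /cdivDiv /laplace sum_ord22 sum_ord2.
have e0 i j : pds [:: i; j] (fun=> 0 : R) p = 0 by rewrite /= !pd_cst.
have e1 : pds [:: 1; 0] (iso v 0 1) p = 0 := e0 1 0.
have e2 : pds [:: 0; 1] (iso v 1 0) p = 0 := e0 0 1.
by rewrite e1 e2 addr0 add0r.
Qed.

Lemma norm_H2_0 : norm_H2 (fun=> 0 : R) = 0.
Proof.
rewrite /norm_H2 (_ : ip _ _ = 0); last first.
  by rewrite ipE -[RHS](intT0 R); apply: eq_intT => p _; rewrite mul0r.
rewrite add0r /ipt (_ : \sum_(i < 2) _ = 0) ?sqrtr0//.
rewrite big1// => i _; rewrite big1// => j _.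
have w := @H2_wD _ [:: i; j] _ (@H2_0 R) isT.
by apply: ip_ae0; [exact: L2_hessian (@H2_0 R)|exact: is_wD_unique w (is_wD0 _ _)].
Qed.

(** The zero function belongs to the unit ball, so the supremum is over a nonempty set of
    nonnegative values. *)
Lemma norm_H2dual_ge0 l : (0 <= norm_H2dual l)%E.
Proof.
apply: (@le_trans _ _ `|l (fun=> 0)|%:E); first by rewrite lee_fin.
by apply: ereal_sup_ubound; exists (fun=> 0); split; [exact: H2_0|rewrite norm_H2_0|].
Qed.

Lemma norm_H2dual_le l (M : R) : (forall z, H2 z -> `|l z| <= M * norm_H2 z) ->
  0 <= M -> (norm_H2dual l <= M%:E)%E.
Proof.
move=> H M0; apply: ge_ereal_sup => _ [z [Hz nz ->]]; rewrite lee_fin.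
by rewrite (le_trans (H z Hz))// -[leRHS]mulr1 ler_wpM2l.
Qed.

Section FixedWidth.
Variables (C eps : R).
Hypotheses (C0 : 0 < C) (eps0 : 0 < eps) (eps_le : eps <= 1 / 16).
Hypothesis mass : (\int[@lebesgue_measure R]_(t in `[0, 1]) phi_eps C eps t)%R = 2^-1.
Local Notation v := (v_eps C eps).
Local Notation K := (corrector C eps).

Let sK := smooth_corrector C eps0.
Let sv := smooth_v_eps C eps0.

(** The trace is minus the pairing of v_eps I, the Dirac distribution the pairing of v_eps I + K. *)
Lemma trace_error z : H2 z -> tr_Lap v z + delta0 z = pairing K (cdivDiv K) z.
Proof.
move=> Hz; have siso := smooth_iso_v C eps0.
rewrite -(edge_pairing eps0 eps_le mass Hz) (tr_Lap_pairing sv Hz).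
have e : cdivDiv (edge_tensor C eps) = fun p => laplace v p + cdivDiv K p.
  by rewrite -cdivDiv_iso; exact: (cdivDivD siso sK).
rewrite e.
have := pairingD (fun i j => L2_smooth (siso i j)) (fun i j => L2_smooth (sK i j))
  (L2_smooth (smooth_laplace sv)) (L2_smooth (smooth_cdivDiv sK)) Hz.
by move=> ->; rewrite addKr.
Qed.

Definition corrector_size : R := nrm (cdivDiv K) + \sum_(i < 2) \sum_(j < 2) nrm (K i j).

Lemma trace_error_bound :
  (norm_H2dual (fun z => (tr_Lap v z - (- delta0 z))%R) <= corrector_size%:E)%E.
Proof.
apply: norm_H2dual_le => [z Hz|].
  rewrite opprK (trace_error Hz).
  exact: (pairing_bound (fun i j => L2_smooth (sK i j)) (L2_smooth (smooth_cdivDiv sK)) Hz).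
by rewrite addr_ge0 ?nrm_ge0// sumr_ge0// => i _; rewrite sumr_ge0// => j _; exact: nrm_ge0.
Qed.

(** The moment is bounded but not uniformly small; it stays explicit because at a fixed point it
    becomes 0 as eps decreases. *)
Lemma corrector_diag_le M i p :
  (forall i p, T p -> `|plateau^`() (co i p)| <= M) -> T p ->
  `|K i i p| <= eps * M + `|moment C eps (co (other i) p)|.
Proof.
move=> HM Tp; have e1 : eps < 1 by move: eps_le; lra.
have x0 k : 0 <= co k p by case: Tp => /ltW h1 /ltW h2 _; case: (ord2E k) => ->.
have b1 x : `|plateau x| <= 1 by have /andP[h1 h2] := descent01 (1 / 8 : R) (3 / 8) x; rewrite ger0_norm.
rewrite corrector_diag (le_trans (ler_normD _ _))// lerD// /tens normrM.
  apply: ler_pM => //; last exact: HM.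
  rewrite /cutoff_area normrM -[leRHS]mulr1; apply: ler_pM => //.
  exact: (area_bound C0 eps0 e1 mass).
by rewrite -[leRHS]mul1r ler_wpM2r.
Qed.

Lemma corrector_other_le i p : T p ->
  `|K i (other i) p| <= `|tail C eps (co i p)| + `|tail C eps (co (other i) p)|.
Proof.
move=> Tp.
have b1 x : `|plateau x| <= 1 by have /andP[h1 h2] := descent01 (1 / 8 : R) (3 / 8) x; rewrite ger0_norm.
have h1 : `|plateau (co i p) * tail C eps (co (other i) p)| <= `|tail C eps (co (other i) p)|.
  by rewrite normrM -[leRHS]mul1r ler_wpM2r.
have h2 : `|tail C eps (co i p) * plateau (co (other i) p)| <= `|tail C eps (co i p)|.
  by rewrite normrM -[leRHS]mulr1 ler_wpM2l.
rewrite corrector_other normrM normrN (ger0_norm (_ : 0 <= 2^-1)) ?invr_ge0// /tens.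
have alg (x a b t1 t2 : R) : 0 <= x -> x <= a + b -> a <= t2 -> b <= t1 -> 2^-1 * x <= t1 + t2.
  by lra.
exact: (alg _ _ _ _ _ (normr_ge0 _) (ler_normD _ _) h1 h2).
Qed.

End FixedWidth.

Lemma co_bound (e : R -> R) : smooth1 e ->
  exists2 M, 0 <= M & forall i p, T p -> `|e (co i p)| <= M.
Proof.
move=> se.
have [M0 H0] := continuous_bounded_triangle (smooth_cont (smooth_comp se (smooth_co 0))).
have [M1 H1] := continuous_bounded_triangle (smooth_cont (smooth_comp se (smooth_co 1))).
exists (Num.max 0 (Num.max M0 M1)); first by rewrite le_max lexx.
move=> i p Tp; rewrite !le_max; case: (ord2E i) => ->.
  by rewrite H0 ?orbT.
by rewrite H1 ?orbT.
Qed.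

Section Limit.
Variable C : R.
Hypotheses (C0 : 0 < C) (mass : forall eps : R, 0 < eps < 1 ->
  (\int[@lebesgue_measure R]_(t in `[0, 1]) phi_eps C eps t)%R = 2^-1).

Let sb' := smooth1_derive1 (@smooth1_plateau R).
Let sb'' := smooth1_derive1 sb'.

Let small (eps : R) : 0 < eps <= 1 / 16 ->
  [/\ 0 < eps, eps <= 1 / 16, eps < 1 &
   (\int[@lebesgue_measure R]_(t in `[0, 1]) phi_eps C eps t)%R = 2^-1].
Proof.
move=> /andP[e0 e1]; have lt1 : eps < 1 by move: e1; lra.
by split => //; apply: mass; rewrite e0.
Qed.

Let co0 i p : T p -> 0 < co i p.
Proof. by case=> h1 h2 _; case: (ord2E i) => ->. Qed.

Let h16 : 0 < 1 / 16 :> R. Proof. by lra. Qed.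

Lemma nrm_corrector_cvg0 i j : nrm (corrector C eps i j) @[eps --> 0^'+] --> 0.
Proof.
have mK eps : 0 < eps <= 1 / 16 -> measT (corrector C eps i j).
  by move=> /small[e0 _ _ _]; exact: measT_smooth (smooth_corrector C e0 i j).
have [ij|ij] := ord2_other i j; move: mK; rewrite ij => mK.
  have [M M0 HM] := co_bound sb'.
  apply: (nrm_cvg0 (M := M + C) h16 mK) => [eps p he Tp|p Tp].
    have [e0 e16 e1 me] := small he.
    apply: (le_trans (corrector_diag_le C0 e0 e16 me i HM Tp)); rewrite lerD//.
      by rewrite -[leRHS]mul1r ler_wpM2r// ltW.
    exact: (moment_bound C0 e0 (ltW (co0 (other i) Tp))).
  (* Once eps is below the tangential coordinate, the moment is 0 and only the part of order eps is
     left. *)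
  exists M; exists (co (other i) p); first exact: co0.
  move=> eps he ed; have [e0 e16 e1 me] := small he.
  apply: (le_trans (corrector_diag_le C0 e0 e16 me i HM Tp)).
  by rewrite (moment_ge C e0 ed) normr0 addr0 mulrC.
apply: (nrm_cvg0 (M := 1 + 1) h16 mK) => [eps p he Tp|p Tp].
  have [e0 e16 e1 me] := small he.
  apply: (le_trans (corrector_other_le C eps i Tp)).
  by rewrite lerD// (tail_bound C0 e0 e1 me)// ltW// co0.
(* The off-diagonal entry is exactly 0 at p once eps is below both coordinates. *)
exists 0; exists (Num.min (co i p) (co (other i) p)); first by rewrite lt_min !co0.
move=> eps he; have [e0 e16 e1 me] := small he; rewrite le_min => /andP[h1 h2].
apply: (le_trans (corrector_other_le C eps i Tp)).
by rewrite (tail_ge e0 e1 me h1) (tail_ge e0 e1 me h2) normr0 addr0 mul0r.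
Qed.

Lemma cdivDiv_corrector_le M1 M2 eps p :
  (forall i p, T p -> `|plateau^`() (co i p)| <= M1) ->
  (forall i p, T p -> `|plateau^`()^`() (co i p)| <= M2) ->
  0 < eps <= 1 / 16 -> T p ->
  `|cdivDiv (corrector C eps) p| <=
    (M2 * M1 + M2 * M1) * eps + (M2 * `|moment C eps (co 1 p)| + M2 * `|moment C eps (co 0 p)|).
Proof.
move=> H1 H2 he Tp; have [e0 e16 e1 me] := small he.
rewrite (cdivDiv_corrector e0 e16 me).
have ka : `|area C eps eps| <= eps := area_bound C0 e0 e1 me (ltW e0).
have alg (k a1 a2 b1 b2 m1 m2 : R) : `|k| <= eps -> `|a1| <= M1 -> `|a2| <= M1 ->
    `|b1| <= M2 -> `|b2| <= M2 ->
    `|k * (b1 * a2 + b2 * a1) + (b1 * m2 + b2 * m1)| <=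
      (M2 * M1 + M2 * M1) * eps + (M2 * `|m2| + M2 * `|m1|).
  move=> hk h1 h2 h3 h4; apply: (le_trans (ler_normD _ _)); apply: lerD.
    rewrite normrM mulrC; apply: ler_pM => //.
    by apply: (le_trans (ler_normD _ _)); apply: lerD; rewrite normrM; apply: ler_pM.
  by apply: (le_trans (ler_normD _ _)); apply: lerD; rewrite normrM; apply: ler_wpM2r.
exact: (alg _ _ _ _ _ _ _ ka (H1 0 _ Tp) (H1 1 _ Tp) (H2 0 _ Tp) (H2 1 _ Tp)).
Qed.

Lemma nrm_cdivDiv_corrector_cvg0 : nrm (cdivDiv (corrector C eps)) @[eps --> 0^'+] --> 0.
Proof.
have mK eps : 0 < eps <= 1 / 16 -> measT (cdivDiv (corrector C eps)).
  by move=> /small[e0 _ _ _]; exact: measT_smooth (smooth_cdivDiv (smooth_corrector C e0)).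
have [M1 P1 H1] := co_bound sb'; have [M2 P2 H2] := co_bound sb''.
apply: (nrm_cvg0 (M := (M2 * M1 + M2 * M1) + (M2 * C + M2 * C)) h16 mK) => [eps p he Tp|p Tp].
  have [e0 e16 e1 me] := small he.
  have mb i := moment_bound C0 e0 (ltW (co0 i Tp)).
  apply: (le_trans (cdivDiv_corrector_le H1 H2 he Tp)); apply: lerD.
    by rewrite -[leRHS]mulr1 ler_wpM2l ?(ltW e1)// addr_ge0// mulr_ge0.
  by apply: lerD; apply: ler_wpM2l.
(* Below both coordinates the moments vanish, and the factor Pi(eps) of the remaining part is at
   most eps. *)
exists (M2 * M1 + M2 * M1); exists (Num.min (co 0 p) (co 1 p)).
  by rewrite lt_min !co0.
move=> eps he; have [e0 e16 e1 me] := small he; rewrite le_min => /andP[h1 h2].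
apply: (le_trans (cdivDiv_corrector_le H1 H2 he Tp)).
by rewrite (moment_ge C e0 h1) (moment_ge C e0 h2) normr0 !mulr0 !addr0.
Qed.

Lemma corrector_size_cvg0 : corrector_size C eps @[eps --> 0^'+] --> 0.
Proof.
have -> : corrector_size C = fun eps => nrm (cdivDiv (corrector C eps)) +
    (nrm (corrector C eps 0 0) + nrm (corrector C eps 0 1)
     + (nrm (corrector C eps 1 0) + nrm (corrector C eps 1 1))).
  by apply/funext => eps; rewrite /corrector_size sum_ord22.
have e : (0 : R) = 0 + (0 + 0 + (0 + 0)) by rewrite !addr0.
rewrite [X in _ --> X]e; apply: cvgD nrm_cdivDiv_corrector_cvg0 _.
by apply: cvgD; apply: cvgD; exact: nrm_corrector_cvg0.
Qed.

Lemma trace_error_cvg0 :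
  norm_H2dual (fun z => tr_Lap (v_eps C eps) z - (- delta0 z)) @[eps --> 0^'+] --> 0%E.
Proof.
have c : (corrector_size C eps)%:E @[eps --> 0^'+] --> 0%E.
  by apply: cvg_EFin; [near=> eps|exact: corrector_size_cvg0].
apply: (squeeze_cvge _ (@cvg_cst _ _ _ _ _) c); near=> eps.
rewrite norm_H2dual_ge0 /=.
have he : 0 < eps <= 1 / 16.
  by apply/andP; split; near: eps; [exact: nbhs_right_gt|exact: nbhs_right_le].
by have [e0 e16 e1 me] := small he; exact: trace_error_bound.
Unshelve. all: by end_near. Qed.

End Limit.
End TraceError.

Theorem theorem18 (R : realType) (C : R) (hC : 0 < C)
    (hint : forall eps : R, 0 < eps < 1 ->
      (\int[@lebesgue_measure R]_(t in `[0, 1]) phi_eps C eps t)%R = 2^-1) :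
  [/\ Hdual_divDiv (@delta0 R),
      (forall eps : R, 0 < eps < 1 ->
         HLap (v_eps C eps) /\ H2dual (tr_Lap (v_eps C eps))) &
      norm_H2dual (fun z => tr_Lap (v_eps C eps) z - (- delta0 z))
        @[eps --> 0^'+] --> 0%E].
Proof.
split; last exact: trace_error_cvg0 hC hint.
(* The Dirac distribution is independent of the width, so one admissible value suffices; 1/16 is the
   largest that [edge_pairing] accepts. *)
- pose eps : R := 1 / 16.
  have e01 : 0 < eps < 1 by apply/andP; split; rewrite /eps; lra.
  have mass := hint eps e01; have /andP[e0 _] := e01.
  have sE := smooth_edge_tensor C e0.
  have dE z : H2 z -> delta0 z = pairing (edge_tensor C eps) (cdivDiv (edge_tensor C eps)) z.
    by move=> Hz; rewrite (edge_pairing e0 (lexx _) mass Hz).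
  split.
    exact: H2dual_ext dE (pairing_H2dual (fun i j => L2_smooth (sE i j))
      (L2_smooth (smooth_cdivDiv sE))).
  exists (edge_tensor C eps); first exact: HdivDiv_smooth sE (@edge_tensor_sym _ C eps).
  by move=> z Hz; rewrite (dE z Hz) (pairing_divDiv sE Hz).
- move=> eps /andP[e0 _]; have sv := smooth_v_eps C e0.
  split; first exact: HLap_smooth.
  apply: (H2dual_ext (fun z => tr_Lap_pairing sv)); apply: H2dualN.
  exact: pairing_H2dual (fun i j => L2_smooth (smooth_iso_v C e0 i j))
    (L2_smooth (smooth_laplace sv)).
Qed.
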